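(* Let $X\in\mathbb{R}^{n\times p}$ be a fixed design matrix with $p\le n$ and full column rank, $\lambda>0$, and $K_{X,\lambda}=\{X\theta:\theta\in\mathbb{R}^p,\ \|\theta\|_1\le\lambda\}$. Consider the two-sided likelihood ratio test of $H_0:\mu=\mu_0$ versus $H_1:\mu\in K_{X,\lambda}$, where $\mu_0\in K_{X,\lambda}$. Suppose $p\to\infty$. For $\mu\in K_{X,\lambda}$ let $\mathfrak{p}_{\lambda,\mu}=\mathbb{P}_\mu(\|\hat\theta^0\|_1\ge\lambda)$, where $\hat\theta^0=(X^\top X)^{-1}X^\top Y$. (1) There exists a universal constant $C>0$ such that, for $\mu_0\in K_{X,\lambda}$, under $Y=\mu_0+\xi$, $$d_{\mathrm{TV}}\left(\frac{T(Y)-m_{\mu_0}}{\sigma_{\mu_0}},\mathcal{N}(0,1)\right)\le\frac{C\sqrt{p+n\,\mathfrak{p}_{\lambda,\mu_0}^{1/2}}}{\big(p-C(n\,\mathfrak{p}_{\lambda,\mu_0})^2\big)_+}.$$ Consequently $\mathbb{E}_{\mu_0}\Psi_{\mathrm{ts}}(Y;m_{\mu_0},\sigma_{\mu_0})=\alpha+\mathcal{O}(p^{-1/2})$, provided that $n\,\mathfrak{p}_{\lambda,\mu_0}^{1/2}=\mathfrak{o}(1)$. (2) Suppose $n\cdot(\mathfrak{p}_{\lambda,\mu}^{1/2}\vee\mathfrak{p}_{\lambda,\mu_0}^{1/2})=\mathfrak{o}(1)$. For any $\mu\in K_{X,\lambda}$ (satisfying this), $\mathbb{E}_\mu\Psi_{\mathrm{ts}}(Y;m_{\mu_0},\sigma_{\mu_0})\to1$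 if and only if $\|\mu-\mu_0\|\gg p^{1/4}$.
   Context: Model: $Y=\mu+\xi$, $\xi$ standard Gaussian in $\mathbb{R}^n$; $\mathbb{P}_\mu,\mathbb{E}_\mu,\mathrm{Var}_\mu$ refer to mean $\mu$; $\|\cdot\|$ is the Euclidean and $\|\cdot\|_1$ the $\ell_1$ norm. With $K=K_{X,\lambda}$ and $\Pi_K$ the metric projection onto $K$ (so that $\Pi_K(Y)=X\hat\theta$, with $\hat\theta$ the minimizer of $\|Y-X\theta\|^2$ over $\|\theta\|_1\le\lambda$), $T(Y)=\|Y-\mu_0\|^2-\|Y-\Pi_K(Y)\|^2$, $m_\mu=\mathbb{E}_\mu T(Y)$, $\sigma_\mu^2=\mathrm{Var}_\mu(T(Y))$. For fixed $\alpha\in(0,1)$, $\Psi_{\mathrm{ts}}(Y;m_{\mu_0},\sigma_{\mu_0})=\mathbf{1}\big(|T(Y)-m_{\mu_0}|/\sigma_{\mu_0}>z_{\alpha/2}\big)$ with $\mathbb{P}(\mathcal{N}(0,1)\ge z_\alpha)=\alpha$. $d_{\mathrm{TV}}$ is total variation distance, $\sup_B|\mathbb{P}(X\in B)-\mathbb{P}(Z\in B)|$. $a_+=\max\{a,0\}$; $c/0=+\infty$ for $c>0$. Asymptotics are as $n\to\infty$; $p,X,\lambda,\mu_0,\mu$ may depend on $n$. For nonnegative sequences $a_n\gg b_n$ means $a_n/b_n\to\infty$; $a\vee b=\max\{a,b\}$. *)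

(* Defs.v *)
From HB Require Import structures.
From mathcomp Require Import all_boot all_order all_algebra.
From mathcomp Require Import all_classical all_reals all_analysis.
Set Implicit Arguments.
Unset Strict Implicit.
Unset Printing Implicit Defensive.
Import Order.TTheory GRing.Theory Num.Theory.
Import numFieldNormedType.Exports.
Local Open Scope classical_set_scope.
Local Open Scope ring_scope.

(* The library norm `|x| on matrices is the sup norm, hence these two. *)
Definition enorm (R : realType) (n : nat) (x : 'cV[R]_n) : R :=
  Num.sqrt (\sum_i x i 0 ^+ 2).

Definition l1norm (R : realType) (n : nat) (x : 'cV[R]_n) : R :=
  \sum_i `|x i 0|.

Definition lasso_set (R : realType) (n p : nat) (X : 'M[R]_(n, p)) (lambda : R)
    : set 'cV[R]_n :=
  [set X *m theta | theta in [set theta : 'cV[R]_p | l1norm theta <= lambda]].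

(* A junk value 0 is returned when y has no nearest point in K; for the
   nonempty compact convex lasso_set the nearest point exists and is unique. *)
Definition metric_proj (R : realType) (n : nat) (K : set 'cV[R]_n)
    (y : 'cV[R]_n) : 'cV[R]_n :=
  xget 0 [set v | K v /\ forall w, K w -> enorm (y - v) <= enorm (y - w)].

Definition lr_stat (R : realType) (n : nat) (K : set 'cV[R]_n)
    (mu0 y : 'cV[R]_n) : R :=
  enorm (y - mu0) ^+ 2 - enorm (y - metric_proj K y) ^+ 2.

Definition ols (R : realType) (n p : nat) (X : 'M[R]_(n, p)) (y : 'cV[R]_n)
    : 'cV[R]_p :=
  invmx (X^T *m X) *m X^T *m y.

(* z_alpha, where P(N(0,1) >= z_alpha) = alpha *)
Definition normal_upper_quantile (R : realType) (alpha : R) : R :=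
  xget 0 [set z : R | normal_prob 0 1 `[z, +oo[%classic = alpha%:E].

Definition lrt_two_sided (R : realType) (n : nat) (K : set 'cV[R]_n)
    (mu0 : 'cV[R]_n) (alpha m sigma : R) (y : 'cV[R]_n) : R :=
  (normal_upper_quantile (alpha / 2) < `|lr_stat K mu0 y - m| / sigma)%R%:R.

Definition dTV (R : realType) (P Q : set R -> \bar R) : \bar R :=
  ereal_sup [set `|P B - Q B|%E | B in [set B : set R | measurable B]].

Section GaussianModel.
Context (R : realType) (n : nat) (d : measure_display) (Omega : measurableType d)
  (P : probability Omega R).

(* In the second clause, taking B i = setT for the unwanted coordinates gives
   the product rule for every subfamily. *)
Definition standard_gaussian (xi : 'I_n -> {RV P >-> R}) : Prop :=
  (forall (i : 'I_n) (B : set R), measurable B ->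
    distribution P (xi i) B = normal_prob 0 1 B) /\
  (forall B : 'I_n -> set R, (forall i, measurable (B i)) ->
    P (\bigcap_i (xi i @^-1` B i)) = (\prod_(i < n) P (xi i @^-1` B i))%E).

(* Y = mu + xi; P_mu, E_mu and Var_mu refer to the law of obs mu xi under P. *)
Definition obs (mu : 'cV[R]_n) (xi : 'I_n -> {RV P >-> R}) (w : Omega)
    : 'cV[R]_n :=
  mu + \col_i xi i w.

Definition stat_mean (K : set 'cV[R]_n) (mu0 mu : 'cV[R]_n)
    (xi : 'I_n -> {RV P >-> R}) : R :=
  fine 'E_P[fun w => lr_stat K mu0 (obs mu xi w)].

Definition stat_sd (K : set 'cV[R]_n) (mu0 mu : 'cV[R]_n)
    (xi : 'I_n -> {RV P >-> R}) : R :=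
  Num.sqrt (fine 'V_P[fun w => lr_stat K mu0 (obs mu xi w)]).

Definition std_stat_law (K : set 'cV[R]_n) (mu0 : 'cV[R]_n)
    (xi : 'I_n -> {RV P >-> R}) : set R -> \bar R :=
  pushforward P (fun w =>
    (lr_stat K mu0 (obs mu0 xi w) - stat_mean K mu0 mu0 xi)
      / stat_sd K mu0 mu0 xi).

Definition exit_prob (p : nat) (X : 'M[R]_(n, p)) (lambda : R) (mu : 'cV[R]_n)
    (xi : 'I_n -> {RV P >-> R}) : R :=
  fine (P [set w | lambda <= l1norm (ols X (obs mu xi w))]).

(* E_mu Psi_ts(Y; m_mu0, sigma_mu0) *)
Definition power_two_sided (K : set 'cV[R]_n) (alpha : R) (mu0 mu : 'cV[R]_n)
    (xi : 'I_n -> {RV P >-> R}) : R :=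
  fine 'E_P[fun w => lrt_two_sided K mu0 alpha (stat_mean K mu0 mu0 xi)
                       (stat_sd K mu0 mu0 xi) (obs mu xi w)].

End GaussianModel.

(* Main.v *)
Require Import Defs.
From HB Require Import structures.
From mathcomp Require Import all_boot all_order all_algebra.
From mathcomp Require Import ring lra.
From mathcomp Require Import all_classical all_reals all_analysis.
From mathcomp Require Import measurable_realfun.
Import Order.TTheory GRing.Theory Num.Theory.
Import numFieldNormedType.Exports.
Set Implicit Arguments.
Unset Strict Implicit.
Unset Printing Implicit Defensive.
Local Open Scope classical_set_scope.
Local Open Scope ring_scope.

(** Let [H] be the orthogonal projection onto the column space of [X] (the matrix
   [hat X]), [K] the lasso set and [q] the exit probability at [mu0]. By Pythagoras
   the statistic is [|H Y - mu0|^2] minus the squared distance from [H Y] to [K].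
   For [Y = mu0 + xi] this is [T = W - D], where [W = |H xi|^2] is a chi-square variable
   with [p] degrees of freedom and the defect [D >= 0] vanishes unless the least
   squares fit leaves the l1 ball, an event of probability [q].

   - The defect is negligible in mean and variance ([defect_moments]). Whatever the
     convex set [K], the function [D] is [C^{1,1}] with [|grad D|^2 = 4 D]
     ([resid_step]), so the Gaussian Poincare inequality ([gaussian_poincare]) gives
     [Var D <= pi^2 E D]. If [q <= 1/2] then Cauchy-Schwarz gives
     [2 (E D)^2 <= E D^2]. Together these bound [E D] and [Var D] by absolute
     constants; hence the mean and variance of [T] are [p + O(1)] and
     [2 p + O(sqrt p)].

   - The chi-square part is nearly normal ([chisq_tv]). Gaussian integration by parts
     gives [E ((W - p) f(W)) = 2 E (W f'(W))] ([chisq_ibp]). Combined with the bounded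
     solution of Stein's equation ([stein_solution]) this gives a normal approximation
     of rate [1 / sqrt p] for continuous test functions with values in [[0, 1]], and
     by density in L1 for all Borel sets ([tv_of_continuous]).

   - Since [T = W] off the exit event, the total variation distance is at most
     [q + O(1 / sqrt p)]. Whenever [C (n q)^2 < p], the inequality [p <= n] forces
     [q <= 1 / sqrt p], which gives the first part ([null_dTV_bound]); the level of the
     test ([size_error]) follows since the normal law gives mass [alpha] to the
     rejection region.

   - Under the mean [mu], put [Delta = |mu - mu0|^2]. Off the exit event at [mu],
     [T = W + 2 <xi, mu - mu0> + Delta], and the linear term has variance [4 Delta].
     If [Delta] is much larger than [sqrt p], the order of the standard deviation of
     [W], Chebyshev's inequality gives power tending to 1 ([miss_le]). If [Delta] is at
     most [M sqrt p], the linear term is of smaller order and the normalised statistic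
     is close to a normal variable with mean in [[0, M]], which is accepted with
     probability bounded below ([miss_ge]). *)

(** * Gaussian integrals on the line *)

Section Gaussian1D.
Context {R : realType}.
Notation mu := (@lebesgue_measure R).
Notation gam := (normal_prob (0:R) 1).
Notation phi := (normal_pdf (0:R) 1).

(** The Radon-Nikodym derivative of the normal law is only known almost
   everywhere; it is identified with the density through its integrals. *)
Lemma integral_gauss (f : R -> \bar R) : measurable_fun setT f ->
  (forall x, 0 <= f x)%E ->
  (\int[gam]_x f x = \int[mu]_x (f x * (phi x)%:E))%E.
Proof.
move=> mf f0.
have dom : (gam `<< mu) by exact: normal_prob_dominates.
rewrite -(Radon_Nikodym_SigmaFinite.change_of_variables dom)//=.
apply: ae_eq_integral => //=.
- apply: emeasurable_funM => //.
  apply: (measurable_int mu).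
  exact: Radon_Nikodym_SigmaFinite.f_integrable.
- apply: emeasurable_funM => //; apply/measurable_EFinP.
  exact: measurable_normal_pdf.
- apply: ae_eqe_mul2l => /=.
  apply: integral_ae_eq => //=.
  + exact: Radon_Nikodym_SigmaFinite.f_integrable.
  + by apply/measurable_EFinP; exact: measurable_normal_pdf.
  + move=> E _ mE; rewrite -Radon_Nikodym_SigmaFinite.f_integral//.
Qed.

Lemma phiE x : phi x = normal_peak 1 * expR (- (x ^+ 2 / 2)) :> R.
Proof. by rewrite normal_pdfE// /normal_fun subr0 expr1n mulNr. Qed.

Lemma lebesgue_affine (f : R -> \bar R) (a b : R) : 0 < a ->
  measurable_fun setT f -> (forall x, 0 <= f x)%E ->
  (\int[mu]_x f x = a%:E * \int[mu]_x f (a * x + b)%R)%E.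
Proof.
move=> a0 mf f0.
pose g := fun x : measurableTypeR R => (a * x + b : measurableTypeR R).
have mg : measurable_fun setT g.
  by apply: measurable_funD => //; apply: measurable_funM.
pose nu' : {measure set (measurableTypeR R) -> \bar R} := pushforward mu g.
pose nu := nu' mg.
pose an : {nonneg R} := NngNum (ltW a0).
have E : forall A, measurable A -> mu A = mscale an nu A.
  apply: lebesgue_measure_unique => _ [[u v] _ <-].
  rewrite -[RHS]/(a%:E * mu (g @^-1` `]u, v]%classic))%E.
  have -> : g @^-1` `]u, v] = `](u - b) / a, (v - b) / a]%classic.
    apply/seteqP; split=> x /=; rewrite !in_itv/= /g.
      move=> /andP[h1 h2]; apply/andP; split.
        by rewrite ltr_pdivrMr// ltrBlDr mulrC.
      by rewrite ler_pdivlMr// lerBrDr mulrC.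
    rewrite ltr_pdivrMr// ltrBlDr mulrC => /andP[-> /=].
    by rewrite ler_pdivlMr// lerBrDr mulrC.
  rewrite !lebesgue_measure_itv/= !lte_fin ltr_pM2r ?invr_gt0//.
  rewrite ltrD2r; case: ifP => _; last by rewrite mule0.
  rewrite -EFinD -EFinM; congr EFin; field; exact: lt0r_neq0.
rewrite (@eq_measure_integral _ _ _ _ (mscale an nu))//; last first.
  by move=> A mA _; exact: E.
rewrite ge0_integral_mscale//=; congr (_ * _)%E.
by rewrite ge0_integral_pushforward//=.
Qed.

(** The rotation is done in two steps, each an affine change of one variable:
   [(x, y)] to [(c x + s y, y)], then [(u, y)] to [(u, (y - s u) / c)]. Hence Tonelli
   and the one-dimensional substitution suffice, at the price of [0 < c]. *)
Lemma rotation_gauss (c s : R) (f : R * R -> \bar R) : 0 < c -> c ^+ 2 + s ^+ 2 = 1 ->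
  measurable_fun setT f -> (forall x, 0 <= f x)%E ->
  (\int[gam]_x \int[gam]_y f (c * x + s * y, - s * x + c * y)%R
   = \int[gam]_x \int[gam]_y f (x, y))%E.
Proof.
move=> c0 cs mf f0.
pose q := fun z : R * R => (f z * (phi z.1)%:E * (phi z.2)%:E)%E.
have phi0 x : (0 <= (phi x)%:E :> \bar R)%E by rewrite lee_fin normal_pdf_ge0.
have q0 z : (0 <= q z)%E by rewrite /q !mule_ge0.
have mphi1 : measurable_fun setT (fun z : R * R => (phi z.1)%:E).
  apply/measurable_EFinP; apply: (measurableT_comp (measurable_normal_pdf _ _)) => //.
have mphi2 : measurable_fun setT (fun z : R * R => (phi z.2)%:E).
  apply/measurable_EFinP; apply: (measurableT_comp (measurable_normal_pdf _ _)) => //.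
have mq : measurable_fun setT q.
  by do 2 apply: emeasurable_funM => //.
have mphi : measurable_fun setT (fun z : R => (phi z)%:E).
  by apply/measurable_EFinP; exact: measurable_normal_pdf.
have sec g : measurable_fun setT g -> (forall x, 0 <= g x)%E ->
   (\int[gam]_x \int[gam]_y g (x, y)
   = \int[mu]_x \int[mu]_y (g (x, y) * (phi x)%:E * (phi y)%:E))%E.
  move=> mg g0; rewrite integral_gauss//=.
  - apply: eq_integral => x _.
    rewrite integral_gauss//=; last exact: (measurableT_comp mg).
    rewrite [LHS]muleC.
    under [RHS]eq_integral do rewrite -muleA muleCA.
    rewrite ge0_integralZl//=.
      by apply: emeasurable_funM => //; exact: (measurableT_comp mg).
    by move=> y _; rewrite mule_ge0.
  - exact: (@measurable_fun_fubini_tonelli_F _ _ _ _ _ gam g).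
  - by move=> x; exact: integral_ge0.
rewrite (sec f)//.
have mrot : measurable_fun setT
   (fun z : R * R => (c * z.1 + s * z.2, - s * z.1 + c * z.2)%R).
  by apply/measurable_fun_pair => //=; apply: measurable_funD => //; apply: measurable_funM.
pose rot := fun z : R * R => (c * z.1 + s * z.2, - s * z.1 + c * z.2)%R.
apply: (etrans (sec (f \o rot) (measurableT_comp mf mrot) (fun z => f0 (rot z)))).
rewrite /rot/=.
have qrot x y : (f (c * x + s * y, - s * x + c * y)%R * (phi x)%:E * (phi y)%:E
   = q (c * x + s * y, - s * x + c * y)%R)%E.
  rewrite /q/= -!muleA -!EFinM; congr (_ * _%:E)%E.
  have E (u v : R) : phi u * phi v = normal_peak 1 ^+ 2 * expR (- ((u ^+ 2 + v ^+ 2) / 2)).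
    by rewrite !phiE mulrDl opprD expRD; ring.
  have e : x ^+ 2 + y ^+ 2 = (c * x + s * y) ^+ 2 + (- s * x + c * y) ^+ 2.
    by rewrite -[LHS]mul1r -cs; ring.
  by apply: (etrans (E _ _)); rewrite e; exact: (esym (E _ _)).
transitivity (\int[mu]_x \int[mu]_y (q \o rot) (x, y))%E.
  by apply: eq_integral => x _; apply: eq_integral => y _; exact: qrot.
have mqr : measurable_fun setT (q \o rot) by exact: measurableT_comp.
have qr0 z : (0 <= (q \o rot) z)%E by exact: q0.
apply: (etrans (@fubini_tonelli _ _ _ _ _ mu mu _ mqr qr0)).
have ci0 : 0 < c^-1 by rewrite invr_gt0.
have cn0 : c != 0 by exact: lt0r_neq0.
pose q2 := fun z : R * R => q (z.2, (- s * z.2 + z.1) / c)%R.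
have q20 z : (0 <= q2 z)%E by exact: q0.
have mq2 : measurable_fun setT q2.
  apply: (measurableT_comp mq); apply/measurable_fun_pair => //=.
  by apply: measurable_funM => //; apply: measurable_funD => //; apply: measurable_funM.
transitivity (\int[mu]_y (c^-1%:E * \int[mu]_u q2 (y, u)))%E.
  apply: eq_integral => y _.
  have -> := @lebesgue_affine (fun u => q2 (y, u)) c (s * y) c0
    (measurableT_comp mq2 (pair1_measurable y)) (fun u => q20 (y, u)).
  rewrite muleA -EFinM mulVf// mul1e.
  apply: eq_integral => x _; rewrite /q2/=; congr (q (_, _)).
  apply: (mulIf cn0); rewrite -mulrA mulVf// mulr1.
  have -> : - s * (c * x + s * y) + y = - s * c * x + (1 - s ^+ 2) * y by ring.
  have -> : 1 - s ^+ 2 = c ^+ 2 by rewrite -cs addrK.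
  by rewrite /=; ring.
rewrite ge0_integralZl//=; last 3 first.
- exact: (@measurable_fun_fubini_tonelli_F _ _ _ _ _ mu q2).
- by move=> x _; exact: integral_ge0.
- by rewrite lee_fin ltW.
rewrite [X in (_ * X)%E](@fubini_tonelli _ _ _ _ _ mu mu q2)//.
rewrite -ge0_integralZl//=; last 3 first.
- exact: (@measurable_fun_fubini_tonelli_G _ _ _ _ _ mu q2).
- by move=> x _; exact: integral_ge0.
- by rewrite lee_fin ltW.
apply: eq_integral => u _.
have -> := @lebesgue_affine (fun v => q (u, v)) c^-1 (- s * u / c) ci0
    (measurableT_comp mq (pair1_measurable u)) (fun v => q0 (u, v)).
apply: (congr1 (fun z => c^-1%:E * z)%E); apply: eq_integral => y _.
by rewrite /q2/= mulrDl addrC [y / c]mulrC.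
Qed.

Lemma integral_gaussR (f : R -> R) : measurable_fun setT f ->
  (\int[gam]_x (f x)%:E = \int[mu]_x (f x * phi x)%:E)%E.
Proof.
move=> mf.
have mfE : measurable_fun setT (EFin \o f) by exact/measurable_EFinP.
have p0 x : 0 <= phi x by exact: normal_pdf_ge0.
rewrite [LHS]integralE [RHS]integralE.
congr (_ - _)%E.
  rewrite integral_gauss//; last exact: measurable_funepos.
  apply: eq_integral => x _; rewrite !funeposE/= -!EFin_max -EFinM.
  by rewrite maxr_pMl ?mul0r.
rewrite integral_gauss//; last exact: measurable_funeneg.
apply: eq_integral => x _; rewrite !funenegE/= -!EFin_max -EFinM.
by rewrite maxr_pMl ?mul0r ?mulNr.
Qed.

(** Quartic growth covers every integrand met below
   (at most a quadratic function of a quadratic form); against the normal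
   density such functions are dominated by a multiple of the density of
   variance 2. *)
Lemma quartic_le_exp (x : R) : 1 + x ^+ 4 <= 64 * expR (x ^+ 2 / 4).
Proof.
have -> : expR (x ^+ 2 / 4) = expR (x ^+ 2 / 8) ^+ 2.
  by rewrite -expRM_natl; congr expR; lra.
have := expR_ge1Dx (x ^+ 2 / 8).
have := sqr_ge0 x; rewrite (_ : x ^+ 4 = x ^+ 2 ^+ 2); last by rewrite -exprM.
move: (x ^+ 2) => y; move: (expR _) => e; nra.
Qed.

Let sq2 : (Num.sqrt 2 : R) != 0. Proof. by rewrite gt_eqF// sqrtr_gt0. Qed.

Lemma quartic_le_pdf : exists A : R, 0 <= A /\
  forall x, (1 + x ^+ 4) * phi x <= A * normal_pdf 0 (Num.sqrt 2) x.
Proof.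
exists (64 * normal_peak 1 / normal_peak (Num.sqrt 2)); split.
  by rewrite !mulr_ge0 ?invr_ge0 ?normal_peak_ge0.
move=> x; rewrite (normal_pdfE _ sq2)// mulrA divfK; last first.
  by rewrite gt_eqF// normal_peak_gt0.
have -> : normal_fun 0 (Num.sqrt 2) x = expR (x ^+ 2 / 4) * expR (- (x ^+ 2 / 2)).
  rewrite -expRD /normal_fun subr0 sqr_sqrtr//; congr expR; lra.
rewrite phiE.
have ca0 : 0 <= normal_peak 1 * expR (- (x ^+ 2 / 2)).
  by rewrite mulr_ge0 ?expR_ge0 ?normal_peak_ge0.
apply: (le_trans (ler_wpM2r ca0 (quartic_le_exp x))).
by rewrite le_eqVlt; apply/orP; left; apply/eqP; ring.
Qed.

Lemma integrable_phi (f : R -> R) A : measurable_fun setT f ->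
  (forall x, `|f x| <= A * (1 + x ^+ 4)) ->
  mu.-integrable setT (EFin \o (fun x => f x * phi x)).
Proof.
move=> mf fA.
have A0 : 0 <= A by have := le_trans (normr_ge0 _) (fA 0); rewrite expr0n addr0 mulr1.
have [B [B0 hB]] := quartic_le_pdf.
apply: (@le_integrable _ _ _ mu setT measurableT _
    (EFin \o (fun x => (A * B) * normal_pdf 0 (Num.sqrt 2) x))).
- by apply/measurable_EFinP; apply: measurable_funM => //; exact: measurable_normal_pdf.
- move=> x _ /=; rewrite lee_fin [leRHS]ger0_norm ?mulr_ge0 ?normal_pdf_ge0//.
  rewrite normrM (ger0_norm (normal_pdf_ge0 _ _ _)).
  apply: (@le_trans _ _ (A * (1 + x ^+ 4) * phi x)).
    by rewrite ler_wpM2r ?normal_pdf_ge0.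
  by rewrite -!mulrA ler_wpM2l.
- exact: (integrableZl measurableT (A * B) (integrable_normal_pdf 0 (Num.sqrt 2))).
Qed.

Lemma integrable_gauss (f : R -> R) A : measurable_fun setT f ->
  (forall x, `|f x| <= A * (1 + x ^+ 4)) -> gam.-integrable setT (EFin \o f).
Proof.
move=> mf fA; apply/integrableP; split; first exact/measurable_EFinP.
rewrite integral_gauss//; last by apply: measurableT_comp => //; exact/measurable_EFinP.
have /integrableP[_] := integrable_phi mf fA; congr (_ < _)%E.
apply: eq_integral => x _; rewrite /= -EFinM normrM; congr (_ * _)%:E.
by rewrite ger0_norm// normal_pdf_ge0.
Qed.

End Gaussian1D.

Section GaussianIBP.
Context {R : realType}.
Notation mu := (@lebesgue_measure R).
Notation gam := (normal_prob (0:R) 1).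
Notation phi := (normal_pdf (0:R) 1).

Lemma is_derive_phi (x : R) : is_derive x 1 phi (- x * phi x).
Proof.
have -> : phi = (fun x : R => normal_peak 1 * expR (- (x ^+ 2 / 2))).
  by apply/funext => y; exact: phiE.
apply: is_derive_eq.
rewrite /GRing.scale/= !mulr0 !mulr1 add0r; move: (expR _) (normal_peak _) => e q; by field.
Qed.

(** The boundary terms of the integration by parts on [[-k, k]] are controlled
   by an explicit rate [1/k]. *)
Lemma phi_quartic_bound : exists A : R, 0 <= A /\
  forall k, (1 + k%:R ^+ 4) * phi k%:R <= A * k.+1%:R^-1 /\
   (1 + (- k%:R) ^+ 4) * phi (- k%:R) <= A * k.+1%:R^-1.
Proof.
have [A [A0 hA]] := @quartic_le_pdf R.
have sq2 : (Num.sqrt 2 : R) != 0 by rewrite gt_eqF// sqrtr_gt0.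
exists (A * (normal_peak (Num.sqrt 2) * 4)); split.
  by rewrite !mulr_ge0 ?normal_peak_ge0.
move=> k.
have H : forall x : R, x ^+ 2 = k%:R ^+ 2 ->
    (1 + x ^+ 4) * phi x <= A * (normal_peak (Num.sqrt 2) * 4) * k.+1%:R^-1.
  move=> x xk; apply: (le_trans (hA x)); rewrite -!mulrA ler_wpM2l//.
  rewrite (normal_pdfE _ sq2) ler_wpM2l ?normal_peak_ge0//.
  rewrite /normal_fun subr0 sqr_sqrtr// xk.
  have -> : - k%:R ^+ 2 / (2 *+ 2) = - (k%:R ^+ 2 / 4) :> R by field.
  rewrite expRN -[4 in leRHS]invrK -invfM lef_pV2 ?posrE ?expR_gt0 ?mulr_gt0 ?invr_gt0//.
  apply: le_trans (expR_ge1Dx _).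
  have := ler0n R k; have := sqr_ge0 (k%:R - 1 : R).
  have -> : k.+1%:R = k%:R + 1 :> R by rewrite natr1.
  move: (k%:R : R) => t h1 h2; nra.
by split; apply: H => //; rewrite sqrrN.
Qed.

(** The function [(u phi)' = (u' - x u) phi] integrates over [[-k, k]] to boundary
   terms of [u phi], which vanish as [k] grows. *)
Lemma gauss_ibp (u v : R -> R) (A : R) :
  (forall x : R, is_derive x 1 u (v x)) -> continuous v ->
  (forall x, `|u x| <= A * (1 + x ^+ 4)) ->
  (forall x, `|x * u x| <= A * (1 + x ^+ 4)) ->
  (forall x, `|v x| <= A * (1 + x ^+ 4)) ->
  \int[gam]_x (x * u x) = \int[gam]_x (v x).
Proof.
move=> du cv bu bxu bv.
pose w x := u x * phi x.
pose dw x := (v x - x * u x) * phi x.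
have wd (x : R) : is_derive x 1 w (dw x).
  have := is_derive_phi x => dphi.
  apply: is_derive_eq; rewrite /dw /GRing.scale/=; ring.
have cu : continuous u.
  by move=> x; apply: differentiable_continuous; apply/derivable1_diffP; apply: ex_derive.
have cphi : continuous phi by apply: continuous_normal_pdf.
have cdw : continuous dw.
  move=> x; apply: cvgM; last exact: cphi.
  apply: cvgB; first exact: cv.
  by apply: cvgM; [exact: cvg_id|exact: cu].
have cw : continuous w by move=> x; apply: cvgM; [exact: cu|exact: cphi].
have mv : measurable_fun setT v by apply: continuous_measurable_fun.
have mu' : measurable_fun setT u by apply: continuous_measurable_fun.
have mxu : measurable_fun setT (fun x : R => x * u x) by apply: measurable_funM.
have iv := integrable_gauss mv bv.
have ixu := integrable_gauss mxu bxu.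
apply/esym/eqP; rewrite -subr_eq0 -RintegralB//; apply/eqP.
have mvu : measurable_fun setT (fun x : R => v x - x * u x) by apply: measurable_funB.
rewrite /Rintegral integral_gaussR//.
have A0 : 0 <= A.
  by have := le_trans (normr_ge0 _) (bu 0); rewrite expr0n addr0 mulr1.
have idw : mu.-integrable setT (EFin \o dw).
  apply: (@integrable_phi _ _ (2 * A)) => // x.
  by apply: (le_trans (ler_normB _ _)); have := bv x; have := bxu x; lra.
pose I := fun k : nat => `[- k%:R, k%:R]%classic : set R.
have mI k : measurable (I k) by exact: measurable_itv.
have ftc k : (\int[mu]_(x in I k.+1) (dw x)%:E = (w k.+1%:R - w (- k.+1%:R))%:E)%E.
  rewrite EFinB; apply: continuous_FTC2.
  - by rewrite gtrN// ltr0n.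
  - by apply: continuous_subspaceT.
  - split; first by move=> x _; apply: ex_derive.
    + by apply: cvg_at_right_filter; exact: cw.
    + by apply: cvg_at_left_filter; exact: cw.
  - by move=> x _; rewrite derive1E; apply: derive_val.
have mf_ k : measurable_fun setT (fun x : R => ((dw \_ (I k.+1)) x)%:E).
  apply/measurable_EFinP; apply/(measurable_restrictT _ (mI _)).
  by apply: measurable_funS (continuous_measurable_fun cdw).
have mdw : measurable_fun setT (fun x : R => (dw x)%:E).
  by apply/measurable_EFinP; exact: continuous_measurable_fun.
have dcv : {ae mu, forall x, setT x -> (fun k => ((dw \_ (I k.+1)) x)%:E) @ \oo --> (dw x)%:E}.
  apply: aeW => x _; apply: cvg_near_cst.
  exists (Num.truncn `|x|) => // k /= kx; rewrite patchE ifT// inE /I/= in_itv/=.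
  rewrite -ler_norml; apply: ltW; apply: (lt_le_trans (truncnS_gt _)).
  by rewrite ler_nat.
have ddw : {ae mu, forall x k, setT x -> (`|((dw \_ (I k.+1)) x)%:E| <= (`|dw x|)%:E)%E}.
  apply: aeW => x k _ /=; rewrite patchE; case: ifP => // _.
  by rewrite lee_fin normr0.
have [_ _ dc] := @dominated_convergence _ _ _ mu setT measurableT _ _ _ mf_ mdw dcv (integrable_abse idw) ddw.
have Ek k : (\int[mu]_x ((dw \_ (I k.+1)) x)%:E = (w k.+1%:R - w (- k.+1%:R))%:E)%E.
  rewrite -ftc [in RHS]integral_mkcond; apply: eq_integral => x _.
  by rewrite !patchE; case: ifP.
have {}dc : (w k.+1%:R - w (- k.+1%:R))%:E @[k --> \oo] --> (\int[mu]_x (dw x)%:E)%E.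
  by move: dc; rewrite (eq_cvg _ _ Ek).
have Z : (w k.+1%:R - w (- k.+1%:R))%:E @[k --> \oo] --> (0%:E : \bar R).
  apply: cvg_EFin; first by near=> k.
  have [B [B0 hB]] := phi_quartic_bound.
  have hb : (fun k : nat => A * B * 2 * (k.+1%:R^-1 : R)) @ \oo --> (0:R).
    rewrite -(mulr0 (A * B * 2)); apply: cvgMr; exact: cvg_harmonic.
  apply/cvgr0Pnorm_le => e e0.
  near=> k => /=.
  have h1 : forall x, (1 + x ^+ 4) * phi x <= B * k.+2%:R^-1 -> `|w x| <= A * B * k.+1%:R^-1.
    move=> x h; rewrite /w normrM (ger0_norm (normal_pdf_ge0 _ _ _)).
    apply: (@le_trans _ _ (A * (1 + x ^+ 4) * phi x)).
      by rewrite ler_wpM2r// normal_pdf_ge0.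
    rewrite -!mulrA ler_wpM2l//; apply: (le_trans h); rewrite ler_wpM2l//.
    by rewrite lef_pV2 ?posrE ?ltr0n// ler_nat.
  apply: (le_trans (ler_normB _ _)).
  have [/h1 q1 /h1 q2] := hB k.+1.
  apply: (@le_trans _ _ (A * B * 2 * k.+1%:R^-1)).
    apply: (le_trans (lerD q1 q2)); rewrite le_eqVlt; apply/orP; left; apply/eqP; ring.
  apply: le_trans (ler_norm _) _.
  by near: k; move/cvgr0Pnorm_le : hb; apply.
by rewrite (cvg_unique _ dc Z).
Unshelve. all: by end_near. Qed.

End GaussianIBP.

(** * Families of independent standard normal variables *)

Section Transfer.
Context {R : realType} d d' (T : measurableType d) (T' : measurableType d').

Definition mkmfun (X : T -> T') (mX : measurable_fun setT X) : {mfun T >-> T'} :=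
  HB.pack X (isMeasurableFun.Build _ _ _ _ X mX).

Definition law (P : probability T R) (X : T -> T') (mX : measurable_fun setT X) :
  probability T' R := distribution P (mkmfun mX).

Lemma integral_law (P : probability T R) (X : T -> T') (mX : measurable_fun setT X)
    (f : T' -> R) : measurable_fun setT f ->
  (\int[P]_w (f (X w))%:E = \int[law P mX]_y (f y)%:E)%E.
Proof.
move=> mf.
have mfE : measurable_fun setT (EFin \o f) by exact/measurable_EFinP.
rewrite [LHS]integralE [RHS]integralE; congr (_ - _)%E; apply/esym.
  have mp := measurable_funepos mfE.
  apply: (etrans (@ge0_integral_pushforward _ _ _ _ R X mX P setT _ measurableT mp
    (fun y _ => funepos_ge0 _ y))).
  by rewrite preimage_setT; apply: eq_integral => w _; rewrite /= !funeposE.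
have mp := measurable_funeneg mfE.
apply: (etrans (@ge0_integral_pushforward _ _ _ _ R X mX P setT _ measurableT mp
  (fun y _ => funeneg_ge0 _ y))).
by rewrite preimage_setT; apply: eq_integral => w _; rewrite /= !funenegE.
Qed.

End Transfer.

Section Family.
Context {R : realType}.
Notation gam := (normal_prob (0:R) 1).

(** Laws on [I -> R] live on the sigma-algebra generated by the measurable
   rectangles; rectangles are stable under intersection, so a probability is
   determined by their masses. *)
Definition rect (I : finType) : set (set (I -> R)) :=
  [set A | exists2 B : I -> set R, (forall i, measurable (B i)) &
     A = [set x | forall i, B i (x i)]].

Notation cylT I := (g_sigma_algebraType (@rect I)).

Lemma measurable_coord (I : finType) (i : I) :
  measurable_fun setT (fun x : cylT I => x i).
Proof.
move=> _ Y mY; rewrite setTI; apply: sub_sigma_algebra.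
exists (fun j => if j == i then Y else setT).
  by move=> j; case: ifP.
apply/seteqP; split=> x /=.
  by move=> h j; case: eqP => [->|].
by move=> /(_ i); rewrite eqxx.
Qed.

Lemma measurable_family d (T : measurableType d) (I : finType) (xi : I -> T -> R) :
  (forall i, measurable_fun setT (xi i)) ->
  measurable_fun setT (fun w => (fun i => xi i w) : cylT I).
Proof.
move=> mxi; apply: (@measurability _ _ T (cylT I) setT _ (@rect I)) => //.
move=> _ [_ [B mB ->] <-]; rewrite setTI.
rewrite (_ : _ @^-1` _ = \big[setI/setT]_(i in I) (xi i @^-1` B i)).
  by apply: bigsetI_measurable => i _; rewrite -[_ @^-1` _]setTI; exact: mxi.
apply/seteqP; split=> w /=.
  by move=> h; elim/big_ind : _ => // i _; exact: h.
by move=> h i; move: h; rewrite (bigD1 i)//= => -[].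
Qed.

Lemma gf_event d (T : measurableType d) (I : finType) (xi : I -> T -> R) (C : I -> set R) :
  (forall i, measurable_fun setT (xi i)) -> (forall i, measurable (C i)) ->
  measurable [set w | forall i, C i (xi i w)].
Proof.
move=> mz mC; have := measurable_family mz => /(_ measurableT [set x | forall i, C i (x i)]).
by rewrite setTI; apply; apply: sub_sigma_algebra; exists C.
Qed.

Section gf.
Context d (T : measurableType d).

(** A single product formula encodes both the marginal laws and independence.
   The index set is an arbitrary finite type so that a family and an
   independent copy of it form one family indexed by [I + I]. *)
Record gaussian_family (P : probability T R) (I : finType) (xi : I -> T -> R) : Prop :=
  GaussianFamily {
    gf_meas : forall i, measurable_fun setT (xi i) ;
    gf_prod : forall B : I -> set R, (forall i, measurable (B i)) ->
      P [set w | forall i, B i (xi i w)] = (\prod_(i : I) gam (B i))%E }.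

End gf.

Lemma gaussian_law_unique d d' (T : measurableType d) (T' : measurableType d')
    (P : probability T R) (Q : probability T' R) (I : finType)
    (xi : I -> T -> R) (eta : I -> T' -> R) :
  gaussian_family P xi -> gaussian_family Q eta ->
  forall A : set (cylT I), measurable A ->
  P [set w | A (fun i => xi i w)] = Q [set w | A (fun i => eta i w)].
Proof.
move=> [mxi pxi] [meta peta] A mA.
have mX := measurable_family mxi; have mY := measurable_family meta.
apply: (@measure_unique _ R (cylT I) (@rect I) (fun=> setT) _ _ _ _ (law P mX) (law Q mY)) => //.
- move=> _ _ [B mB ->] [C mC ->]; exists (fun i => B i `&` C i).
    by move=> i; exact: measurableI.
  apply/seteqP; split=> x /=.
    by move=> [h1 h2] i; split.
  by move=> h; split=> i; have [] := h i.
- by move=> _; exists (fun=> setT) => //; apply/seteqP; split.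
- by rewrite bigcup_const//; exists 0%N.
- by move=> _ [B mB ->]; rewrite [LHS]pxi// [RHS]peta.
- by move=> _; apply: (le_lt_trans (probability_le1 _ _)) => //; rewrite ltry.
Qed.

Lemma gaussian_integral_unique d d' (T : measurableType d) (T' : measurableType d')
    (P : probability T R) (Q : probability T' R) (I : finType)
    (xi : I -> T -> R) (eta : I -> T' -> R) :
  gaussian_family P xi -> gaussian_family Q eta ->
  forall F : cylT I -> R, measurable_fun setT F ->
  (\int[P]_w (F (fun i => xi i w))%:E = \int[Q]_w (F (fun i => eta i w))%:E)%E.
Proof.
move=> gxi geta F mF.
have mX := measurable_family (gf_meas gxi); have mY := measurable_family (gf_meas geta).
rewrite (integral_law P mX mF) (integral_law Q mY mF).
apply: eq_measure_integral => A mA _.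
exact: gaussian_law_unique gxi geta A mA.
Qed.

(** Replacing some coordinates by those of an independent copy does not change
   the law: this is how an expectation is conditioned on the other
   coordinates. *)
Lemma gaussian_merge d d' (T : measurableType d) (T' : measurableType d')
    (P : probability T R) (Q : probability T' R) (I : finType)
    (xi : I -> T -> R) (eta : I -> T' -> R) (S : pred I) :
  gaussian_family P xi -> gaussian_family Q eta ->
  gaussian_family (P \x Q)%E (fun i z => if S i then eta i z.2 else xi i z.1).
Proof.
move=> [mxi pxi] [meta peta]; split.
  move=> i /=; case: (S i).
    exact: (measurableT_comp (meta i) measurable_snd).
  exact: (measurableT_comp (mxi i) measurable_fst).
move=> B mB.
pose B1 i := if S i then setT else B i.
pose B2 i := if S i then B i else setT.
have -> : [set z : T * T' | forall i, B i (if S i then eta i z.2 else xi i z.1)] =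
   [set w | forall i, B1 i (xi i w)] `*` [set w | forall i, B2 i (eta i w)].
  apply/seteqP; split=> -[w1 w2] /=.
    by move=> h; split=> i; have := h i; rewrite /B1 /B2; case: ifP.
  by move=> [h1 h2] i; have := h1 i; have := h2 i; rewrite /B1 /B2; case: ifP.
have mB1 i : measurable (B1 i) by rewrite /B1; case: ifP.
have mB2 i : measurable (B2 i) by rewrite /B2; case: ifP.
rewrite [LHS](@product_measure1E _ _ _ _ R P Q); [|exact: gf_event|exact: gf_event].
transitivity ((\prod_(i : I) gam (B1 i)) * (\prod_(i : I) gam (B2 i)))%E.
  by congr (_ * _)%E; [exact: pxi|exact: peta].
rewrite -big_split/=; apply: eq_bigr => i _.
by rewrite /B1 /B2; case: ifP => _; rewrite probability_setT ?mul1e ?mule1.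
Qed.

End Family.

Section Rotation.
Context {R : realType}.
Notation gam := (normal_prob (0:R) 1).
Notation cylT I := (g_sigma_algebraType (@rect R I)).

Lemma gaussian_pair d d' (T : measurableType d) (T' : measurableType d')
    (P : probability T R) (Q : probability T' R) (I J : finType)
    (xi : I -> T -> R) (eta : J -> T' -> R) :
  gaussian_family P xi -> gaussian_family Q eta ->
  gaussian_family (P \x Q)%E
    (fun k z => match k with inl i => xi i z.1 | inr j => eta j z.2 end).
Proof.
move=> [mxi pxi] [meta peta]; split.
  case=> [i|j] /=.
    exact: (measurableT_comp (mxi i) measurable_fst).
  exact: (measurableT_comp (meta j) measurable_snd).
move=> B mB.
set E := [set z | _].
have -> : E = [set w | forall i, B (inl i) (xi i w)] `*` [set w | forall j, B (inr j) (eta j w)].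
  apply/seteqP; split=> -[w1 w2] /=.
    by move=> h; split=> [i|j]; [exact: (h (inl i))|exact: (h (inr j))].
  by move=> [h1 h2] [i|j].
rewrite [LHS](@product_measure1E _ _ _ _ R P Q);
  [|exact: (@gf_event _ _ _ _ _ (fun i => B (inl i)))|exact: (@gf_event _ _ _ _ _ (fun i => B (inr i)))].
rewrite big_sumType/=.
by congr (_ * _)%E; [exact: (pxi (fun i => B (inl i)))|exact: (peta (fun i => B (inr i)))].
Qed.

Lemma gf_coord d (T : measurableType d) (P : probability T R) (I : finType)
    (xi : I -> T -> R) (i : I) (B : set R) : gaussian_family P xi -> measurable B ->
  P [set w | B (xi i w)] = gam B.
Proof.
move=> [mxi pxi] mB.
have := pxi (fun j => if j == i then B else setT).
rewrite (bigD1 i)//= eqxx big1 ?mule1; last first.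
  by move=> j /negbTE ->; exact: probability_setT.
move=> <-; last by move=> j; case: ifP.
congr (P _); apply/seteqP; split=> w /=.
  by move=> h j; case: eqP => [->|].
by move=> /(_ i); rewrite eqxx.
Qed.

Lemma gf_integral_coord d (T : measurableType d) (P : probability T R) (I : finType)
    (xi : I -> T -> R) (i : I) (f : R -> R) : gaussian_family P xi ->
  measurable_fun setT f ->
  (\int[P]_w (f (xi i w))%:E = \int[gam]_x (f x)%:E)%E.
Proof.
move=> g mf.
apply: (etrans (@integral_law R _ _ T (measurableTypeR R) P (xi i) (gf_meas g i) f mf)).
by apply: eq_measure_integral => A mA _; exact: gf_coord g mA.
Qed.

Definition rot2 (I : eqType) (c s : R) (j k : I) (x : I -> R) (l : I) : R :=
  if l == j then c * x j + s * x k else if l == k then - s * x j + c * x k else x l.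

Lemma gauss_rect_rotation (c s : R) (B B' : set R) : 0 < c -> c ^+ 2 + s ^+ 2 = 1 ->
  measurable B -> measurable B' ->
  (gam \x gam)%E [set z | B (c * z.1 + s * z.2) /\ B' (- s * z.1 + c * z.2)]
  = (gam B * gam B')%E.
Proof.
move=> c0 cs mB mB'.
have mBB : measurable (B `*` B') by exact: measurableX.
pose rot := fun z : R * R => (c * z.1 + s * z.2, - s * z.1 + c * z.2)%R.
have mrot : measurable_fun setT rot.
  by apply/measurable_fun_pair => //=; apply: measurable_funD => //; apply: measurable_funM.
have mE : measurable (rot @^-1` (B `*` B')) by rewrite -[_ @^-1` _]setTI; exact: mrot.
have I1 (X : set (R * R)) : measurable X ->
    (gam \x gam)%E X = (\int[gam]_x \int[gam]_y (\1_X (x, y) : R)%:E)%E.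
  move=> mX.
  have mi : measurable_fun setT (fun z : R * R => (\1_X z : R)%:E).
    by apply/measurable_EFinP; exact: measurable_indic.
  have i0 : forall z : R * R, (0%R <= (\1_X z : R)%:E)%E by move=> z; rewrite lee_fin.
  have e := @integral_indic _ _ R (gam \x gam)%E setT measurableT X mX.
  rewrite setIT in e; rewrite -e.
  exact: (@fubini_tonelli1 _ _ _ _ _ gam gam _ mi i0).
have mi : measurable_fun setT (fun z : R * R => (\1_(B `*` B') z : R)%:E).
  by apply/measurable_EFinP; exact: measurable_indic.
have i0 : forall z : R * R, (0%R <= (\1_(B `*` B') z : R)%:E)%E by move=> z; rewrite lee_fin.
transitivity ((gam \x gam)%E (rot @^-1` (B `*` B'))).
  by congr (_ _); apply/seteqP; split.
rewrite I1//.
transitivity (\int[gam]_x \int[gam]_y (\1_(B `*` B') (x, y) : R)%:E)%E.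
  exact: (rotation_gauss c0 cs mi i0).
by rewrite -I1// product_measure1E.
Qed.

(** The two rotated coordinates are taken from an independent copy, so that
   rotation invariance of the planar normal law applies to them alone. *)
Lemma gaussian_rot2 d (T : measurableType d) (P : probability T R) (I : finType)
    (xi : I -> T -> R) (j k : I) (c s : R) : j != k -> 0 < c -> c ^+ 2 + s ^+ 2 = 1 ->
  gaussian_family P xi ->
  gaussian_family P (fun l w => rot2 c s j k (xi^~ w) l).
Proof.
move=> jk c0 cs g; have mxi := gf_meas g; split.
  move=> l; rewrite /rot2; case: eqP => _; last case: eqP => _ //.
  - by apply: measurable_funD; apply: measurable_funM.
  - by apply: measurable_funD; apply: measurable_funM.
move=> B mB.
have mcoord := @measurable_coord R I.
pose A := [set x : cylT I | forall l, B l (rot2 c s j k x l)].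
have mA : measurable A.
  apply: (@gf_event _ _ (cylT I) I (fun l x => rot2 c s j k x l)) => // l.
  rewrite /rot2; case: eqP => _; last case: eqP => _ //.
  - by apply: measurable_funD; apply: measurable_funM.
  - by apply: measurable_funD; apply: measurable_funM.
pose S := [pred l : I | (l == j) || (l == k)].
have gm := gaussian_merge S g g.
apply: (etrans (gaussian_law_unique g gm mA)).
pose C1 l := if S l then setT else B l.
have mC1 l : measurable (C1 l) by rewrite /C1; case: ifP.
pose X := [set z : R * R | B j (c * z.1 + s * z.2) /\ B k (- s * z.1 + c * z.2)].
have mX : measurable X.
  have mrot : measurable_fun setT
      (fun z : R * R => (c * z.1 + s * z.2, - s * z.1 + c * z.2)%R).
    by apply/measurable_fun_pair => //=; apply: measurable_funD => //; apply: measurable_funM.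
  have := mrot measurableT (B j `*` B k); rewrite setTI; apply.
  exact: measurableX.
have mpair : measurable_fun setT (fun w => (xi j w, xi k w)).
  by apply/measurable_fun_pair.
have -> : [set w : T * T | A (fun i => if S i then xi i w.2 else xi i w.1)] =
   [set w | forall l, C1 l (xi l w)] `*` [set w | X (xi j w, xi k w)].
  apply/seteqP; split=> -[w1 w2].
    rewrite /A /X /= => h; split; last split.
    - move=> l; have := h l; rewrite /rot2 /C1 /=.
      by case: (l == j); case: (l == k).
    - by have := h j; rewrite /rot2 !eqxx /= orbT.
    - by have := h k; rewrite /rot2 !eqxx /= orbT eq_sym (negbTE jk).
  rewrite /A /X /= => -[h1 [h2 h3]] l; rewrite /rot2 /= !eqxx/= orbT.
  have [->//|lj] := eqVneq l j; have [->//|lk] := eqVneq l k.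
  by have := h1 l; rewrite /C1 /= (negbTE lj) (negbTE lk).
rewrite [LHS](@product_measure1E _ _ _ _ R P P); [|exact: gf_event|]; last first.
  by have := mpair measurableT X mX; rewrite setTI.
have EX : P [set w | X (xi j w, xi k w)] = (gam (B j) * gam (B k))%E.
  rewrite -(gauss_rect_rotation c0 cs)//.
  pose L := @law R _ _ T (measurableTypeR R * measurableTypeR R)%type P
    (fun w => (xi j w, xi k w)) mpair.
  apply/esym; apply: (@product_measure_unique _ _ (measurableTypeR R) (measurableTypeR R) R gam gam L) => //.
  move=> D D' mD mD'.
  have := gf_prod g (B := fun l => if l == j then D else if l == k then D' else setT).
  rewrite (bigD1 j)//= (bigD1 k)/= ?[k == j]eq_sym ?jk// eqxx (negbTE jk) eqxx big1 ?mule1.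
    move=> <-; last by move=> l; case: ifP => // _; case: ifP.
    congr (P _); apply/seteqP; split=> w /=.
      by move=> [h1 h2] l; case: eqP => [->//|_]; case: eqP => [->//|_].
    move=> h; split; first by have := h j; rewrite eqxx.
    by have := h k; rewrite eq_sym (negbTE jk) eqxx.
  by move=> l /andP[/negbTE -> /negbTE ->]; exact: probability_setT.
transitivity ((\prod_l gam (C1 l)) * (gam (B j) * gam (B k)))%E.
  by congr (_ * _)%E; [exact: gf_prod|exact: EX].
rewrite (bigD1 j)//= (bigD1 k)/= ?[k == j]eq_sym ?jk//.
rewrite [RHS](bigD1 j)//= [X in _ = (_ * X)%E](bigD1 k)/= ?[k == j]eq_sym ?jk//.
rewrite /C1/= !eqxx orbT /= !probability_setT !mul1e muleC -muleA.
congr (_ * (_ * _))%E; apply: eq_bigr => l /andP[/negbTE -> /negbTE ->] //.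
Qed.

(** Simultaneous rotation of the pairs [(x i, y i)], where [x] and [y] are the two
   halves of a family indexed by [I + I]. *)
Definition rotall (I : Type) (c s : R) (x : I + I -> R) (l : I + I) : R :=
  match l with
  | inl i => c * x (inl i) + s * x (inr i)
  | inr i => - s * x (inl i) + c * x (inr i)
  end.

Lemma gaussian_rotall d (T : measurableType d) (P : probability T R) (I : finType)
    (xi : I + I -> T -> R) (c s : R) : 0 < c -> c ^+ 2 + s ^+ 2 = 1 ->
  gaussian_family P xi ->
  gaussian_family P (fun l w => rotall c s (xi^~ w) l).
Proof.
move=> c0 cs g.
pose ind l := match l : I + I with inl i => i | inr i => i end.
pose part (r : seq I) l w := if ind l \in r then rotall c s (xi^~ w) l else xi l w.
(* The pairs are rotated one after the other, along the enumeration of [I]. *)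
have H (r : seq I) : uniq r -> gaussian_family P (part r).
  elim: r => [_|i r IH /= /andP[ir ur]].
    by rewrite (_ : part [::] = xi).
  have := gaussian_rot2 (j := inl i) (k := inr i) isT c0 cs (IH ur).
  congr gaussian_family; apply/funext => l; apply/funext => w.
  rewrite /rot2 /part /= (negbTE ir).
  case: l => l /=; rewrite inE.
    by rewrite (_ : (inl l == inl i) = (l == i))//; have [->|] := eqVneq l i.
  by rewrite (_ : (inr l == inr i) = (l == i))//; have [->|] := eqVneq l i.
have := H (enum I) (enum_uniq _); congr gaussian_family.
by apply/funext => l; apply/funext => w; rewrite /part mem_enum.
Qed.

End Rotation.

(** * Moments and integration by parts *)

Section Expect.
Context {R : realType}.
Notation gam := (normal_prob (0:R) 1).
Notation cylT I := (g_sigma_algebraType (@rect R I)).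

(** Dominating function for all the integrability statements. *)
Definition Q4 (I : finType) (x : I -> R) : R := 1 + \sum_i x i ^+ 4.

Lemma Rint_cst d (T : measurableType d) (P : probability T R) (c : R) :
  \int[P]_w c = c.
Proof.
rewrite Rintegral_cst//.
have e : fine (P setT) = 1 by rewrite probability_setT.
by apply: (etrans (congr1 (fun z => c * z) e)); rewrite mulr1.
Qed.

Lemma Rint_sum d (T : measurableType d) (P : probability T R) (I : finType)
    (f : I -> T -> R) : (forall i, P.-integrable setT (EFin \o f i)) ->
  \int[P]_w (\sum_i f i w) = \sum_i \int[P]_w f i w.
Proof.
move=> fi; rewrite /Rintegral.
rewrite (eq_integral (fun w => \sum_i (f i w)%:E)%E); last first.
  by move=> w _; rewrite -sumEFin.
rewrite integral_sum// -sum_fine// => i _.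
exact: (integrable_fin_num measurableT (fi i)).
Qed.

Lemma Q4_ge1 (I : finType) (x : I -> R) : 1 <= Q4 x.
Proof. by rewrite /Q4 lerDl; apply: sumr_ge0 => i _; rewrite exprn_even_ge0. Qed.

Lemma Q4_ge0 (I : finType) (x : I -> R) : 0 <= Q4 x.
Proof. exact: le_trans (Q4_ge1 x). Qed.

Lemma sqr_sum_le (I : finType) (a : I -> R) :
  (\sum_i a i) ^+ 2 <= #|I|%:R * \sum_i a i ^+ 2.
Proof.
rewrite expr2 big_distrlr/=.
apply: (@le_trans _ _ (\sum_i \sum_j (a i ^+ 2 + a j ^+ 2) / 2)).
  apply: ler_sum => i _; apply: ler_sum => j _.
  have := sqr_ge0 (a i - a j); nra.
rewrite (eq_bigr (fun i => (#|I|%:R * a i ^+ 2 + \sum_j a j ^+ 2) / 2)); last first.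
  move=> i _; rewrite -mulr_suml big_split/= sumr_const mulr_natl;
    congr ((_ *+ _ + _) / _); apply: eq_card.
rewrite /= -mulr_suml big_split/= -mulr_sumr sumr_const.
rewrite (_ : #|xpredT| = #|I|); last exact: eq_card.
by rewrite -mulr_natl le_eqVlt; apply/orP; left; apply/eqP; field.
Qed.

Lemma integrable_Q4 d (T : measurableType d) (P : probability T R) (I : finType)
    (xi : I -> T -> R) : gaussian_family P xi ->
  P.-integrable setT (EFin \o (fun w => Q4 (xi^~ w))).
Proof.
move=> g; have mxi := gf_meas g.
have -> : EFin \o (fun w => Q4 (xi^~ w)) = (fun w => 1%:E + \sum_(i : I) (xi i w ^+ 4)%:E)%E.
  by apply/funext => w; rewrite /= /Q4 EFinD -sumEFin.
apply: integrableD => //; first exact: finite_measure_integrable_cst.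
apply: integrable_sum => // i _; apply/integrableP; split.
  by apply/measurable_EFinP; exact: measurable_funX.
have mf : measurable_fun setT (fun x : R => `|x ^+ 4|).
  by apply: measurableT_comp => //; exact: measurable_funX.
have -> : (\int[P]_w `|(xi i w ^+ 4)%:E| = \int[P]_w (`|xi i w ^+ 4|)%:E)%E by [].
rewrite (gf_integral_coord i g mf).
have m4 : measurable_fun setT (fun x : R => x ^+ 4) by exact: measurable_funX.
have b4 (x : R) : `|x ^+ 4| <= 1 * (1 + x ^+ 4).
  by rewrite mul1r ger0_norm ?exprn_even_ge0// lerDr.
by have /integrableP[_ +] := integrable_gauss m4 b4.
Qed.

Lemma gf_integrable d (T : measurableType d) (P : probability T R) (I : finType)
    (xi : I -> T -> R) (f : T -> R) (A : R) : gaussian_family P xi ->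
  measurable_fun setT f -> (forall w, `|f w| <= A * Q4 (xi^~ w)) ->
  P.-integrable setT (EFin \o f).
Proof.
move=> g mf fA.
apply: (@le_integrable _ _ _ P setT measurableT _ (fun w => A%:E * (EFin \o (fun w => Q4 (xi^~ w))) w)%E).
- exact/measurable_EFinP.
- by move=> w _; rewrite /= lee_fin; apply: (le_trans (fA w)); exact: ler_norm.
- by apply: integrableZl => //; exact: integrable_Q4.
Qed.

Definition upd (I : eqType) (x : I -> R) (i : I) (t : R) : I -> R :=
  fun j => if j == i then t else x j.

Lemma Q4_upd (I : finType) (x : I -> R) i t : Q4 (upd x i t) <= Q4 x * (1 + t ^+ 4).
Proof.
have x0 : 0 <= \sum_(j | j != i) x j ^+ 4.
  by apply: sumr_ge0 => j _; rewrite exprn_even_ge0.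
rewrite /Q4 (bigD1 i)//= [in leRHS](bigD1 i)//= {1}/upd eqxx.
rewrite (eq_bigr (fun j => x j ^+ 4)); last by move=> j /negbTE ji; rewrite /upd ji.
have : 0 <= x i ^+ 4 by rewrite exprn_even_ge0.
have : 0 <= t ^+ 4 by rewrite exprn_even_ge0.
move: (x i ^+ 4) (t ^+ 4) (\sum_(j | j != i) x j ^+ 4) x0 => a b c; nra.
Qed.

Lemma measurable_upd (I : finType) (x : I -> R) i :
  measurable_fun setT (fun t : R => upd x i t : cylT I).
Proof.
apply: (@measurable_family R _ R I (fun j t => upd x i t j)) => j.
by rewrite /upd; case: (j == i).
Qed.

(** Averaging over one coordinate first reduces an identity between
   expectations to one between one-dimensional Gaussian integrals. *)
Lemma gf_resample d (T : measurableType d) (P : probability T R) (I : finType)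
    (xi : I -> T -> R) (i : I) (G : (I -> R) -> R) (A : R) : gaussian_family P xi ->
  measurable_fun setT (G : cylT I -> R) -> (forall x, `|G x| <= A * Q4 x) ->
  \int[P]_w G (xi^~ w) = \int[P]_w (\int[gam]_t G (upd (xi^~ w) i t)).
Proof.
move=> g mG GA.
have A0 : 0 <= A.
  have := le_trans (normr_ge0 _) (GA (fun=> 0)).
  by rewrite pmulr_lge0//; apply: lt_le_trans (Q4_ge1 _).
have gm := gaussian_merge (pred1 i) g g.
rewrite {1}/Rintegral (gaussian_integral_unique g gm mG) /Rintegral.
set f := (fun w : T * T => (G (fun j => if pred1 i j then xi j w.2 else xi j w.1))%:E).
have iP : (P \x P)%E.-integrable setT f.
  apply: (@gf_integrable _ _ (P \x P)%E I _ (fun w => G (fun j => if pred1 i j then xi j w.2 else xi j w.1)) A gm).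
    exact: (measurableT_comp mG (measurable_family (gf_meas gm))).
  by move=> w; exact: GA.
rewrite -(@integral12_prod_meas1 _ _ _ _ _ P P f iP) /fubini_F.
congr fine; apply: eq_integral => w _.
have mU : measurable_fun setT (fun t : R => G (upd (xi^~ w) i t)).
  by apply: (measurableT_comp mG); exact: measurable_upd.
rewrite fineK; last first.
  apply: integrable_fin_num => //.
  apply: (@integrable_gauss _ _ (A * Q4 (xi^~ w))) => // t.
  by apply: (le_trans (GA _)); rewrite -mulrA ler_wpM2l// Q4_upd.
apply: (etrans _ (gf_integral_coord i g mU)).
apply: eq_integral => y _; rewrite /f /=; congr ((G _)%:E).
by apply/funext => j; rewrite /upd/=; case: eqP => [->|].
Qed.

Lemma gf_ibp d (T : measurableType d) (P : probability T R) (I : finType)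
    (xi : I -> T -> R) (i : I) (U V : (I -> R) -> R) (A : R) : gaussian_family P xi ->
  measurable_fun setT (U : cylT I -> R) -> measurable_fun setT (V : cylT I -> R) ->
  (forall x (t : R), is_derive t 1 (fun s => U (upd x i s)) (V (upd x i t))) ->
  (forall x, continuous (fun t => V (upd x i t))) ->
  (forall x, `|U x| <= A * Q4 x) -> (forall x, `|x i * U x| <= A * Q4 x) ->
  (forall x, `|V x| <= A * Q4 x) ->
  \int[P]_w (xi i w * U (xi^~ w)) = \int[P]_w V (xi^~ w).
Proof.
move=> g mU mV dU cV bU bxU bV.
have A0 : 0 <= A.
  have := le_trans (normr_ge0 _) (bU (fun=> 0)).
  by rewrite pmulr_lge0//; apply: lt_le_trans (Q4_ge1 _).
have mxU : measurable_fun setT (fun x : cylT I => x i * U x).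
  by apply: measurable_funM => //; exact: measurable_coord.
rewrite (gf_resample i g mxU bxU) (gf_resample i g mV bV).
congr Rintegral; apply/funext => w.
have bnd (F : (I -> R) -> R) : (forall x, `|F x| <= A * Q4 x) ->
   forall t, `|F (upd (xi^~ w) i t)| <= A * Q4 (xi^~ w) * (1 + t ^+ 4).
  by move=> bF t; apply: (le_trans (bF _)); rewrite -mulrA ler_wpM2l// Q4_upd.
rewrite -(@gauss_ibp R (fun t => U (upd (xi^~ w) i t)) (fun t => V (upd (xi^~ w) i t))
   (A * Q4 (xi^~ w))) //; try exact: bnd.
- by congr Rintegral; apply/funext => t; rewrite {1}/upd eqxx.
- by move=> t; have := bnd _ bxU t; rewrite {1}/upd eqxx.
Qed.

Lemma sqr_sum_sqr_le_Q4 (I : finType) (x : I -> R) :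
  (1 + \sum_i x i ^+ 2) ^+ 2 <= 2 * (1 + #|I|%:R) * Q4 x.
Proof.
have h := sqr_sum_le (fun i => x i ^+ 2).
have e : \sum_i (x i ^+ 2) ^+ 2 = \sum_i x i ^+ 4 by apply: eq_bigr => i _; rewrite -exprM.
rewrite e in h; rewrite /Q4.
have : 0 <= \sum_i x i ^+ 4 by apply: sumr_ge0 => j _; rewrite exprn_even_ge0.
have := ler0n R #|I|.
move: h; move: (\sum_i x i ^+ 2) (\sum_i x i ^+ 4) (#|I|%:R) => a b c h c0 b0.
have := sqr_ge0 (a - 1); nra.
Qed.

Lemma sum_sqr_le_Q4 (I : finType) (x : I -> R) :
  (1 + \sum_i x i ^+ 2) <= 2 * (1 + #|I|%:R) * Q4 x.
Proof.
apply: le_trans (sqr_sum_sqr_le_Q4 x).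
have : 0 <= \sum_i x i ^+ 2 by apply: sumr_ge0 => j _; rewrite sqr_ge0.
move: (\sum_i _) => a; nra.
Qed.

(** Integration by parts gives [E (xi i * <a, xi>) = a i]; multiplying by [a i]
   and summing yields the second moment. *)
Lemma gf_linear_moment2 d (T : measurableType d) (P : probability T R) (I : finType)
    (xi : I -> T -> R) (a : I -> R) : gaussian_family P xi ->
  \int[P]_w ((\sum_i a i * xi i w) ^+ 2) = \sum_i a i ^+ 2.
Proof.
move=> g; have mxi := gf_meas g.
pose U (x : I -> R) := \sum_j a j * x j.
pose A := (1 + \sum_j `|a j|) * (2 * (1 + #|I|%:R)).
have a0 : 0 <= \sum_j `|a j| by apply: sumr_ge0.
have bx (x : I -> R) i : `|x i| ^+ 2 <= \sum_i x i ^+ 2.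
  rewrite (bigD1 i)//= real_normK ?num_real// lerDl sumr_ge0// => j _.
  exact: sqr_ge0.
have bU1 x : `|U x| <= (\sum_j `|a j|) * (1 + \sum_i x i ^+ 2).
  apply: (le_trans (ler_norm_sum _ _ _)); rewrite mulr_suml; apply: ler_sum => j _.
  rewrite normrM ler_wpM2l//.
  have := bx x j; have := sqr_ge0 (`|x j| - 1); move: `|x j| (\sum_i x i ^+ 2) => u v; nra.
have bxU1 x i : `|x i * U x| <= (\sum_j `|a j|) * (1 + \sum_i x i ^+ 2).
  rewrite /U mulr_sumr; apply: (le_trans (ler_norm_sum _ _ _)); rewrite mulr_suml.
  apply: ler_sum => j _; rewrite mulrCA normrM ler_wpM2l// normrM.
  have := bx x j; have := bx x i; have := sqr_ge0 (`|x j| - `|x i|).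
  move: `|x j| `|x i| (\sum_i x i ^+ 2) => u v w; nra.
have b1 (x : I -> R) : 1 <= 1 + \sum_i x i ^+ 2.
  by rewrite lerDl sumr_ge0// => i _; exact: sqr_ge0.
have lift (x : I -> R) (y : R) : y <= (\sum_j `|a j|) * (1 + \sum_i x i ^+ 2) -> y <= A * Q4 x.
  move=> h; apply: (le_trans h); rewrite /A -mulrA; apply: ler_pM => //.
  - by apply: le_trans (b1 x).
  - by rewrite lerDr.
  - exact: sum_sqr_le_Q4.
have bV (x : I -> R) i : `|a i| <= A * Q4 x.
  apply: lift; rewrite -[leLHS]mulr1 ler_pM// (bigD1 i)//= lerDl sumr_ge0// => j _.
have mU : measurable_fun setT (U : cylT I -> R).
  by apply: measurable_sum => j; apply: measurable_funM => //; exact: measurable_coord.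
have E i : \int[P]_w (xi i w * U (xi^~ w)) = a i.
  have dU (x : I -> R) (t : R) : is_derive t 1 (fun s => U (upd x i s)) (a i).
    have -> : (fun s : R => U (upd x i s)) = (fun s : R => a i * s + \sum_(j | j != i) a j * x j).
      apply/funext => s; rewrite /U (bigD1 i)//= /upd eqxx; congr (_ + _).
      by apply: eq_bigr => j /negbTE ->.
    by apply: is_derive_eq; rewrite /GRing.scale/= mulr1 ?mulr0 ?addr0.
  have mV : measurable_fun setT ((fun _ : cylT I => a i) : cylT I -> R) by exact: measurable_cst.
  rewrite (@gf_ibp _ _ P I xi i U (fun=> a i) A g mU mV dU).
  - exact: Rint_cst.
  - by move=> x t; exact: cvg_cst.
  - by move=> x; apply: lift; exact: bU1.
  - by move=> x; apply: lift; exact: bxU1.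
  - by move=> x; exact: bV.
have iX i : P.-integrable setT (EFin \o (fun w => xi i w * U (xi^~ w))).
  apply: (@gf_integrable _ _ P I xi _ A g) => [|w]; last by apply: lift; exact: bxU1.
  apply: measurable_funM => //.
  exact: (measurableT_comp mU (measurable_family mxi)).
transitivity (\int[P]_w (\sum_i a i * (xi i w * U (xi^~ w)))).
  congr Rintegral; apply/funext => w; rewrite expr2 -/(U (xi^~ w)) mulr_suml.
  by apply: eq_bigr => i _; rewrite mulrA.
rewrite Rint_sum => [|i]; last exact: (integrableZl measurableT (a i) (iX i)).
by apply: eq_bigr => i _; rewrite RintegralZl// E -expr2.
Qed.

End Expect.

(** * The Gaussian Poincare inequality *)

Section Poincare.
Context {R : realType}.
Notation cylT I := (g_sigma_algebraType (@rect R I)).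

Lemma Rint_Fubini d d' (T : measurableType d) (T' : measurableType d')
    (P : probability T R) (Q : probability T' R) (f : T * T' -> R) :
  (P \x Q)%E.-integrable setT (EFin \o f) ->
  (forall w, Q.-integrable setT (EFin \o (fun w' => f (w, w')))) ->
  \int[(P \x Q)%E]_z f z = \int[P]_w \int[Q]_w' f (w, w').
Proof.
move=> iP iQ; rewrite /Rintegral.
have -> := esym (@integral12_prod_meas1 _ _ _ _ _ P Q _ iP).
rewrite /fubini_F; congr fine; apply: eq_integral => w _.
by rewrite fineK//; exact: (integrable_fin_num measurableT (iQ w)).
Qed.

Lemma sum_sqr_le_telescope (N : nat) (u : nat -> R) :
  (u N - u 0%N) ^+ 2 <= N%:R * \sum_(k < N) (u k.+1 - u k) ^+ 2.
Proof.
rewrite -(telescope_sumr u (leq0n N)) big_mkord.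
by apply: (le_trans (sqr_sum_le _)); rewrite card_ord.
Qed.

Lemma sqr_sin_le (x : R) : 0 < x -> sin x ^+ 2 <= x ^+ 2.
Proof.
move=> x0.
have [c _] := @MVT R sin cos 0 x x0 (fun y _ => is_derive_sin y)
  (continuous_subspaceT (@continuous_sin R)).
rewrite sin0 !subr0 => ->; rewrite exprMn ler_piMl ?sqr_ge0//.
Qed.

Lemma Q4_inl (I : finType) (z : I + I -> R) : Q4 (fun i => z (inl i)) <= Q4 z.
Proof.
rewrite /Q4 big_sumType/= lerD2l lerDl.
by apply: sumr_ge0 => i _; rewrite exprn_even_ge0.
Qed.

Lemma Q4_inr (I : finType) (z : I + I -> R) : Q4 (fun i => z (inr i)) <= Q4 z.
Proof.
rewrite /Q4 big_sumType/= lerD2l lerDr.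
by apply: sumr_ge0 => i _; rewrite exprn_even_ge0.
Qed.

(** The inequality is needed for a function [D = |h|^2] with gradient [2 h] that is
   only [C^{1,1}]: [Dstep] is its first order expansion with quadratic
   remainder. Let [y] be an independent copy of [x]. The path
   [cos t x + sin t y] goes from [x] to [y] as [t] runs from [0] to [pi / 2];
   cut it into [N] steps of size [e = pi / (2 N)]. The joint law of the position
   and of the velocity is that of [(x, y)] all along the path, so that each
   step contributes at most [8 e^2 E <h x, y>^2 + O(e^4) = 8 e^2 E D + O(e^4)] to
   the sum of squared increments. Cauchy-Schwarz over the [N] steps bounds
   [E (D y - D x)^2 = 2 Var D] by [2 pi^2 E D + O(N^-2)], and [N] is sent to
   infinity. Discretising the path avoids differentiating under the
   integral. *)
Section Main.
Context d (T : measurableType d) (P : probability T R) (I : finType) (xi : I -> T -> R).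
Variables (D : (I -> R) -> R) (h : I -> (I -> R) -> R) (A : R).
Hypothesis g : gaussian_family P xi.
Hypothesis mD : measurable_fun setT (D : cylT I -> R).
Hypothesis mh : forall i, measurable_fun setT (h i : cylT I -> R).
Hypothesis Dh : forall x, D x = \sum_i h i x ^+ 2.
Hypothesis Dstep : forall a b,
  `|D b - D a - 2 * \sum_i h i a * (b i - a i)| <= \sum_i (b i - a i) ^+ 2.
Hypothesis A0 : 0 <= A.
Hypothesis DA : forall x, D x <= A * (1 + \sum_i x i ^+ 2).

Let D_ge0 x : 0 <= D x.
Proof. by rewrite Dh sumr_ge0// => i _; exact: sqr_ge0. Qed.

Let S2_ge0 (J : finType) (x : J -> R) : 0 <= \sum_i x i ^+ 2.
Proof. by apply: sumr_ge0 => i _; exact: sqr_ge0. Qed.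

Let b := \int[P]_w D (xi^~ w).
Let a := \int[P]_w (D (xi^~ w) ^+ 2).
Let cI : R := 2 * (1 + #|{: I + I}|%:R).

Let cross (x y : I -> R) : `|2 * \sum_i x i * y i| <= \sum_i x i ^+ 2 + \sum_i y i ^+ 2.
Proof.
rewrite -big_split/= mulr_sumr; apply: (le_trans (ler_norm_sum _ _ _)).
apply: ler_sum => i _; rewrite ler_norml.
have := sqr_ge0 (x i - y i); have := sqr_ge0 (x i + y i) => *.
by apply/andP; split; nra.
Qed.

(* [L] is the scalar product of [h x] with the velocity: the increment is
   [2 s L] up to a remainder [e^2 r] with [r] of quadratic growth. *)
Let step_bound (z : I + I -> R) (c s e : R) : 0 <= 1 - c -> 1 - c <= e ^+ 2 -> e ^+ 2 <= 1 ->
    s ^+ 2 <= e ^+ 2 ->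
  (D (fun i => rotall c s z (inl i)) - D (fun i => z (inl i))) ^+ 2 <=
  8 * e ^+ 2 * (\sum_i h i (fun i => z (inl i)) * z (inr i)) ^+ 2 +
  e ^+ 4 * (2 * (A + 3) ^+ 2 * cI * Q4 z).
Proof.
move=> c0 ce e1 se.
pose x i := z (inl i); pose y i := z (inr i).
set L := \sum_i _ * _; set t := _ - _.
have := Dstep x (fun i => rotall c s z (inl i)); rewrite -/t.
have E1 : 2 * \sum_i h i x * (rotall c s z (inl i) - x i) =
    - (1 - c) * (2 * \sum_i h i x * x i) + 2 * s * L.
  rewrite /L !mulr_sumr -big_split/=; apply: eq_bigr => i _; rewrite /x/=; ring.
have E2 : \sum_i (rotall c s z (inl i) - x i) ^+ 2 <=
    e ^+ 2 * (2 * \sum_i x i ^+ 2 + 2 * \sum_i y i ^+ 2).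
  rewrite 2!mulr_sumr -big_split/= mulr_sumr; apply: ler_sum => i _ /=.
  rewrite -/(x i) -/(y i).
  have h1 : (1 - c) ^+ 2 <= e ^+ 2 by nra.
  have := sqr_ge0 ((c - 1) * x i - s * y i).
  have := ler_wpM2r (sqr_ge0 (x i)) h1; have := ler_wpM2r (sqr_ge0 (y i)) se.
  nra.
have E3 := cross (fun i => h i x) x; rewrite -Dh in E3.
rewrite E1 => E4.
pose r := D x + 3 * \sum_i x i ^+ 2 + 2 * \sum_i y i ^+ 2.
have rb : `|t - 2 * s * L| <= e ^+ 2 * r.
  have -> : t - 2 * s * L = (t - (- (1 - c) * (2 * \sum_i h i x * x i) + 2 * s * L))
      + (- (1 - c) * (2 * \sum_i h i x * x i)) by ring.
  apply: (le_trans (ler_normD _ _)).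
  apply: (@le_trans _ _ (e ^+ 2 * (2 * \sum_i x i ^+ 2 + 2 * \sum_i y i ^+ 2) +
     e ^+ 2 * (D x + \sum_i x i ^+ 2))).
    apply: lerD; first exact: le_trans E4 E2.
    rewrite normrM normrN (ger0_norm c0); apply: ler_pM => //.
  by rewrite -mulrDr /r le_eqVlt; apply/orP; left; apply/eqP; ring.
have r0 : 0 <= r by rewrite /r !addr_ge0// mulr_ge0.
have rz : r <= (A + 3) * (1 + \sum_i z i ^+ 2).
  rewrite big_sumType/= /r; have := DA x; have := S2_ge0 x; have := S2_ge0 y.
  rewrite /x /y; move: (D _) (\sum_i z (inl i) ^+ 2) (\sum_i z (inr i) ^+ 2) => u v w.
  move: A0; nra.
have r2 : r ^+ 2 <= (A + 3) ^+ 2 * (cI * Q4 z).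
  apply: (@le_trans _ _ ((A + 3) ^+ 2 * (1 + \sum_i z i ^+ 2) ^+ 2)).
    by rewrite -exprMn lerXn2r ?nnegrE// (le_trans r0 rz).
  by rewrite ler_wpM2l ?sqr_ge0// sqr_sum_sqr_le_Q4.
have q0 : (t - 2 * s * L) ^+ 2 <= (e ^+ 2 * r) ^+ 2.
  by rewrite -(real_normK (num_real (t - _))) lerXn2r ?nnegrE// mulr_ge0// sqr_ge0.
apply: (@le_trans _ _ (8 * s ^+ 2 * L ^+ 2 + 2 * (t - 2 * s * L) ^+ 2)).
  have := sqr_ge0 (t - 4 * s * L); nra.
apply: lerD.
  by rewrite ler_wpM2r ?sqr_ge0// ler_wpM2l.
apply: (@le_trans _ _ (2 * (e ^+ 2 * r) ^+ 2)); first by rewrite ler_wpM2l.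
have -> : 2 * (e ^+ 2 * r) ^+ 2 = e ^+ 4 * 2 * r ^+ 2 by ring.
have -> : e ^+ 4 * (2 * (A + 3) ^+ 2 * cI * Q4 z) =
  e ^+ 4 * 2 * ((A + 3) ^+ 2 * (cI * Q4 z)) by ring.
by rewrite ler_wpM2l// mulr_ge0// exprn_even_ge0.
Qed.

Let zeta (k : I + I) (w : T * T) : R :=
  match k with inl i => xi i w.1 | inr i => xi i w.2 end.
Let PP := (P \x P)%E.

Let gz : gaussian_family PP zeta.
Proof. exact: gaussian_pair g g. Qed.

Let mzi : measurable_fun setT (fun z : cylT (I + I)%type => (fun i => z (inl i)) : cylT I).
Proof. by apply: (@measurable_family _ _ (cylT (I + I)%type) I (fun i z => z (inl i))) => i; exact: measurable_coord. Qed.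

Let mrot c s : measurable_fun setT (fun z : cylT (I + I)%type => (fun i => rotall c s z (inl i)) : cylT I).
Proof.
apply: (@measurable_family _ _ (cylT (I + I)%type) I (fun i z => rotall c s z (inl i))) => i /=.
by apply: measurable_funD; apply: measurable_funM => //; exact: measurable_coord.
Qed.

Let Lz (z : I + I -> R) := \sum_i h i (fun i => z (inl i)) * z (inr i).

Let mLz : measurable_fun setT (Lz : cylT (I + I)%type -> R).
Proof.
apply: measurable_sum => i; apply: measurable_funM; last exact: measurable_coord.
exact: (measurableT_comp (mh i) mzi).
Qed.

Let Lz_bound z : Lz z ^+ 2 <= (A + 1) ^+ 2 * cI * Q4 z.
Proof.
have := cross (fun i => h i (fun i => z (inl i))) (fun i => z (inr i)).
rewrite -/(Lz z) -Dh => h1.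
have h2 : `|2 * Lz z| <= (A + 1) * (1 + \sum_i z i ^+ 2).
  apply: (le_trans h1); have := DA (fun i => z (inl i)); rewrite big_sumType/=.
  have := S2_ge0 (fun i => z (inl i)); have := S2_ge0 (fun i => z (inr i)).
  move: A0; nra.
have h3 : (2 * Lz z) ^+ 2 <= (A + 1) ^+ 2 * (1 + \sum_i z i ^+ 2) ^+ 2.
  rewrite -exprMn -(real_normK (num_real (2 * _))) lerXn2r ?nnegrE//.
  exact: le_trans h2.
have h4 := ler_wpM2l (sqr_ge0 (A + 1)) (sqr_sum_sqr_le_Q4 z).
rewrite -mulrA; have := sqr_ge0 (Lz z); rewrite /cI; nra.
Qed.

Let iLz : PP.-integrable setT (EFin \o (fun w => Lz (zeta^~ w) ^+ 2)).
Proof.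
have mz := measurable_family (gf_meas gz).
apply: (@gf_integrable _ _ _ PP _ zeta _ ((A + 1) ^+ 2 * cI) gz).
  by apply: measurable_funX; exact: (measurableT_comp mLz mz).
by move=> w; rewrite ger0_norm ?sqr_ge0//; exact: Lz_bound.
Qed.

Let ELz : \int[PP]_w Lz (zeta^~ w) ^+ 2 = b.
Proof.
have mxi := gf_meas g.
rewrite (@Rint_Fubini _ _ _ _ P P _ iLz).
  congr Rintegral; apply/funext => w.
  by apply: (etrans (gf_linear_moment2 (fun i => h i (xi^~ w)) g)); rewrite -Dh.
move=> w; pose B := 2 * (1 + #|I|%:R) * (1 + \sum_i h i (xi^~ w) ^+ 2) ^+ 2.
apply: (@gf_integrable _ _ _ P _ xi _ B g).
  rewrite /Lz /=; apply: measurable_funX; apply: measurable_sum => i.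
  by apply: measurable_funM; [exact: measurable_cst|exact: mxi].
move=> w'; rewrite ger0_norm ?sqr_ge0// /Lz/=.
have := cross (fun i => h i (xi^~ w)) (xi^~ w').
have h4 := sqr_sum_sqr_le_Q4 (xi^~ w').
set S := \sum_i _ ^+ 2; set S' := \sum_i xi i w' ^+ 2; set L := \sum_i _ => h1.
have s0 : 0 <= S by exact: S2_ge0.
have s0' : 0 <= S' by exact: S2_ge0.
have h2 : `|2 * L| <= (1 + S) * (1 + S') by apply: (le_trans h1); nra.
have h3 : (2 * L) ^+ 2 <= ((1 + S) * (1 + S')) ^+ 2.
  by rewrite -(real_normK (num_real (2 * _))) lerXn2r ?nnegrE// mulr_ge0// addr_ge0.
rewrite /B mulrAC; apply: le_trans (ler_wpM2r (sqr_ge0 (1 + S)) h4).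
rewrite exprMn in h3; have := sqr_ge0 L; rewrite -/S'; nra.
Qed.

Let D2_bound x : D x ^+ 2 <= A ^+ 2 * (2 * (1 + #|I|%:R)) * Q4 x.
Proof.
apply: (@le_trans _ _ ((A * (1 + \sum_i x i ^+ 2)) ^+ 2)).
  by rewrite lerXn2r ?nnegrE// ?mulr_ge0// ?addr_ge0.
rewrite exprMn -mulrA ler_wpM2l ?sqr_ge0//.
exact: sqr_sum_sqr_le_Q4.
Qed.

Let step (c s : R) (z : I + I -> R) : R :=
  (D (fun i => rotall c s z (inl i)) - D (fun i => z (inl i))) ^+ 2.

Let mstep c s : measurable_fun setT (step c s : cylT (I + I)%type -> R).
Proof.
apply: measurable_funX; apply: measurable_funB.
  exact: (measurableT_comp mD (mrot c s)).
exact: (measurableT_comp mD mzi).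
Qed.

Let iQz : PP.-integrable setT (EFin \o (fun w => Q4 (zeta^~ w))).
Proof. exact: integrable_Q4. Qed.

Let K : R := 2 * (A + 3) ^+ 2 * cI * \int[PP]_w Q4 (zeta^~ w).

Let cI_ge0 : 0 <= cI. Proof. by rewrite mulr_ge0// addr_ge0. Qed.

Let istep (c s e : R) z : 0 <= 1 - c -> 1 - c <= e ^+ 2 -> e ^+ 2 <= 1 ->
    s ^+ 2 <= e ^+ 2 -> gaussian_family PP z ->
  PP.-integrable setT (EFin \o (fun w => step c s (z^~ w))).
Proof.
move=> h1 h2 h3 h4 gz'; have mz := measurable_family (gf_meas gz').
apply: (@gf_integrable _ _ _ PP _ z _
  (8 * e ^+ 2 * ((A + 1) ^+ 2 * cI) + e ^+ 4 * (2 * (A + 3) ^+ 2 * cI)) gz').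
  exact: (measurableT_comp (mstep c s) mz).
move=> w; rewrite ger0_norm ?sqr_ge0//; apply: (le_trans (step_bound (z^~ w) h1 h2 h3 h4)).
rewrite [leRHS]mulrDl; apply: lerD; last by rewrite mulrA.
rewrite -[leRHS]mulrA; apply: ler_wpM2l; last exact: Lz_bound.
by rewrite mulr_ge0// sqr_ge0.
Qed.

Let Estep (c s e : R) z : 0 <= 1 - c -> 1 - c <= e ^+ 2 -> e ^+ 2 <= 1 ->
    s ^+ 2 <= e ^+ 2 -> gaussian_family PP z ->
  \int[PP]_w step c s (z^~ w) <= 8 * e ^+ 2 * b + e ^+ 4 * K.
Proof.
move=> h1 h2 h3 h4 gz'.
rewrite {1}/Rintegral (gaussian_integral_unique gz' gz (mstep c s)) -/(Rintegral _ _ _).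
have i1 := integrableZl measurableT (8 * e ^+ 2) iLz.
have i2 := integrableZl measurableT (e ^+ 4 * (2 * (A + 3) ^+ 2 * cI)) iQz.
rewrite -ELz /K mulrA -RintegralZl// -RintegralZl// -RintegralD//.
apply: le_Rintegral => //.
- exact: istep h1 h2 h3 h4 gz.
- exact: (integrableD measurableT i1 i2).
- move=> w _; apply: (le_trans (step_bound (zeta^~ w) h1 h2 h3 h4)).
  by rewrite lerD2l mulrA.
Qed.

Let iDD : PP.-integrable setT (EFin \o (fun w => (D (xi^~ w.2) - D (xi^~ w.1)) ^+ 2)).
Proof.
apply: (@gf_integrable _ _ _ PP _ zeta _ (4 * (A ^+ 2 * (2 * (1 + #|I|%:R)))) gz).
  apply: measurable_funX; apply: measurable_funB; apply: (measurableT_comp mD).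
    exact: (@measurable_family _ _ _ I (fun i w => xi i w.2) (fun i => gf_meas gz (inr i))).
  exact: (@measurable_family _ _ _ I (fun i w => xi i w.1) (fun i => gf_meas gz (inl i))).
move=> w; rewrite ger0_norm ?sqr_ge0//.
have := D2_bound (xi^~ w.1); have := D2_bound (xi^~ w.2).
set B := A ^+ 2 * _.
have B0 : 0 <= B by rewrite !mulr_ge0// addr_ge0.
have := ler_wpM2l B0 (Q4_inl (zeta^~ w)); have := ler_wpM2l B0 (Q4_inr (zeta^~ w)).
have := sqr_ge0 (D (xi^~ w.1) + D (xi^~ w.2)); rewrite /zeta; lra.
Qed.

(* The [k]-th point of the path, together with its velocity. *)
Let zk (N k : nat) (l : I + I) (w : T * T) : R :=
  let t := k%:R * (pi / 2 / N%:R) in rotall (cos t) (sin t) (zeta^~ w) l.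

Let zkS N k l w : let e := pi / 2 / N%:R in
  zk N k.+1 l w = rotall (cos e) (sin e) ((zk N k)^~ w) l.
Proof.
move=> e; rewrite /zk -/e -natr1 mulrDl mul1r cosD sinD.
by case: l => i /=; ring.
Qed.

Let poincare_N (N : nat) : (2 <= N)%N ->
  \int[PP]_w (D (xi^~ w.2) - D (xi^~ w.1)) ^+ 2 <=
  2 * pi ^+ 2 * b + (pi / 2) ^+ 4 * K / N%:R ^+ 2.
Proof.
move=> N2; have N0 : (0 < N%:R :> R) by rewrite ltr0n (leq_trans _ N2).
have p0 := @pi_gt0 R.
pose e : R := pi / 2 / N%:R.
have e0 : 0 < e by rewrite /e !divr_gt0.
have p4 : pi <= 4 :> R by have := @pihalf_lt2 R; lra.
have N2' : 2 <= N%:R :> R by rewrite ler_nat.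
have e1 : e <= 1 by rewrite /e ler_pdivrMr// mul1r; lra.
have eh : e < pi / 2.
  by rewrite /e ltr_pdivrMr// ltr_pMr ?divr_gt0//; apply: lt_le_trans N2'; rewrite ltr1n.
have ce0 : 0 < cos e.
  apply: cos_gt0_pihalf; rewrite eh andbT; apply: lt_trans e0.
  by rewrite oppr_lt0 divr_gt0.
have cs1 : cos e ^+ 2 + sin e ^+ 2 = 1 by exact: cos2Dsin2.
have c1 : 0 <= 1 - cos e by rewrite subr_ge0 cos_le1.
have s2e := sqr_sin_le e0.
have ce : 1 - cos e <= e ^+ 2 by nra.
have ee1 : e ^+ 2 <= 1 by nra.
have gzk k : gaussian_family PP (zk N k).
  elim: k => [|k IH].
    rewrite (_ : zk N 0 = zeta)//; apply/funext => l; apply/funext => w.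
    by rewrite /zk mul0r cos0 sin0; case: l => i /=; ring.
  rewrite (_ : zk N k.+1 = fun l w => rotall (cos e) (sin e) ((zk N k)^~ w) l).
    exact: gaussian_rotall.
  by apply/funext => l; apply/funext => w; exact: zkS.
pose psi k w := D (fun i => zk N k (inl i) w).
have psi0 w : psi 0%N w = D (xi^~ w.1).
  by congr D; apply/funext => i; rewrite /zk mul0r cos0 sin0 /=; ring.
have psiN w : psi N w = D (xi^~ w.2).
  congr D; apply/funext => i; rewrite /zk.
  have -> : N%:R * (pi / 2 / N%:R) = pi / 2 :> R by field; rewrite gt_eqF.
  by rewrite cos_pihalf sin_pihalf /=; ring.
have psiS k w : (psi k.+1 w - psi k w) ^+ 2 = step (cos e) (sin e) ((zk N k)^~ w).
  rewrite /step /psi; congr ((D _ - _) ^+ 2); apply/funext => i; exact: zkS.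
have iS k := istep c1 ce ee1 s2e (gzk k).
have isN : PP.-integrable setT (EFin \o (fun w => \sum_(k < N) step (cos e) (sin e) ((zk N k)^~ w))).
  rewrite (_ : _ \o _ = fun w => \sum_(k < N) (step (cos e) (sin e) ((zk N k)^~ w))%:E)%E.
    by apply: integrable_sum => // k _; exact: iS.
  by apply/funext => w; rewrite /= sumEFin.
apply: (@le_trans _ _ (\int[PP]_w (N%:R * \sum_(k < N) step (cos e) (sin e) ((zk N k)^~ w)))).
  apply: le_Rintegral => //.
  - exact: (integrableZl measurableT N%:R isN).
  - move=> w _; rewrite -psi0 -psiN.
    apply: (le_trans (sum_sqr_le_telescope N (psi^~ w))).
    by rewrite ler_wpM2l//; apply: ler_sum => k _; rewrite psiS.
rewrite RintegralZl//.
rewrite Rint_sum; last by move=> k; exact: iS.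
apply: (@le_trans _ _ (N%:R * \sum_(k < N) (8 * e ^+ 2 * b + e ^+ 4 * K))).
  rewrite ler_wpM2l//; apply: ler_sum => k _; exact: Estep.
rewrite sumr_const card_ord -mulr_natl le_eqVlt; apply/orP; left; apply/eqP.
by rewrite /e; field; rewrite gt_eqF.
Qed.

Let iD1 : P.-integrable setT (EFin \o (fun w => D (xi^~ w))).
Proof.
apply: (@gf_integrable _ _ _ P _ xi _ (A * (2 * (1 + #|I|%:R))) g).
  exact: (measurableT_comp mD (measurable_family (gf_meas g))).
move=> w; rewrite ger0_norm//; apply: (le_trans (DA _)).
by rewrite -mulrA ler_wpM2l//; exact: sum_sqr_le_Q4.
Qed.

Let iD2 : P.-integrable setT (EFin \o (fun w => D (xi^~ w) ^+ 2)).
Proof.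
apply: (@gf_integrable _ _ _ P _ xi _ (A ^+ 2 * (2 * (1 + #|I|%:R))) g).
  by apply: measurable_funX; exact: (measurableT_comp mD (measurable_family (gf_meas g))).
by move=> w; rewrite ger0_norm ?sqr_ge0//; exact: D2_bound.
Qed.

Let sq_int (u : R) : P.-integrable setT (EFin \o (fun w' => (D (xi^~ w') - u) ^+ 2)) /\
  \int[P]_w' (D (xi^~ w') - u) ^+ 2 = a - 2 * u * b + u ^+ 2.
Proof.
have i1 := integrableZl measurableT (- (2 * u)) iD1.
have ic : P.-integrable setT (EFin \o (fun=> u ^+ 2)) by exact: finite_measure_integrable_cst.
have i2 : P.-integrable setT (EFin \o (fun w => D (xi^~ w) ^+ 2 + - (2 * u) * D (xi^~ w))).
  exact: (integrableD measurableT iD2 i1).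
have i3 : P.-integrable setT (EFin \o (fun w => D (xi^~ w) ^+ 2 + - (2 * u) * D (xi^~ w) + u ^+ 2)).
  exact: (integrableD measurableT i2 ic).
rewrite (_ : (fun w' => (D (xi^~ w') - u) ^+ 2) =
  (fun w => D (xi^~ w) ^+ 2 + - (2 * u) * D (xi^~ w) + u ^+ 2)); last first.
  by apply/funext => w; ring.
split=> //; rewrite RintegralD// RintegralD// RintegralZl// Rint_cst -/a -/b; ring.
Qed.

Lemma gaussian_poincare : a - b ^+ 2 <= pi ^+ 2 * b.
Proof.
have E : \int[PP]_w (D (xi^~ w.2) - D (xi^~ w.1)) ^+ 2 = 2 * (a - b ^+ 2).
  rewrite (@Rint_Fubini _ _ _ _ P P _ iDD)/=; last by move=> w; exact: (sq_int _).1.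
  transitivity (\int[P]_w (D (xi^~ w) ^+ 2 + - (2 * b) * D (xi^~ w) + a)).
    by congr Rintegral; apply/funext => w; rewrite (sq_int _).2; ring.
  have i1 := integrableZl measurableT (- (2 * b)) iD1.
  have ic : P.-integrable setT (EFin \o (fun=> a)) by exact: finite_measure_integrable_cst.
  have i2 := integrableD measurableT iD2 i1.
  rewrite RintegralD// RintegralD// RintegralZl// Rint_cst -/a -/b; ring.
rewrite leNgt; apply/negP => lt.
pose delta := (a - b ^+ 2) - pi ^+ 2 * b.
have d0 : 0 < delta by rewrite subr_gt0.
pose M := (pi / 2) ^+ 4 * K.
have K0 : 0 <= K.
  apply: mulr_ge0; last by apply: Rintegral_ge0 => w _; exact: Q4_ge0.
  by apply: mulr_ge0 => //; apply: mulr_ge0 => //; exact: sqr_ge0.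
have M0 : 0 <= M by rewrite mulr_ge0// exprn_even_ge0.
pose N := (Num.truncn (M / delta)).+2.
have := @poincare_N N isT; rewrite E => hN.
have N1 : 2 <= N%:R :> R by rewrite ler_nat.
have MN : M / delta < N%:R.
  apply: (lt_le_trans (truncnS_gt _)); by rewrite ler_nat.
rewrite ltr_pdivrMr// in MN.
have h2 : M / N%:R ^+ 2 <= M / N%:R.
  rewrite ler_wpM2l// lef_pV2 ?posrE ?exprn_gt0//; try exact: lt_le_trans N1.
  by rewrite expr2 ler_pMr; [apply: le_trans N1; rewrite ler1n|exact: lt_le_trans N1].
have h3 : M / N%:R < delta.
  by rewrite ltr_pdivrMr 1?mulrC//; exact: lt_le_trans N1.
have : 2 * delta <= M / N%:R ^+ 2 by rewrite /delta /M; lra.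
lra.
Qed.

End Main.
End Poincare.

(** * The projection onto the image of the l1 ball *)

Section Hat.
Context {R : realType}.

Definition dot n (x y : 'cV[R]_n) : R := \sum_i x i 0 * y i 0.
Definition nrm2 n (x : 'cV[R]_n) : R := dot x x.

Lemma dotC n (x y : 'cV[R]_n) : dot x y = dot y x.
Proof. by apply: eq_bigr => i _; rewrite mulrC. Qed.
Lemma dotDl n (x y z : 'cV[R]_n) : dot (x + y) z = dot x z + dot y z.
Proof. by rewrite -big_split; apply: eq_bigr => i _; rewrite !mxE mulrDl. Qed.
Lemma dotDr n (x y z : 'cV[R]_n) : dot z (x + y) = dot z x + dot z y.
Proof. by rewrite !(dotC z) dotDl. Qed.
Lemma dotZl n (x y : 'cV[R]_n) a : dot (a *: x) y = a * dot x y.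
Proof. by rewrite mulr_sumr; apply: eq_bigr => i _; rewrite !mxE mulrA. Qed.
Lemma dotZr n (x y : 'cV[R]_n) a : dot x (a *: y) = a * dot x y.
Proof. by rewrite dotC dotZl dotC. Qed.
Lemma dotNl n (x y : 'cV[R]_n) : dot (- x) y = - dot x y.
Proof. by rewrite -scaleN1r dotZl mulN1r. Qed.
Lemma dotNr n (x y : 'cV[R]_n) : dot x (- y) = - dot x y.
Proof. by rewrite dotC dotNl dotC. Qed.
Lemma dotBl n (x y z : 'cV[R]_n) : dot (x - y) z = dot x z - dot y z.
Proof. by rewrite dotDl dotNl. Qed.
Lemma dotBr n (x y z : 'cV[R]_n) : dot z (x - y) = dot z x - dot z y.
Proof. by rewrite dotDr dotNr. Qed.
Definition dotE := (dotDl, dotDr, dotNl, dotNr, dotZl, dotZr).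

Lemma dot_mx n (x y : 'cV[R]_n) : dot x y = (x^T *m y) 0 0.
Proof. by rewrite mxE; apply: eq_bigr => i _; rewrite !mxE. Qed.

Lemma dot_mulmx m n (A : 'M[R]_(m, n)) x y : dot (A *m x) y = dot x (A^T *m y).
Proof. by rewrite !dot_mx trmx_mul mulmxA. Qed.

Lemma nrm2_ge0 n (x : 'cV[R]_n) : 0 <= nrm2 x.
Proof. by apply: sumr_ge0 => i _; rewrite -expr2 sqr_ge0. Qed.

Lemma nrm2_eq0 n (x : 'cV[R]_n) : nrm2 x = 0 -> x = 0.
Proof.
move=> /eqP; rewrite psumr_eq0 => [|i _]; last by rewrite -expr2 sqr_ge0.
move=> /allP h; apply/matrixP => i j; rewrite ord1 mxE.
by have := h i (mem_index_enum _); rewrite -expr2 sqrf_eq0 => /eqP.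
Qed.

Lemma enorm_sqr n (x : 'cV[R]_n) : enorm x ^+ 2 = nrm2 x.
Proof.
rewrite /enorm sqr_sqrtr; last by apply: sumr_ge0 => i _; rewrite sqr_ge0.
by apply: eq_bigr => i _; rewrite expr2.
Qed.

Lemma enorm_ge0 n (x : 'cV[R]_n) : 0 <= enorm x.
Proof. exact: sqrtr_ge0. Qed.

Lemma enorm_le n (x y : 'cV[R]_n) : (enorm x <= enorm y) = (nrm2 x <= nrm2 y).
Proof. by rewrite -!enorm_sqr ler_pXn2r// nnegrE enorm_ge0. Qed.

Lemma nrm2D n (x y : 'cV[R]_n) : nrm2 (x + y) = nrm2 x + 2 * dot x y + nrm2 y.
Proof. by rewrite /nrm2 dotDl !dotDr (dotC y x); ring. Qed.

(** Orthogonal projection onto the column space of [X], when [X] has full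
   column rank. *)
Definition hat n p (X : 'M[R]_(n, p)) : 'M[R]_n := X *m invmx (X^T *m X) *m X^T.

Section Full.
Variables (n p : nat) (X : 'M[R]_(n, p)).
Hypothesis rX : \rank X = p.

Lemma gram_unit : X^T *m X \in unitmx.
Proof.
rewrite -row_free_unit -kermx_eq0; apply/eqP/row_matrixP => i; rewrite row0.
set v := row i _.
have v0 : v *m (X^T *m X) = 0 by apply/sub_kermxP; exact: row_sub.
have fX : row_free X^T by rewrite /row_free mxrank_tr rX.
have : nrm2 (X *m v^T) = 0.
  have e : X^T *m (X *m v^T) = 0.
    by apply: trmx_inj; rewrite !trmx_mul !trmxK trmx0 -mulmxA.
  by rewrite /nrm2 dot_mulmx e /dot big1// => j _; rewrite !mxE mulr0.
move=> /nrm2_eq0 Xv; apply/eqP; rewrite -(mulmx_free_eq0 v fX).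
by rewrite -[v *m _]trmxK trmx_mul trmxK Xv trmx0.
Qed.

Lemma hat_sym : (hat X)^T = hat X.
Proof. by rewrite /hat !trmx_mul trmxK trmx_inv trmx_mul trmxK mulmxA. Qed.

Lemma hat_mulX : hat X *m X = X.
Proof. by rewrite /hat -!mulmxA mulVmx ?gram_unit// mulmx1. Qed.

Lemma hat_idem : hat X *m hat X = hat X.
Proof. by rewrite {2}/hat !mulmxA hat_mulX. Qed.

Lemma hat_tr : \tr (hat X) = p%:R.
Proof. by rewrite /hat mxtrace_mulC mulmxA mulmxV ?gram_unit// mxtrace1. Qed.

Lemma hat_ols (y : 'cV[R]_n) : hat X *m y = X *m ols X y.
Proof. by rewrite /hat /ols !mulmxA. Qed.

Lemma dot_hat (x y : 'cV[R]_n) : dot (hat X *m x) y = dot x (hat X *m y).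
Proof. by rewrite dot_mulmx hat_sym. Qed.

Lemma nrm2_hat_le (x : 'cV[R]_n) : nrm2 (hat X *m x) <= nrm2 x.
Proof.
have : 0 <= nrm2 (x - hat X *m x) by exact: nrm2_ge0.
have e : dot (hat X *m x) (hat X *m x) = dot x (hat X *m x).
  by rewrite dot_hat mulmxA hat_idem.
by rewrite /nrm2 !dotE e (dotC (hat X *m x) x); lra.
Qed.

End Full.
End Hat.

Section Proj.
Context {R : realType}.
Variables (n p : nat) (X : 'M[R]_(n, p)) (lambda : R).
Hypothesis rX : \rank X = p.
Hypothesis l0 : 0 < lambda.
Let K := lasso_set X lambda.
Let H := hat X.

Lemma lasso_hat v : K v -> H *m v = v.
Proof. by move=> [t _ <-]; rewrite mulmxA hat_mulX. Qed.

Lemma lasso_convex u v (t : R) : 0 <= t <= 1 -> K u -> K v -> K (u + t *: (v - u)).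
Proof.
move=> /andP[t0 t1] [a /= ha <-] [b /= hb <-].
exists (a + t *: (b - a)); last by rewrite mulmxDr -scalemxAr mulmxBr.
rewrite /= /l1norm; apply: (@le_trans _ _ ((1 - t) * l1norm a + t * l1norm b)).
  rewrite /l1norm !mulr_sumr -big_split/=; apply: ler_sum => i _; rewrite !mxE.
  have -> : a i 0 + t * (b i 0 - a i 0) = (1 - t) * a i 0 + t * b i 0 by ring.
  apply: (le_trans (ler_normD _ _)); rewrite !normrM (ger0_norm t0) ger0_norm//.
  by rewrite subr_ge0.
by move: (l1norm a) (l1norm b) ha hb => r s; nra.
Qed.

Lemma continuous_bigsum (T : topologicalType) (I : finType) (F : I -> T -> R) :
  (forall i, continuous (F i)) -> continuous (fun x => \sum_i F i x).
Proof.
move=> cF; apply: (@continuous_big R I +%R 0 xpredT _ T (index_enum I) F) => //.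
exact: add_continuous.
Qed.

(** The squared distance to [y] is minimised over the coefficient vectors, which
   form a compact set. *)
Lemma nearest_exists (y : 'cV[R]_n) :
  exists v, K v /\ forall w, K w -> enorm (y - v) <= enorm (y - w).
Proof.
pose f (v : 'rV[R]_p) := \sum_i (y i 0 - \sum_j X i j * v 0 j) ^+ 2.
pose A := [set v : 'rV[R]_p | forall i, `[- lambda, lambda]%classic (v 0 i)] `&`
          [set v : 'rV[R]_p | \sum_i `|v 0 i| <= lambda].
have cf : continuous f.
  apply: continuous_bigsum => i v.
  apply: (@continuous_comp _ _ _ (fun v : 'rV[R]_p => y i 0 - \sum_j X i j * v 0 j) (fun x => x ^+ 2)).
    apply: (@continuousB R R^o); first exact: cst_continuous.
    apply: continuous_bigsum => j u; apply: continuousM; first exact: cst_continuous.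
    exact: coord_continuous.
  exact: sqr_continuous.
have cA : compact A.
  apply: compact_closedI.
    apply: (@rV_compact R p (fun=> `[- lambda, lambda]%classic)) => i.
    exact: segment_compact.
  apply: (@preimage_closed _ _ (fun v : 'rV[R]_p => \sum_i `|v 0 i|) [set x | x <= lambda]).
    move=> v _; apply: continuous_bigsum => j u.
    apply: (@continuous_comp _ _ _ (fun v : 'rV[R]_p => v 0 j) Num.norm).
      exact: coord_continuous.
    exact: norm_continuous.
  exact: closed_le.
have A0 : A !=set0.
  exists 0; split => /=.
    by move=> i; rewrite mxE in_itv/= oppr_le0 (ltW l0).
  by rewrite big1 ?(ltW l0)// => i _; rewrite mxE normr0.
have [c cA' cmin] := EVT_min_rV A0 cA (continuous_subspaceT cf).
have fE (v : 'rV[R]_p) : f v = nrm2 (y - X *m v^T).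
  apply: eq_bigr => i _; rewrite -expr2 !mxE; congr ((_ - _) ^+ 2).
  by apply: eq_bigr => j _; rewrite !mxE.
have Al (v : 'rV[R]_p) : A v <-> l1norm v^T <= lambda.
  have e : l1norm v^T = \sum_i `|v 0 i| by apply: eq_bigr => i _; rewrite mxE.
  rewrite e; split=> [[] //|h]; split=> // i /=.
  rewrite in_itv/= -ler_norml; apply: le_trans h.
  by rewrite (bigD1 i)//= lerDl sumr_ge0.
exists (X *m c^T); split.
  by exists c^T => //=; apply/Al; rewrite inE in cA'.
move=> w [t /= tl <-]; rewrite enorm_le -fE.
have := cmin t^T; rewrite inE (fE t^T) trmxK; apply.
by apply/Al; rewrite trmxK.
Qed.

Let Pi y := metric_proj K y.

Lemma metric_projP y : K (Pi y) /\ forall w, K w -> nrm2 (y - Pi y) <= nrm2 (y - w).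
Proof.
have [k1 k2] : K (Pi y) /\ forall w, K w -> enorm (y - Pi y) <= enorm (y - w).
  by apply: (@xgetPex _ 0 [set v | K v /\ forall w, K w -> enorm (y - v) <= enorm (y - w)]);
   exact: nearest_exists.
by split=> // w Kw; rewrite -enorm_le; exact: k2.
Qed.

(** By Pythagoras the nearest point of [K] to [y] is also the nearest one to
   [hat X *m y], so the squared norm of [resid y] is the squared distance from
   [hat X *m y] to [K]. *)
Definition resid (y : 'cV[R]_n) : 'cV[R]_n := hat X *m y - metric_proj (lasso_set X lambda) y.

Lemma hat_resid y : H *m resid y = resid y.
Proof.
by rewrite /resid mulmxBr mulmxA hat_idem// (lasso_hat (metric_projP y).1).
Qed.

Lemma dot_range u v : H *m v = v -> dot u v = dot (H *m u) v.
Proof. by move=> e; rewrite dot_hat e. Qed.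

Lemma pythagoras y v : K v ->
  nrm2 (y - v) = nrm2 (y - H *m y) + nrm2 (H *m y - v).
Proof.
move=> Kv; have -> : y - v = (y - H *m y) + (H *m y - v) by rewrite addrA subrK.
rewrite nrm2D.
have -> : dot (y - H *m y) (H *m y - v) = 0.
  rewrite dot_range; last by rewrite mulmxBr mulmxA hat_idem// (lasso_hat Kv).
  by rewrite mulmxBr mulmxA hat_idem// subrr /dot big1// => i _; rewrite mxE mul0r.
by rewrite mulr0 addr0.
Qed.

Lemma resid_min y v : K v -> nrm2 (resid y) <= nrm2 (H *m y - v).
Proof.
have [k1 k2] := metric_projP y; move=> Kv.
have := k2 v Kv; rewrite (pythagoras y k1) (pythagoras y Kv) /resid /Pi /K; lra.
Qed.

(** First order optimality along the segment from the projection to [v], which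
   stays in [K]. *)
Lemma resid_variational y v : K v -> dot (resid y) (v - Pi y) <= 0.
Proof.
move=> Kv; have [k1 k2] := metric_projP y.
have key (t : R) : 0 < t <= 1 -> 2 * dot (resid y) (v - Pi y) <= t * nrm2 (v - Pi y).
  move=> /andP[t0 t1].
  have := @resid_min y (Pi y + t *: (v - Pi y)).
  have K' : K (Pi y + t *: (v - Pi y)) by apply: lasso_convex; rewrite ?(ltW t0).
  move=> /(_ K').
  have -> : H *m y - (Pi y + t *: (v - Pi y)) = resid y - t *: (v - Pi y).
    by rewrite opprD addrA.
  rewrite nrm2D dotNr dotZr.
  have -> : nrm2 (- (t *: (v - Pi y))) = t * (t * nrm2 (v - Pi y)).
    by rewrite /nrm2 dotNl dotNr opprK dotZl dotZr.
  move: (dot _ _) (nrm2 _) (nrm2 _) => a b c h.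
  have : t * (2 * a) <= t * (t * b) by lra.
  by rewrite ler_pM2l.
rewrite leNgt; apply/negP => pos.
have c0 : 0 <= nrm2 (v - Pi y) by exact: nrm2_ge0.
set a := dot _ _ in pos key; set c := nrm2 _ in c0 key.
pose t := a / (a + c).
have ac : 0 < a + c by apply: ltr_pwDl.
have t0 : 0 < t by rewrite divr_gt0.
have t1 : t <= 1 by rewrite ler_pdivrMr// mul1r lerDl.
have := key t; rewrite t0 t1 => /(_ isT).
have e : t * (a + c) = a by rewrite divfK// gt_eqF.
have : t * a > 0 by exact: mulr_gt0.
lra.
Qed.

Let hat_diff a b : H *m b - H *m a = (resid b - resid a) + (Pi b - Pi a).
Proof.
rewrite /resid -/H -/K -/(Pi a) -/(Pi b).
move: (H *m b) (H *m a) (Pi b) (Pi a) => u v w z.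
by apply/matrixP => i j; rewrite !mxE; ring.
Qed.

(** Moreau: the identity minus the projection onto a convex set is firmly
   nonexpansive. *)
Lemma resid_lipschitz a b : nrm2 (resid b - resid a) <= nrm2 (b - a).
Proof.
apply: le_trans (nrm2_hat_le rX (b - a)).
have h1 := resid_variational a (metric_projP b).1.
have h2 := resid_variational b (metric_projP a).1.
have -> : hat X *m (b - a) = (resid b - resid a) + (Pi b - Pi a).
  by rewrite mulmxBr hat_diff.
have e : dot (resid b - resid a) (Pi b - Pi a) =
    - dot (resid b) (Pi a - Pi b) - dot (resid a) (Pi b - Pi a).
  by rewrite dotBl -(opprB (Pi b) (Pi a)) dotNr opprK.
have h3 := nrm2_ge0 (Pi b - Pi a); rewrite [leRHS]nrm2D e; move: h1 h2 h3.
move: (nrm2 (resid b - resid a)) (nrm2 (Pi b - Pi a)) (dot (resid b) _) (dot (resid a) _).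
by move=> u v w z; lra.
Qed.

(** The squared distance to [K] is differentiable with gradient [2 resid] and a
   quadratic remainder. The upper bound compares the distance of [b] to [K] with
   its distance to the projection of [a]; the lower bound uses the optimality of
   that projection. *)
Lemma resid_step a b :
  `|nrm2 (resid b) - nrm2 (resid a) - 2 * dot (resid a) (b - a)| <= nrm2 (b - a).
Proof.
have e1 : dot (resid a) (b - a) = dot (resid a) (H *m b - H *m a).
  by rewrite -mulmxBr -dot_hat hat_resid.
have h1 := resid_variational a (metric_projP b).1.
have h2 := resid_min b (metric_projP a).1.
have h3 := nrm2_hat_le rX (b - a).
rewrite ler_norml; apply/andP; split.
  apply: (@le_trans _ _ 0); first by rewrite oppr_le0 nrm2_ge0.
  rewrite e1.
  rewrite hat_diff.
  have h4 := nrm2_ge0 (resid b - resid a).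
  have e4 : nrm2 (resid b - resid a) =
      nrm2 (resid b) - 2 * dot (resid a) (resid b) + nrm2 (resid a).
    rewrite nrm2D dotNr (dotC (resid b)) /nrm2 dotNl dotNr opprK.
    by move: (dot _ _) (dot _ _) (dot _ _) => u v w; ring.
  have e5 : dot (resid a) (resid a) = nrm2 (resid a) by [].
  rewrite (dotDr (resid b - resid a)) (dotBr _ (resid a)) e5.
  rewrite e4 in h4; move: h1 h4.
  move: (nrm2 (resid b)) (nrm2 (resid a)) (dot _ (Pi b - Pi a)) (dot _ (resid b)).
  by move=> u v w z; lra.
apply: le_trans h3.
have e2 : H *m b - Pi a = hat X *m (b - a) + resid a.
  by rewrite mulmxBr /resid addrA subrK.
have e6 : dot (hat X *m (b - a)) (resid a) = dot (resid a) (b - a).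
  by rewrite dot_hat -/H hat_resid dotC.
move: h2; rewrite e2 (nrm2D (hat X *m (b - a)) (resid a)) e6; lra.
Qed.

Lemma lr_statE mu0 y : K mu0 ->
  lr_stat K mu0 y = nrm2 (H *m y - mu0) - nrm2 (resid y).
Proof.
move=> K0; have [k1 _] := metric_projP y.
rewrite /lr_stat !enorm_sqr (pythagoras y K0) (pythagoras y k1) /resid /Pi; lra.
Qed.

Lemma resid_eq0 y : l1norm (ols X y) < lambda -> resid y = 0.
Proof.
move=> lt; apply: nrm2_eq0; apply/eqP; rewrite eq_le nrm2_ge0 andbT.
have Ky : K (H *m y) by exists (ols X y); [exact: ltW|rewrite -hat_ols].
apply: (le_trans (resid_min y Ky)); rewrite subrr /nrm2 /dot big1// => i _.
by rewrite mxE mul0r.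
Qed.

End Proj.

(** * Stein's equation *)

Section Stein.
Context {R : realType}.
Notation mu := (@lebesgue_measure R).
Notation gam := (normal_prob (0:R) 1).
Notation phi := (normal_pdf (0:R) 1).

Lemma phi_gt0 (x : R) : 0 < phi x.
Proof. by rewrite phiE mulr_gt0 ?expR_gt0// normal_peak_gt0. Qed.

Lemma continuous_phi : continuous phi.
Proof. exact: continuous_normal_pdf. Qed.

Lemma phi_cvg_pinfty : phi x @[x --> +oo] --> (0 : R).
Proof.
have s2 : (0 : R) < (Num.sqrt 2)^-1 by rewrite invr_gt0 sqrtr_gt0.
have -> : phi = (fun x => normal_peak 1 * gauss_fun (x * (Num.sqrt 2)^-1)).
  apply/funext => x; rewrite phiE /gauss_fun exprMn exprVn sqr_sqrtr//.
rewrite -(mulr0 (normal_peak 1 : R)); apply: cvgMr.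
apply: (@cvg_comp _ _ _ (fun x : R => x * (Num.sqrt 2)^-1) gauss_fun _ +oo).
  by apply: gt0_cvgMly => //; exact: cvg_id.
exact: cvg_gauss_fun.
Qed.

Lemma integrable_phi1 : mu.-integrable setT (EFin \o phi).
Proof. exact: integrable_normal_pdf. Qed.

Definition utail (x : R) := \int[mu]_(t in `[x, +oo[) phi t.

(** On the range of integration [x * phi t <= t * phi t], and the latter has
   primitive [- phi]. *)
Lemma mills_mul (x : R) : 0 <= x -> x * utail x <= phi x.
Proof.
move=> x0.
have mt : measurable_fun setT (fun t : R => t) by [].
have it : mu.-integrable setT (EFin \o (fun t => t * phi t)).
  apply: (@integrable_phi _ _ 1) => // t; rewrite mul1r.
  have e : t ^+ 4 = `|t| ^+ 2 ^+ 2 by rewrite -exprM -normrX ger0_norm// exprn_even_ge0.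
  rewrite e; have := sqr_ge0 (`|t| - 1); have := sqr_ge0 (`|t| ^+ 2 - 1).
  by move: `|t| => a; nra.
have E : \int[mu]_(t in `[x, +oo[) (t * phi t) = phi x.
  rewrite (@Rintegral_ge0_continuous_FTC2y R (fun t => t * phi t) (fun t => - phi t) x 0).
  - by rewrite sub0r opprK.
  - by move=> t xt; rewrite mulr_ge0 ?normal_pdf_ge0// (le_trans x0).
  - apply: continuous_subspaceT => t; apply: continuousM; first exact: cvg_id.
    exact: continuous_phi.
  - by rewrite -[X in _ --> X]oppr0; apply: cvgN; exact: phi_cvg_pinfty.
  - by move=> t _; apply: derivableN; have := is_derive_phi t => -[].
  - by apply: cvg_at_right_filter; apply: cvgN; exact: continuous_phi.
  - move=> t _; rewrite derive1E.
    have d := is_derive_phi t.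
    have -> : 'D_1 (fun t0 => - phi t0) t = - (- t * phi t).
      by apply: derive_val.
    by rewrite mulNr opprK.
rewrite -[leRHS]E /utail -RintegralZl//; last exact: integrableS integrable_phi1.
apply: le_Rintegral => //.
- by apply: (integrableS measurableT) => //; exact: (integrableZl measurableT x integrable_phi1).
- exact: integrableS it.
- by move=> t; rewrite /= in_itv/= andbT => xt; rewrite ler_wpM2r// normal_pdf_ge0.
Qed.

Lemma utail_ge0 x : 0 <= utail x.
Proof. by apply: Rintegral_ge0 => t _; exact: normal_pdf_ge0. Qed.

Lemma utail_le1 x : utail x <= 1.
Proof.
have -> : 1 = fine (\int[mu]_t (phi t)%:E) by rewrite integral_normal_pdf.
rewrite /utail /Rintegral fine_le//.
- apply: integrable_fin_num => //; exact: integrableS integrable_phi1.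
- by rewrite integral_normal_pdf.
- apply: ge0_subset_integral => //.
  by apply/measurable_EFinP; exact: measurable_normal_pdf.
  by move=> t _; rewrite lee_fin normal_pdf_ge0.
Qed.

(** On [[0, 1]] the tail is at most 1 and the density at least [phi 1]; beyond 1 the
   bound of [mills_mul] is enough. *)
Definition mills_cst : R := 1 + (phi 1)^-1.

Lemma mills_cst_ge1 : 1 <= mills_cst.
Proof. by rewrite /mills_cst lerDl invr_ge0 normal_pdf_ge0. Qed.

Lemma mills_le (x : R) : 0 <= x -> utail x <= mills_cst * phi x.
Proof.
move=> x0; have p0 := phi_gt0 x; have p1 := phi_gt0 1.
have [x1|x1] := leP 1 x.
  apply: (@le_trans _ _ (x * utail x)); first by rewrite ler_peMl// utail_ge0.
  by apply: (le_trans (mills_mul x0)); rewrite ler_peMl ?(ltW p0)// mills_cst_ge1.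
apply: (le_trans (utail_le1 x)); rewrite /mills_cst mulrDl mul1r.
apply: (@le_trans _ _ ((phi 1)^-1 * phi x)); last by rewrite lerDr ltW.
rewrite ler_pdivlMl// mulr1 !phiE ler_wpM2l ?normal_peak_ge0// ler_expR lerN2.
by rewrite ler_wpM2r// ler_pXn2r ?nnegrE// ltW.
Qed.

Lemma phiN (x : R) : phi (- x) = phi x.
Proof. by rewrite !phiE sqrrN. Qed.

Lemma ltailE (x : R) : \int[mu]_(t in `]-oo, x]) phi t = utail (- x).
Proof.
rewrite /utail /Rintegral -[x in LHS]opprK; congr fine.
rewrite ge0_integration_by_substitutionNy.
- by apply: eq_integral => t _; rewrite /= phiN.
- by apply: continuous_subspaceT; exact: continuous_phi.
- by move=> t _; exact: normal_pdf_ge0.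
Qed.

Section Solution.
Variable (h : R -> R).
Hypothesis ch : continuous h.
Hypothesis h01 : forall x, 0 <= h x <= 1.
Let c := \int[gam]_x h x.
Let k (x : R) := (h x - c) * phi x.

Let mh : measurable_fun setT h. Proof. exact: continuous_measurable_fun. Qed.

Let ih : gam.-integrable setT (EFin \o h).
Proof.
apply: (@integrable_gauss _ _ 1) => // x; rewrite mul1r.
have /andP[h0 h1] := h01 x; rewrite ger0_norm//; apply: (le_trans h1).
by rewrite lerDl exprn_even_ge0.
Qed.

Let c01 : 0 <= c <= 1.
Proof.
apply/andP; split.
  by apply: Rintegral_ge0 => x _; have /andP[] := h01 x.
rewrite -[leRHS](Rint_cst gam 1); apply: le_Rintegral => //.
  exact: finite_measure_integrable_cst.
by move=> x _; have /andP[] := h01 x.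
Qed.

Let hc x : `|h x - c| <= 1.
Proof.
have /andP[? ?] := h01 x; have /andP[? ?] := c01; rewrite ler_norml.
by apply/andP; split; lra.
Qed.

Let mhc : measurable_fun setT (fun x : R => h x - c).
Proof. exact: measurable_funB. Qed.

Let ik : mu.-integrable setT (EFin \o k).
Proof.
apply: (@integrable_phi _ _ 1) => // x; apply: (le_trans (hc x)).
by rewrite mul1r lerDl exprn_even_ge0.
Qed.

Let k_le x : `|k x| <= phi x.
Proof. by rewrite normrM (ger0_norm (normal_pdf_ge0 _ _ _)) ler_piMl// normal_pdf_ge0. Qed.

Let ik0 : \int[mu]_x k x = 0.
Proof.
rewrite /Rintegral /k -integral_gaussR// -/(Rintegral _ _ _) RintegralB//.
  by rewrite Rint_cst subrr.
exact: finite_measure_integrable_cst.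
Qed.

(* [F / phi] solves the equation. Since [k] has integral 0, [F] is also minus an
   integral over the right half-line, hence is bounded by either tail. *)
Let F (x : R) := \int[mu]_(t in `]-oo, x]) k t.

Let ck : continuous k.
Proof.
move=> x; apply: cvgM; last exact: continuous_phi.
by apply: cvgB; [exact: ch|exact: cvg_cst].
Qed.

Let abs_int (D : set (measurableTypeR R)) : measurable D ->
  `|\int[mu]_(t in D) k t| <= \int[mu]_(t in D) phi t.
Proof.
move=> mD; have ikD : mu.-integrable D (EFin \o k) by exact: integrableS ik.
have := le_normr_Rintegral mD ikD => /le_trans; apply; apply: le_Rintegral => //.
  exact: integrable_norm.
by apply: integrableS integrable_phi1.
Qed.

Let F_right x : `|F x| <= utail x.
Proof.
have : F x + \int[mu]_(t in `]x, +oo[) k t = 0.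
  rewrite -ik0 /F -Rintegral_setU//.
  - congr Rintegral; apply/seteqP; split=> t //= _; rewrite /= !in_itv/= andbT.
    by have [tx|tx] := leP t x; [left|right].
  - by apply: (integrableS measurableT _ _ ik) => //; exact: measurableU.
  - rewrite disj_set2E; apply/eqP/seteqP; split=> // t [] /=.
    by rewrite !in_itv/= andbT => h1; rewrite ltNge h1.
move=> /eqP; rewrite addr_eq0 => /eqP ->; rewrite normrN.
apply: (le_trans (abs_int _)) => //.
by rewrite Rintegral_itv_obnd_cbnd//; exact: integrableS integrable_phi1.
Qed.

Let F_left x : `|F x| <= utail (- x).
Proof. by rewrite -ltailE; exact: abs_int. Qed.

Let F_deriv (x : R) : is_derive x 1 F (k x).
Proof.
have xx : x < x + 1 by rewrite ltrDl.
have ikx : mu.-integrable [set` Interval -oo%O (BRight (x + 1))] (EFin \o k).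
  exact: integrableS ik.
have ckx : {for x, continuous k} by exact: ck.
have [d e] := continuous_FTC1 xx ikx (ltNyr x) ckx.
by apply: DeriveDef; [exact: d|rewrite -derive1E; exact: e].
Qed.

Let f (x : R) := F x / phi x.

Let F_abs x : `|F x| <= utail `|x|.
Proof.
have [x0|x0] := leP 0 x; first by rewrite (ger0_norm x0); exact: F_right.
by rewrite (ltr0_norm x0); exact: F_left.
Qed.

(** The bounds on [f] and [f'] do not involve the smoothness of [h]; this is what
   turns the argument into a total variation estimate. *)
Lemma stein_solution : exists f f' : R -> R,
  [/\ forall x : R, is_derive x 1 f (f' x), continuous f',
      forall x, `|f x| <= mills_cst, forall x, `|f' x| <= 2 &
      forall x, f' x - x * f x = h x - c].
Proof.
exists f, (fun x => (h x - c) + x * f x).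
have p0 x := phi_gt0 x.
have pn0 x : phi x != 0 by rewrite gt_eqF.
have pabs x : phi x = phi `|x|.
  by have [x0|x0] := leP 0 x; rewrite ?(ger0_norm x0)// (ltr0_norm x0) phiN.
have d (x : R) : is_derive x 1 f (h x - c + x * f x).
  have dF := F_deriv x; have dp := is_derive_phi x.
  have := @is_deriveM _ _ F (fun x => (phi x)^-1) x 1 _ _ dF (is_deriveV (pn0 x) dp).
  move=> D; apply: is_derive_eq; rewrite /k /f /GRing.scale/=.
  by field; exact: pn0.
have fb x : `|f x| <= mills_cst.
  rewrite /f normrM normfV (ger0_norm (ltW (p0 x))) ler_pdivrMr//.
  by apply: (le_trans (F_abs x)); rewrite [phi x]pabs; exact: mills_le.
have xfb x : `|x * f x| <= 1.
  rewrite /f mulrA normrM normfV (ger0_norm (ltW (p0 x))) ler_pdivrMr// mul1r normrM.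
  apply: (@le_trans _ _ (`|x| * utail `|x|)); first by rewrite ler_wpM2l.
  by rewrite [phi x]pabs; exact: mills_mul.
split=> //.
- move=> x; apply: cvgD; first by apply: cvgB; [exact: ch|exact: cvg_cst].
  apply: cvgM; first exact: cvg_id.
  by apply: differentiable_continuous; apply/derivable1_diffP; have [] := d x.
- move=> x; apply: (le_trans (ler_normD _ _)).
  by have := hc x; have := xfb x; lra.
- by move=> x; rewrite addrK.
Qed.

End Solution.
End Stein.

(** * From continuous functions to Borel sets *)

Section Regularity.
Context {R : realType}.
Variables P Q : probability (measurableTypeR R) R.

(** The approximating function must be the same for [P] and [Q], otherwise the
   two approximations could not be compared. *)
Definition approx (f : R -> R) : Prop :=
  [/\ measurable_fun setT f, forall x, 0 <= f x <= 1 &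
   forall e, 0 < e -> exists h : R -> R, [/\ continuous h, forall x, 0 <= h x <= 1,
     \int[P]_x `|f x - h x| <= e & \int[Q]_x `|f x - h x| <= e]].

Lemma integrable01 (M : probability (measurableTypeR R) R) (f : R -> R) :
  measurable_fun setT f -> (forall x, 0 <= f x <= 1) ->
  M.-integrable setT (EFin \o f).
Proof.
move=> mf f01.
have i1 : M.-integrable setT (EFin \o (fun=> 1 : R)) by exact: finite_measure_integrable_cst.
apply: (@le_integrable _ _ _ M setT measurableT _ _ _ _ i1); first exact/measurable_EFinP.
by move=> x _; have /andP[a b] := f01 x; rewrite /= lee_fin normr1 ger0_norm.
Qed.

Lemma integrable01B (M : probability (measurableTypeR R) R) (f g : R -> R) :
  measurable_fun setT f -> (forall x, 0 <= f x <= 1) ->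
  measurable_fun setT g -> (forall x, 0 <= g x <= 1) ->
  M.-integrable setT (EFin \o (fun x => `|f x - g x|)).
Proof.
move=> mf f01 mg g01; apply: integrable01.
  by apply: measurableT_comp => //; exact: measurable_funB.
move=> x; have /andP[a b] := f01 x; have /andP[a' b'] := g01 x.
by rewrite normr_ge0 ler_norml /=; apply/andP; split; lra.
Qed.

Lemma approx_triangle (M : probability (measurableTypeR R) R) (f g h : R -> R) e e' :
  measurable_fun setT f -> (forall x, 0 <= f x <= 1) ->
  measurable_fun setT g -> (forall x, 0 <= g x <= 1) ->
  measurable_fun setT h -> (forall x, 0 <= h x <= 1) ->
  \int[M]_x `|f x - g x| <= e -> \int[M]_x `|g x - h x| <= e' ->
  \int[M]_x `|f x - h x| <= e + e'.
Proof.
move=> mf f01 mg g01 mh h01 h1 h2.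
apply: (@le_trans _ _ (\int[M]_x (`|f x - g x| + `|g x - h x|))).
  apply: le_Rintegral => //.
  - exact: integrable01B.
  - exact: (integrableD measurableT (integrable01B M mf f01 mg g01) (integrable01B M mg g01 mh h01)).
  - by move=> x _; rewrite -(subrKA (g x)) ler_normD.
by rewrite RintegralD// ?lerD//; exact: integrable01B.
Qed.

Lemma approx_cont (h : R -> R) : continuous h -> (forall x, 0 <= h x <= 1) -> approx h.
Proof.
move=> ch h01; split=> //; first exact: continuous_measurable_fun.
move=> e e0; exists h; split=> //.
  under eq_Rintegral do rewrite subrr normr0.
  by rewrite Rint_cst ltW.
under eq_Rintegral do rewrite subrr normr0.
by rewrite Rint_cst ltW.
Qed.

Lemma cvg_dist (M : probability (measurableTypeR R) R) (f_ : nat -> R -> R) (f : R -> R) e :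
  (forall n, measurable_fun setT (f_ n)) -> (forall n x, 0 <= f_ n x <= 1) ->
  measurable_fun setT f ->
  (forall x, f_ n x @[n --> \oo] --> f x) -> (forall x, 0 <= f x <= 1) -> 0 < e ->
  \forall n \near \oo, \int[M]_x `|f x - f_ n x| <= e.
Proof.
move=> mf_ f_01 mf cf f01 e0.
have i1 : M.-integrable setT (EFin \o (fun=> 1 : R)) by exact: finite_measure_integrable_cst.
have m1 n : measurable_fun setT (EFin \o f_ n) by exact/measurable_EFinP.
have m2 : measurable_fun setT (EFin \o f) by exact/measurable_EFinP.
have c1 : {ae M, forall x, setT x -> (EFin \o f_ n) x @[n --> \oo] --> (EFin \o f) x}.
  by apply: aeW => x _; apply: cvg_EFin; [near=> n|exact: cf].
have d1 : {ae M, forall x n, setT x -> (`|(EFin \o f_ n) x| <= (EFin \o (fun=> 1%R : R)) x)%E}.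
  apply: aeW => x n _; have /andP[a b] := f_01 n x.
  by rewrite /= lee_fin ger0_norm.
have [_ dc _] := @dominated_convergence _ _ _ M setT measurableT _ _ _ m1 m2 c1 i1 d1.
have /fine_cvg /= fc : (\int[M]_x `|(f_ n x)%:E - (f x)%:E|)%E @[n --> \oo] --> 0%:E by exact: dc.
move/cvgr0Pnorm_le : fc => /(_ e e0); apply: filterS => n.
rewrite ger0_norm; last by apply: Rintegral_ge0 => x _; exact: normr_ge0.
by under eq_Rintegral do rewrite distrC.
Unshelve. all: by end_near. Qed.

Lemma approx_limit (f_ : nat -> R -> R) (f : R -> R) :
  (forall n, approx (f_ n)) -> (forall x, f_ n x @[n --> \oo] --> f x) ->
  (forall x, 0 <= f x <= 1) -> approx f.
Proof.
move=> af cf f01.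
have mf_ n : measurable_fun setT (f_ n) by have [] := af n.
have f_01 n x : 0 <= f_ n x <= 1 by have [_ + _] := af n.
have mf : measurable_fun setT f.
  by apply: (measurable_fun_cvg mf_) => x _; exact: cf.
split=> // e e0.
have e2 : 0 < e / 2 by rewrite divr_gt0.
have [n [p1 q1]] : exists n, \int[P]_x `|f x - f_ n x| <= e / 2 /\
    \int[Q]_x `|f x - f_ n x| <= e / 2.
  have hP := cvg_dist P mf_ f_01 mf cf f01 e2.
  have hQ := cvg_dist Q mf_ f_01 mf cf f01 e2.
  have [n _ hn] := filterI hP hQ.
  by exists n; exact: (hn n (leqnn n)).
have [_ _ /(_ _ e2) [h [ch h01 p2 q2]]] := af n.
have mh : measurable_fun setT h by exact: continuous_measurable_fun.
exists h; split=> //; rewrite [e]splitr.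
  exact: (approx_triangle mf f01 (mf_ n) (f_01 n) mh h01).
exact: (approx_triangle mf f01 (mf_ n) (f_01 n) mh h01).
Qed.

Lemma approx_compl (f : R -> R) : approx f -> approx (fun x => 1 - f x).
Proof.
move=> [mf f01 af]; split.
- exact: measurable_funB.
- by move=> x; have /andP[a b] := f01 x; apply/andP; split; lra.
move=> e /af [h [ch h01 hp hq]].
have E : (fun x => `|1 - f x - (1 - h x)|) = (fun x => `|f x - h x|).
  by apply/funext => x; rewrite distrC; congr `|_|; ring.
exists (fun x => 1 - h x); split.
- by move=> x; apply: cvgB; [exact: cvg_cst|exact: ch].
- by move=> x; have /andP[a b] := h01 x; apply/andP; split; lra.
- by rewrite E.
- by rewrite E.
Qed.

Lemma max_dist (a b c d : R) :
  `|Num.max a b - Num.max c d| <= `|a - c| + `|b - d|.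
Proof.
have key (u v w z : R) : Num.max u v - Num.max w z <= `|u - w| + `|v - z|.
  have h1 := ler_norm (u - w); have h2 := ler_norm (v - z).
  have h3 := normr_ge0 (u - w); have h4 := normr_ge0 (v - z).
  have h5 : w <= Num.max w z by rewrite le_max lexx.
  have h6 : z <= Num.max w z by rewrite le_max lexx orbT.
  by rewrite lerBlDr ge_max; apply/andP; split; lra.
rewrite ler_norml lerNl opprB key andbT.
by rewrite (distrC a) (distrC b) key.
Qed.

Lemma approx_max (f g : R -> R) : approx f -> approx g ->
  approx (fun x => Num.max (f x) (g x)).
Proof.
move=> [mf f01 af] [mg g01 ag].
have max01 (u v : R) : 0 <= u <= 1 -> 0 <= v <= 1 -> 0 <= Num.max u v <= 1.
  by move=> /andP[a b] /andP[a' b']; rewrite le_max a ge_max b b'.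
split.
- exact: measurable_maxr.
- by move=> x; apply: max01.
move=> e e0.
have e2 : 0 < e / 2 by rewrite divr_gt0.
have [h [ch h01 hp hq]] := af _ e2; have [k [ck k01 kp kq]] := ag _ e2.
have mh : measurable_fun setT h by exact: continuous_measurable_fun.
have mk : measurable_fun setT k by exact: continuous_measurable_fun.
have key (M : probability (measurableTypeR R) R) :
    \int[M]_x `|f x - h x| <= e / 2 -> \int[M]_x `|g x - k x| <= e / 2 ->
    \int[M]_x `|Num.max (f x) (g x) - Num.max (h x) (k x)| <= e.
  move=> h1 h2.
  apply: (@le_trans _ _ (\int[M]_x (`|f x - h x| + `|g x - k x|))).
    apply: le_Rintegral => //.
    - apply: integrable01B; [exact: measurable_maxr|by move=> x; exact: max01|
        exact: measurable_maxr|by move=> x; exact: max01].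
    - exact: (integrableD measurableT (integrable01B M mf f01 mh h01) (integrable01B M mg g01 mk k01)).
    - by move=> x _; exact: max_dist.
  rewrite RintegralD//; try exact: integrable01B.
  by apply: (le_trans (lerD h1 h2)); rewrite -splitr.
exists (fun x => Num.max (h x) (k x)); split.
- by move=> x; apply: (@continuous_max R R h k x); [exact: ch|exact: ck].
- by move=> x; exact: max01.
- exact: key.
- exact: key.
Qed.

Definition approx_set : set (set R) := [set B | approx (\1_B : R -> R)].

Let ind01 (B : set R) x : 0 <= (\1_B x : R) <= 1.
Proof. by rewrite indicE; case: (_ \in _); rewrite /= ?lexx ?ler01. Qed.

(** Unions are increasing limits of maxima, which keep continuity and the
   range [[0, 1]]. *)
Lemma approx_set_sigma : sigma_algebra setT approx_set.
Proof.
have g0 : approx_set set0.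
  rewrite /approx_set /= (_ : \1_set0 = (fun=> 0)); last by apply/funext => x; rewrite indicE in_set0.
  by apply: approx_cont; [move=> x; exact: cvg_cst|move=> x; rewrite lexx ler01].
split=> // [A gA|A gA].
  rewrite /approx_set /= (_ : \1_(setT `\` A) = (fun x => 1 - \1_A x)); first exact: approx_compl.
  by apply/funext => x; rewrite setTD !indicE in_setC; case: (_ \in _); rewrite /= ?subrr ?subr0.
pose U n := \bigcup_(i < n) A i.
have gU n : approx_set (U n).
  elim: n => [|n IH]; first by rewrite /U bigcup_mkord big_ord0.
  rewrite /approx_set /= (_ : \1_(U n.+1) = (fun x => Num.max (\1_(U n) x) (\1_(A n) x))).
    by apply: approx_max; [exact: IH|exact: gA].
  apply/funext => x; rewrite /U bigcup_mkord big_ord_recr/= -bigcup_mkord !indicE in_setU.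
  by case: (_ \in _); case: (_ \in _); rewrite /= ?maxxx ?(max_l ler01) ?(max_r ler01).
apply: (approx_limit gU); last exact: ind01.
move=> x; apply: cvg_near_cst.
have [[i _ Aix]|nx] := pselect ((\bigcup_k A k) x).
  exists i.+1 => // n /= ni; rewrite !indicE !mem_set//; first by exists i.
  by exists i.
exists 0%N => // n _; rewrite !indicE !memNset// => -[i _ Aix]; apply: nx; exists i => //.
Qed.

Lemma approx_set_ray a : approx_set `]a, +oo[%classic.
Proof.
pose f_ n (x : R) := Num.min 1 (Num.max 0 (n%:R * (x - a))).
apply: (@approx_limit f_); last exact: ind01.
  move=> n; apply: approx_cont.
    move=> x; apply: (@continuous_min R R (fun=> 1) (fun x => Num.max 0 (n%:R * (x - a))) x).
      exact: cvg_cst.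
    apply: (@continuous_max R R (fun=> 0) (fun x => n%:R * (x - a)) x); first exact: cvg_cst.
    apply: cvgM; first exact: cvg_cst.
    by apply: cvgB; [exact: cvg_id|exact: cvg_cst].
  by move=> x; rewrite /f_ le_min ler01 le_max lexx ge_min lexx.
move=> x; apply: cvg_near_cst; rewrite indicE.
have [ax|xa] := ltP a x; last first.
  exists 0%N => // n _; rewrite memNset/= ?in_itv/= ?andbT; last by rewrite ltNge xa.
  rewrite /f_ max_l ?min_r//.
  by rewrite mulr_ge0_le0// subr_le0.
rewrite mem_set/= ?in_itv/= ?andbT//.
have xa0 : 0 < x - a by rewrite subr_gt0.
exists (Num.truncn (x - a)^-1).+1 => // n /= hn.
have h1 : 1 <= n%:R * (x - a).
  rewrite -ler_pdivrMr// mul1r ltW//; apply: (lt_le_trans (truncnS_gt _)).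
  by rewrite ler_nat.
by rewrite /f_ max_r ?min_l// (le_trans ler01).
Qed.

Lemma measurable_approx_set (B : set (measurableTypeR R)) : measurable B -> approx_set B.
Proof.
have e : (@measurable _ (measurableTypeR R)) = <<s (@RGenOInfty.G R) >> by exact: RGenOInfty.measurableE.
rewrite e; apply: smallest_sub; first exact: approx_set_sigma.
by move=> _ [a ->]; exact: approx_set_ray.
Qed.

(** The indicators that can be approximated form a sigma-algebra which contains
   the rays. *)
Lemma tv_of_continuous (e : R) :
  (forall h : R -> R, continuous h -> (forall x, 0 <= h x <= 1) ->
    `|\int[P]_x h x - \int[Q]_x h x| <= e) ->
  forall B : set (measurableTypeR R), measurable B -> `|fine (P B) - fine (Q B)| <= e.
Proof.
move=> he B mB; apply/ler_addgt0Pr => d d0.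
have [mi _ /(_ (d / 2)) []] := measurable_approx_set mB; first by rewrite divr_gt0.
move=> h [ch h01 hp hq].
have mh : measurable_fun setT h by exact: continuous_measurable_fun.
have key (M : probability (measurableTypeR R) R) :
    \int[M]_x `|\1_B x - h x| <= d / 2 -> `|fine (M B) - \int[M]_x h x| <= d / 2.
  move=> hM.
  have -> : fine (M B) = \int[M]_x (\1_B x).
    by rewrite /Rintegral integral_indic// setIT.
  rewrite -RintegralB//; [|exact: integrable01|exact: integrable01].
  apply: le_trans hM; apply: le_normr_Rintegral => //.
  exact: (integrableB measurableT (integrable01 M mi (@ind01 B)) (integrable01 M mh h01)).
have kP := key P hp; have kQ := key Q hq; have k3 := he h ch h01.
have -> : fine (P B) - fine (Q B) = (fine (P B) - \int[P]_x h x) +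
   (\int[P]_x h x - \int[Q]_x h x) - (fine (Q B) - \int[Q]_x h x) by ring.
apply: (le_trans (ler_normB _ _)).
have := ler_normD (fine (P B) - \int[P]_x h x) (\int[P]_x h x - \int[Q]_x h x).
lra.
Qed.

End Regularity.

(** * Measurability of Lipschitz functions *)

Section LipMeas.
Context {R : realType}.
Notation cylT I := (g_sigma_algebraType (@rect R I)).

(** The sigma-algebra on [I -> R] comes from rectangles, without reference to
   the topology. Rounding the argument to the grid of mesh [1/k] gives functions
   that are constant on countably many rectangles and converge to [F]. *)
Lemma measurable_lipschitz (I : finType) (F : (I -> R) -> R) :
  (forall a b, (F b - F a) ^+ 2 <= \sum_i (b i - a i) ^+ 2) ->
  measurable_fun setT (F : cylT I -> R).
Proof.
move=> lip.
pose r (k : nat) (x : I -> R) (i : I) : R := (Num.floor (k.+1%:R * x i))%:~R / k.+1%:R.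
have rx k x i : (x i - r k x i) ^+ 2 <= (k.+1%:R^-1) ^+ 2.
  have k0 : 0 < k.+1%:R :> R by [].
  have h1 : 0 <= x i - r k x i.
    by rewrite subr_ge0 /r ler_pdivrMr// [leRHS]mulrC floor_le.
  have h2 : x i - r k x i <= k.+1%:R^-1.
    rewrite lerBlDl /r -[X in _ + X]mul1r -mulrDl ler_pdivlMr// [leLHS]mulrC.
    by have /ltW := floorD1_gt (k.+1%:R * x i); rewrite intrD.
  by rewrite ler_pXn2r ?nnegrE ?invr_ge0.
apply: (@measurable_fun_cvg _ (cylT I) R setT (fun k x => F (r k x))) => [k|x _].
- move=> _ Y mY; rewrite setTI.
  pose z0 (z : {ffun I -> int}) : I -> R := fun i => (z i)%:~R / k.+1%:R.
  pose cell (z : {ffun I -> int}) : set (cylT I) := [set x | forall i, Num.floor (k.+1%:R * x i) = z i].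
  rewrite (_ : _ @^-1` Y = \bigcup_z (if `[< Y (F (z0 z)) >] then cell z else set0)).
    apply: countable_bigcupT_measurable; first exact: countableP.
    move=> z; case: asboolP => // _.
    apply: sub_sigma_algebra; exists (fun i => [set t | Num.floor (k.+1%:R * t) = z i]) => // i.
    have -> : [set t : R | Num.floor (k.+1%:R * t) = z i] =
        (fun t => k.+1%:R * t) @^-1` `[(z i)%:~R, (z i + 1)%:~R[%classic.
      apply/seteqP; split=> t /=; rewrite in_itv/=.
        by move=> <-; rewrite floor_le floorD1_gt.
      by move=> h; apply: floor_def.
    rewrite -[_ @^-1` _]setTI; apply: (@measurable_funM _ _ _ setT (fun=> k.+1%:R : R) id) => //.
  apply/seteqP; split=> x /=.
    move=> h; exists [ffun i => Num.floor (k.+1%:R * x i)] => //.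
    have e : z0 [ffun i => Num.floor (k.+1%:R * x i)] = r k x.
      by apply/funext => i; rewrite /z0 ffunE.
    by rewrite e asboolT// => i; rewrite ffunE.
  move=> [z _]; case: asboolP => // Yz cz.
  by rewrite (_ : r k x = z0 z)//; apply/funext => i; rewrite /r cz.
- apply/cvgrPdist_le => e e0.
  pose M : R := 1 + #|I|%:R.
  have M1 : 1 <= M by rewrite lerDl.
  near=> k.
  have kM : M / e <= k.+1%:R.
    near: k; exists (Num.truncn (M / e)) => // k /= hk.
    by apply/ltW/(lt_le_trans (truncnS_gt _)); rewrite ler_nat ltnS.
  have h1 : (F x - F (r k x)) ^+ 2 <= e ^+ 2.
    apply: (le_trans (lip _ _)).
    apply: (@le_trans _ _ (\sum_(i : I) (k.+1%:R^-1) ^+ 2)).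
      by apply: ler_sum => i _; exact: rx.
    rewrite sumr_const -[X in X <= _]mulr_natl.
    have k0 : 0 < k.+1%:R :> R by [].
    have h2 : k.+1%:R^-1 <= e / M.
      by rewrite -[leRHS]invrK lef_pV2 ?posrE ?invr_gt0 ?divr_gt0// ?invf_div// (lt_le_trans ltr01).
    have h3 : (k.+1%:R^-1) ^+ 2 <= (e / M) ^+ 2.
      by rewrite ler_pXn2r ?nnegrE ?invr_ge0// divr_ge0// ltW// (lt_le_trans ltr01).
    apply: (@le_trans _ _ (M ^+ 2 * (e / M) ^+ 2)).
      apply: ler_pM => //; rewrite ?sqr_ge0//.
      rewrite (_ : #|_| = #|I|); last exact: eq_card.
      by rewrite /M; have := ler0n R #|I|; move: (#|I|%:R) => u; nra.
    by rewrite -exprMn mulrCA mulfV ?mulr1// gt_eqF// (lt_le_trans ltr01).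
  by rewrite -(ler_pXn2r (n := 2)) ?nnegrE ?(ltW e0)// real_normK ?num_real.
Unshelve. all: by end_near. Qed.

End LipMeas.

(** * The chi-square variable *)

Section ChiSquare.
Context {R : realType}.
Notation cylT I := (g_sigma_algebraType (@rect R I)).
Variables (n p : nat) (X : 'M[R]_(n, p)).
Hypothesis rX : \rank X = p.
Let H := hat X.

Definition vec (x : 'I_n -> R) : 'cV[R]_n := \col_i x i.
(** A chi-square variable with [p] degrees of freedom when [x] is standard
   Gaussian. *)
Definition chisq (x : 'I_n -> R) : R := nrm2 (hat X *m vec x).
Let Hx (i : 'I_n) (x : 'I_n -> R) : R := (H *m vec x) i 0.

Lemma mulmx_vec (A : 'M[R]_n) x i : (A *m vec x) i 0 = \sum_j A i j * x j.
Proof. by rewrite mxE; apply: eq_bigr => j _; rewrite mxE. Qed.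

Lemma mulmx_delta (A : 'M[R]_n) i : (A *m delta_mx i (0 : 'I_1)) i 0 = A i i.
Proof.
rewrite mxE (bigD1 i)//= !mxE !eqxx mulr1 big1 ?addr0// => j /negbTE ji.
by rewrite !mxE ji mulr0.
Qed.

Lemma nrm2_vec x : nrm2 (vec x) = \sum_i x i ^+ 2.
Proof. by apply: eq_bigr => i _; rewrite mxE expr2. Qed.

Lemma chisq_ge0 x : 0 <= chisq x.
Proof. exact: nrm2_ge0. Qed.

Lemma chisq_le x : chisq x <= \sum_i x i ^+ 2.
Proof. by rewrite -nrm2_vec; exact: nrm2_hat_le. Qed.

Let chisqE x : chisq x = \sum_i Hx i x ^+ 2.
Proof. by apply: eq_bigr => i _; rewrite expr2. Qed.

Let chisq_dot x : chisq x = \sum_i x i * Hx i x.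
Proof.
rewrite /chisq /nrm2 (dot_hat X) mulmxA (hat_idem rX).
by apply: eq_bigr => i _; rewrite mxE.
Qed.

Let mHx i : measurable_fun setT (Hx i : cylT 'I_n -> R).
Proof.
rewrite (_ : Hx i = (fun x => \sum_j H i j * x j)); last first.
  by apply/funext => x; exact: mulmx_vec.
by apply: measurable_sum => j; apply: measurable_funM => //; exact: measurable_coord.
Qed.

Lemma measurable_chisq : measurable_fun setT (chisq : cylT 'I_n -> R).
Proof.
rewrite (_ : chisq = (fun x => \sum_i Hx i x ^+ 2)); last exact/funext/chisqE.
by apply: measurable_sum => i; exact: measurable_funX.
Qed.

Let vec_upd x i t : vec (upd x i t) = vec x + (t - x i) *: delta_mx i 0.
Proof.
apply/matrixP => j k; rewrite !mxE ord1 eqxx andbT /upd.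
by have [->|ji] := eqVneq j i; rewrite ?mulr1 ?mulr0 ?addr0// addrC subrK.
Qed.

Let Hx_upd x i t : Hx i (upd x i t) = Hx i x + (t - x i) * H i i.
Proof.
rewrite /Hx vec_upd mulmxDr -scalemxAr -(mulmx_delta H i).
by move: (H *m vec x) (H *m delta_mx i 0) => u v; rewrite !mxE.
Qed.

Let dot_delta (y : 'cV[R]_n) i : dot y (delta_mx i 0) = y i 0.
Proof.
rewrite /dot (bigD1 i)//= !mxE !eqxx mulr1 big1 ?addr0// => j /negbTE ji.
by rewrite !mxE ji mulr0.
Qed.

Let nrm2_Hdelta i : nrm2 (H *m delta_mx i (0 : 'I_1)) = H i i.
Proof. by rewrite /nrm2 (dot_hat X) mulmxA (hat_idem rX) dotC dot_delta mulmx_delta. Qed.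

Let chisq_upd x i t : chisq (upd x i t) =
  chisq x + 2 * (t - x i) * Hx i x + (t - x i) ^+ 2 * H i i.
Proof.
rewrite /chisq vec_upd mulmxDr -scalemxAr nrm2D dotZr.
rewrite dotC (dot_hat X) mulmxA (hat_idem rX) dotC dot_delta -/(Hx i x).
have -> : nrm2 ((t - x i) *: (hat X *m delta_mx i 0)) = (t - x i) ^+ 2 * H i i.
  by rewrite -nrm2_Hdelta /nrm2 dotZl dotZr mulrA expr2.
by rewrite mulrA.
Qed.

Let Hii i : 0 <= H i i <= 1.
Proof.
rewrite -nrm2_Hdelta nrm2_ge0/=; apply: (le_trans (nrm2_hat_le rX _)).
by rewrite /nrm2 dot_delta mxE !eqxx.
Qed.

Let Hx2_le i x : Hx i x ^+ 2 <= chisq x.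
Proof.
by rewrite chisqE (bigD1 i)//= lerDl sumr_ge0// => j _; exact: sqr_ge0.
Qed.

Let x2_le (i : 'I_n) (x : 'I_n -> R) : x i ^+ 2 <= \sum_i x i ^+ 2.
Proof.
by rewrite (bigD1 i)//= lerDl sumr_ge0// => j _; exact: sqr_ge0.
Qed.

Section Moments.
Context d (T : measurableType d) (P : probability T R) (xi : 'I_n -> T -> R).
Hypothesis g : gaussian_family P xi.

Let cn : R := 2 * (1 + #|'I_n|%:R).

Let Wi (F : ('I_n -> R) -> R) (A : R) :
  measurable_fun setT (F : cylT 'I_n -> R) -> 0 <= A ->
  (forall x, `|F x| <= A * (1 + \sum_i x i ^+ 2) ^+ 2) ->
  P.-integrable setT (EFin \o (fun w => F (xi^~ w))).
Proof.
move=> mF A0 b; apply: (@gf_integrable _ _ _ P _ xi _ (A * cn) g).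
  exact: (measurableT_comp mF (measurable_family (gf_meas g))).
move=> w; apply: (le_trans (b _)); rewrite -mulrA ler_wpM2l//.
exact: sqr_sum_sqr_le_Q4.
Qed.

Let S1 (x : 'I_n -> R) : 1 <= 1 + \sum_i x i ^+ 2.
Proof. by rewrite lerDl sumr_ge0// => i _; exact: sqr_ge0. Qed.

(** With [H] the projection, which is symmetric and idempotent,
   [W = sum_i xi_i (H xi)_i] and [dW / dxi_i = 2 (H xi)_i]. Integrating by parts in
   each [xi_i] produces [p f(W)], where [p] is the trace of [H], and
   [2 |H xi|^2 f'(W) = 2 W f'(W)]. *)
Lemma chisq_ibp (f f' : R -> R) (A : R) : 0 <= A ->
  (forall x : R, is_derive x 1 f (f' x)) -> continuous f' ->
  (forall x, 0 <= x -> `|f x| <= A * (1 + x)) -> (forall x, `|f' x| <= A) ->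
  \int[P]_w (chisq (xi^~ w) * f (chisq (xi^~ w))) =
  p%:R * \int[P]_w f (chisq (xi^~ w)) +
  2 * \int[P]_w (chisq (xi^~ w) * f' (chisq (xi^~ w))).
Proof.
move=> A0 df cf' bf bf'.
have cf : continuous f.
  by move=> x; apply: differentiable_continuous; apply/derivable1_diffP; have [] := df x.
have mf : measurable_fun setT (fun x : cylT 'I_n => f (chisq x)).
  by apply: (measurableT_comp (continuous_measurable_fun cf)); exact: measurable_chisq.
have mf' : measurable_fun setT (fun x : cylT 'I_n => f' (chisq x)).
  by apply: (measurableT_comp (continuous_measurable_fun cf')); exact: measurable_chisq.
pose U i x := Hx i x * f (chisq x).
pose V i x := H i i * f (chisq x) + 2 * (Hx i x ^+ 2 * f' (chisq x)).
have mU i : measurable_fun setT (U i : cylT 'I_n -> R) by exact: measurable_funM.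
have mV i : measurable_fun setT (V i : cylT 'I_n -> R).
  apply: measurable_funD; first exact: measurable_funM.
  by apply: measurable_funM => //; apply: measurable_funM => //; exact: measurable_funX.
have dU i x (t : R) : is_derive t 1 (fun s => U i (upd x i s)) (V i (upd x i t)).
  have -> : (fun s : R => U i (upd x i s)) = (fun s : R => (Hx i x + (s - x i) * H i i) *
     f (chisq x + 2 * (s - x i) * Hx i x + (s - x i) ^+ 2 * H i i)).
    by apply/funext => s; rewrite /U Hx_upd chisq_upd.
  rewrite /V Hx_upd chisq_upd.
  pose q (s : R) := chisq x + 2 * (s - x i) * Hx i x + (s - x i) ^+ 2 * H i i.
  have dq : is_derive t 1 q (2 * (Hx i x + (t - x i) * H i i)).
    by apply: is_derive_eq; rewrite /GRing.scale/=; ring.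
  have dfq : is_derive t 1 (f \o q) (f' (q t) * (2 * (Hx i x + (t - x i) * H i i))).
    exact: (@is_derive1_comp _ f q t _ _ (df (q t)) dq).
  have dl : is_derive t 1 (fun s : R => Hx i x + (s - x i) * H i i) (H i i).
    by apply: is_derive_eq; rewrite /GRing.scale/=; ring.
  have := is_deriveM dl dfq => D.
  by apply: is_derive_eq; rewrite /GRing.scale/= /q; ring.
have cV i x : continuous (fun t => V i (upd x i t)).
  have -> : (fun t : R => V i (upd x i t)) = (fun t : R =>
     H i i * f (chisq x + 2 * (t - x i) * Hx i x + (t - x i) ^+ 2 * H i i) +
     2 * ((Hx i x + (t - x i) * H i i) ^+ 2 *
        f' (chisq x + 2 * (t - x i) * Hx i x + (t - x i) ^+ 2 * H i i))).
    by apply/funext => t; rewrite /V Hx_upd chisq_upd.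
  have cq : continuous (fun t : R => chisq x + 2 * (t - x i) * Hx i x + (t - x i) ^+ 2 * H i i).
    move=> t; apply: differentiable_continuous; apply/derivable1_diffP; exact: ex_derive.
  have cl : continuous (fun t : R => (Hx i x + (t - x i) * H i i) ^+ 2).
    move=> t; apply: differentiable_continuous; apply/derivable1_diffP; exact: ex_derive.
  move=> t; apply: cvgD; apply: cvgM; try exact: cvg_cst.
    exact: (continuous_comp (cq t) (cf _)).
  apply: cvgM; first exact: cl.
  exact: (continuous_comp (cq t) (cf' _)).
have ukey (u : R) : 1 <= u -> A * u <= A * u ^+ 2.
  by move=> u1; rewrite ler_wpM2l// expr2 ler_peMl// (le_trans ler01).
have bW x : `|f (chisq x)| <= A * (1 + \sum_i x i ^+ 2).
  apply: (le_trans (bf _ (chisq_ge0 x))); rewrite ler_wpM2l// lerD2l.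
  exact: chisq_le.
have Hb i x : `|Hx i x| <= 1 + \sum_i x i ^+ 2.
  have h1 := le_trans (Hx2_le i x) (chisq_le x).
  rewrite -(real_normK (num_real (Hx i x))) in h1.
  have := sqr_ge0 (`|Hx i x| - 1); have := sqr_ge0 `|Hx i x|; lra.
have xHb i x : `|x i * Hx i x| <= 1 + \sum_i x i ^+ 2.
  have h1 := le_trans (Hx2_le i x) (chisq_le x); have h2 := x2_le i x.
  have := sqr_ge0 (x i - Hx i x); have := sqr_ge0 (x i + Hx i x) => h3 h4.
  by rewrite ler_norml; apply/andP; split; lra.
have bU i x : `|U i x| <= 3 * A * (1 + \sum_i x i ^+ 2) ^+ 2.
  rewrite normrM (_ : 3 * A * _ = (1 + \sum_i x i ^+ 2) * (3 * (A * (1 + \sum_i x i ^+ 2)))); last by ring.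
  apply: ler_pM => //; apply: (le_trans (bW x)).
  have := le_trans (normr_ge0 _) (bW x); lra.
have bxU i x : `|x i * U i x| <= 3 * A * (1 + \sum_i x i ^+ 2) ^+ 2.
  rewrite mulrA normrM (_ : 3 * A * _ = (1 + \sum_i x i ^+ 2) * (3 * (A * (1 + \sum_i x i ^+ 2)))); last by ring.
  apply: ler_pM => //; apply: (le_trans (bW x)).
  have := le_trans (normr_ge0 _) (bW x); lra.
have bV i x : `|V i x| <= 3 * A * (1 + \sum_i x i ^+ 2) ^+ 2.
  have /andP[H0 H1] := Hii i.
  have h1 : `|H i i * f (chisq x)| <= A * (1 + \sum_i x i ^+ 2).
    rewrite normrM (ger0_norm H0) -[leRHS]mul1r; apply: ler_pM => //.
  have h2 : `|2 * (Hx i x ^+ 2 * f' (chisq x))| <= 2 * ((1 + \sum_i x i ^+ 2) * A).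
    rewrite normrM (ger0_norm (_ : 0 <= 2))// ler_wpM2l// normrM (ger0_norm (sqr_ge0 _)).
    apply: ler_pM => //; first exact: sqr_ge0.
    by apply: (le_trans (Hx2_le i x)); apply: (le_trans (chisq_le x)); rewrite lerDr.
  apply: (le_trans (ler_normD _ _)); apply: (le_trans (lerD h1 h2)).
  have := S1 x; move: (1 + \sum_i x i ^+ 2) => u u1; have := ukey u u1; have := mulr_ge0 A0 (le_trans ler01 u1); lra.
have toQ (F : ('I_n -> R) -> R) x : `|F x| <= 3 * A * (1 + \sum_i x i ^+ 2) ^+ 2 ->
   `|F x| <= 3 * A * cn * Q4 x.
  move=> h; apply: (le_trans h); rewrite -(mulrA (3 * A)) ler_wpM2l ?mulr_ge0//.
  exact: sqr_sum_sqr_le_Q4.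
have A30 : 0 <= 3 * A by rewrite mulr_ge0.
have E i : \int[P]_w (xi i w * U i (xi^~ w)) = \int[P]_w V i (xi^~ w).
  apply: (@gf_ibp _ _ _ P _ xi i (U i) (V i) (3 * A * cn) g (mU i) (mV i) (dU i) (cV i)).
  - by move=> x; apply: toQ.
  - by move=> x; apply: (toQ (fun x => x i * U i x)).
  - by move=> x; apply: toQ.
have mxU i : measurable_fun setT (fun x : cylT 'I_n => x i * U i x).
  by apply: measurable_funM => //; exact: measurable_coord.
transitivity (\sum_i \int[P]_w (xi i w * U i (xi^~ w))).
  rewrite -Rint_sum; last by move=> i; exact: (@Wi (fun x => x i * U i x) _ (mxU i) A30 (bxU i)).
  congr Rintegral; apply/funext => w; rewrite {1}chisq_dot mulr_suml.
  by apply: eq_bigr => i _; rewrite mulrA.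
transitivity (\sum_i \int[P]_w V i (xi^~ w)); first by apply: eq_bigr => i _; exact: E.
have bfW x : `|f (chisq x)| <= 3 * A * (1 + \sum_i x i ^+ 2) ^+ 2.
  apply: (le_trans (bW x)); have := S1 x; move: (1 + \sum_i x i ^+ 2) => u u1; have := ukey u u1; have := mulr_ge0 A0 (le_trans ler01 u1); lra.
have ifW := @Wi (fun x => f (chisq x)) _ mf A30 bfW.
have mWf' : measurable_fun setT (fun x : cylT 'I_n => chisq x * f' (chisq x)).
  by apply: measurable_funM => //; exact: measurable_chisq.
have bWf' x : `|chisq x * f' (chisq x)| <= 3 * A * (1 + \sum_i x i ^+ 2) ^+ 2.
  rewrite normrM (ger0_norm (chisq_ge0 x)).
  apply: (@le_trans _ _ ((1 + \sum_i x i ^+ 2) * A)).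
    apply: ler_pM => //; first exact: chisq_ge0.
    by apply: (le_trans (chisq_le x)); rewrite lerDr.
  have := S1 x; move: (1 + \sum_i x i ^+ 2) => u u1; have := ukey u u1; have := mulr_ge0 A0 (le_trans ler01 u1); lra.
have iWf' := @Wi (fun x => chisq x * f' (chisq x)) _ mWf' A30 bWf'.
rewrite -Rint_sum; last by move=> i; exact: (@Wi (V i) _ (mV i) A30 (bV i)).
rewrite -RintegralZl// -RintegralZl// -RintegralD//; last 2 first.
- exact: (integrableZl measurableT p%:R ifW).
- exact: (integrableZl measurableT 2 iWf').
congr Rintegral; apply/funext => w.
rewrite /V big_split/= -mulr_suml -mulr_sumr -mulr_suml -chisqE.
by congr (_ * _ + _); rewrite -(hat_tr rX).
Qed.

End Moments.
End ChiSquare.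

Section ChiSquareNormal.
Context {R : realType}.
Notation gam := (normal_prob (0:R) 1).
Variables (n p : nat) (X : 'M[R]_(n, p)).
Hypothesis rX : \rank X = p.
Context d (T : measurableType d) (P : probability T R) (xi : 'I_n -> T -> R).
Hypothesis g : gaussian_family P xi.

Let W w := chisq X (xi^~ w).

Let mW : measurable_fun setT W.
Proof. exact: (measurableT_comp (measurable_chisq X) (measurable_family (gf_meas g))). Qed.

Let W0 w : 0 <= W w. Proof. exact: chisq_ge0. Qed.

Let cn : R := 2 * (1 + #|'I_n|%:R).

Let W2_le w : (1 + W w) ^+ 2 <= cn * Q4 (xi^~ w).
Proof.
apply: le_trans (sqr_sum_sqr_le_Q4 (xi^~ w)).
have h := chisq_le rX (xi^~ w); have h0 := W0 w.
by rewrite lerXn2r ?nnegrE ?lerD2l// addr_ge0// (le_trans h0 h).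
Qed.

Lemma integrable_chisq (F : T -> R) (A : R) : measurable_fun setT F -> 0 <= A ->
  (forall w, `|F w| <= A * (1 + W w) ^+ 2) -> P.-integrable setT (EFin \o F).
Proof.
move=> mF A0 b; apply: (@gf_integrable _ _ _ P _ xi _ (A * cn) g) => // w.
by apply: (le_trans (b _)); rewrite -mulrA ler_wpM2l.
Qed.

Let iW : P.-integrable setT (EFin \o W).
Proof.
apply: (@integrable_chisq _ 1) => // w; rewrite ger0_norm// mul1r.
have := W0 w; nra.
Qed.

Let iW2 : P.-integrable setT (EFin \o (fun w => W w ^+ 2)).
Proof.
apply: (@integrable_chisq _ 1) => // [|w]; first exact: measurable_funX.
by rewrite ger0_norm ?sqr_ge0// mul1r; have := W0 w; nra.
Qed.

(** The first two moments are [chisq_ibp] for [f = 1] and [f = id]. *)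
Lemma chisq_mean : \int[P]_w W w = p%:R.
Proof.
have d1 (x : R) : is_derive x 1 (fun=> 1 : R) (0 : R) by exact: is_derive_cst.
have c0 : continuous (fun _ : R => 0 : R) by move=> x; exact: cvg_cst.
have := chisq_ibp rX g (f := fun=> 1) (f' := fun=> 0) ler01 d1 c0.
rewrite !Rint_cst mulr1 => H.
have {H} := H _ _.
under [in X in _ -> _ -> X]eq_Rintegral do rewrite mulr1.
under [in X in _ -> _ -> _ = _ + _ * X]eq_Rintegral do rewrite mulr0.
rewrite Rint_cst mulr0 addr0; apply.
- by move=> x x0; rewrite normr1 mul1r lerDl.
- by move=> x; rewrite normr0.
Qed.

Lemma chisq_moment2 : \int[P]_w (W w ^+ 2) = p%:R ^+ 2 + 2 * p%:R.
Proof.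
have d1 (x : R) : is_derive x 1 (fun x => x : R) (1 : R) by exact: is_derive_id.
have c0 : continuous (fun _ : R => 1 : R) by move=> x; exact: cvg_cst.
have := chisq_ibp rX g (f := fun x => x) (f' := fun=> 1) ler01 d1 c0.
have -> : (fun w => chisq X (xi^~ w) * 1) = W by apply/funext => w; rewrite mulr1.
rewrite chisq_mean -expr2 => <-.
- by congr Rintegral; apply/funext => w; rewrite expr2.
- by move=> x x0; rewrite ger0_norm// mul1r lerDr.
- by move=> x; rewrite normr1.
Qed.

Lemma chisq_sqdist (m : R) : P.-integrable setT (EFin \o (fun w => (W w - m) ^+ 2)) /\
  \int[P]_w (W w - m) ^+ 2 = 2 * p%:R + (p%:R - m) ^+ 2.
Proof.
have i1 := integrableZl measurableT (- (2 * m)) iW.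
have ic : P.-integrable setT (EFin \o (fun=> m ^+ 2)) by exact: finite_measure_integrable_cst.
have i2 : P.-integrable setT (EFin \o (fun w => W w ^+ 2 + - (2 * m) * W w)).
  exact: (integrableD measurableT iW2 i1).
have i3 : P.-integrable setT (EFin \o (fun w => W w ^+ 2 + - (2 * m) * W w + m ^+ 2)).
  exact: (integrableD measurableT i2 ic).
rewrite (_ : (fun w => (W w - m) ^+ 2) = (fun w => W w ^+ 2 + - (2 * m) * W w + m ^+ 2)); last first.
  by apply/funext => w; ring.
split=> //; rewrite RintegralD// RintegralD// RintegralZl// Rint_cst chisq_mean chisq_moment2; ring.
Qed.

Hypothesis p0 : (0 < p)%N.
Let sp : R := Num.sqrt p%:R.
Let sp0 : 0 < sp. Proof. by rewrite sqrtr_gt0 ltr0n. Qed.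
Let sp2 : sp ^+ 2 = p%:R. Proof. by rewrite sqr_sqrtr. Qed.

Let iWp : P.-integrable setT (EFin \o (fun w => `|W w - p%:R|)).
Proof.
apply: (@integrable_chisq _ (1 + p%:R)) => //.
  by apply: measurableT_comp => //; exact: measurable_funB.
move=> w; rewrite normr_id; apply: (le_trans (ler_normB _ _)).
rewrite !ger0_norm//; have := W0 w; have := ler0n R p; nra.
Qed.

(** The bound comes from [u <= u^2 / (2 sp) + sp / 2] and the variance [2 p], with
   [sp] the square root of [p]. *)
Lemma chisq_absdev : \int[P]_w `|W w - p%:R| <= 3 / 2 * sp.
Proof.
have [i2 e2] := chisq_sqdist p%:R.
have i3 : P.-integrable setT (EFin \o (fun w => (2 * sp)^-1 * (W w - p%:R) ^+ 2)).
  exact: (integrableZl measurableT (2 * sp)^-1 i2).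
have ic : P.-integrable setT (EFin \o (fun=> sp / 2)) by exact: finite_measure_integrable_cst.
apply: (@le_trans _ _ (\int[P]_w ((2 * sp)^-1 * (W w - p%:R) ^+ 2 + sp / 2))).
  apply: le_Rintegral => //; first exact: (integrableD measurableT i3 ic).
  move=> w _; rewrite -(real_normK (num_real (W w - p%:R))); move: `|_| => u.
  rewrite -subr_ge0.
  have -> : (2 * sp)^-1 * u ^+ 2 + sp / 2 - u = (u - sp) ^+ 2 / (2 * sp).
    by field; rewrite gt_eqF.
  by rewrite divr_ge0 ?sqr_ge0// mulr_ge0// ltW.
rewrite RintegralD// Rint_cst RintegralZl// e2 subrr expr0n addr0 -sp2.
by rewrite le_eqVlt; apply/orP; left; apply/eqP; field; rewrite gt_eqF.
Qed.

(** Stein's equation turns the left side into [E (f'(G) - G f(G))] for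
   [G = (W - m) / s]; by [chisq_ibp] this is
   [E (f'(G) (1 - 2 W / s^2)) - (p - m) / s * E f(G)], and [W] is within
   [O(sqrt p)] of [p] on average. *)
Lemma chisq_stein (h : R -> R) (m s : R) : continuous h -> (forall x, 0 <= h x <= 1) ->
  0 < s ->
  `|\int[P]_w h ((W w - m) / s) - \int[gam]_x h x| <=
  @mills_cst R * `|p%:R - m| / s + 2 * (`|1 - 2 * p%:R / s ^+ 2| + 3 * sp / s ^+ 2).
Proof.
move=> ch h01 s0; have sn0 : s != 0 by rewrite gt_eqF.
have [f [f' [df cf' bf bf' stein]]] := stein_solution ch h01.
have cf : continuous f.
  by move=> x; apply: differentiable_continuous; apply/derivable1_diffP; have [] := df x.
have M1 := @mills_cst_ge1 R; set M := @mills_cst R in M1 bf *.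
pose q (x : R) := (x - m) / s.
have cq : continuous q.
  by move=> x; apply: cvgM; [apply: cvgB; [exact: cvg_id|exact: cvg_cst]|exact: cvg_cst].
have dq (x : R) : is_derive x 1 q s^-1.
  apply: is_derive_eq; rewrite /GRing.scale/=; ring.
have dfq (x : R) : is_derive x 1 (f \o q) (f' (q x) * s^-1).
  exact: (@is_derive1_comp _ f q x _ _ (df (q x)) (dq x)).
have cfq : continuous (fun x => f' (q x) * s^-1).
  move=> x; apply: cvgM; last exact: cvg_cst.
  exact: (continuous_comp (cq x) (cf' _)).
pose A := M + 2 / s.
have A0 : 0 <= A by rewrite addr_ge0 ?divr_ge0 ?(ltW s0)// (le_trans ler01).
have b1 x : 0 <= x -> `|(f \o q) x| <= A * (1 + x).
  move=> x0; apply: (le_trans (bf _)).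
  have : 0 <= 2 / s by rewrite divr_ge0// ltW.
  by rewrite /A; move: (2 / s) => u u0; nra.
have b2 x : `|f' (q x) * s^-1| <= A.
  rewrite normrM (ger0_norm (_ : 0 <= s^-1)) ?invr_ge0 ?(ltW s0)//.
  apply: (@le_trans _ _ (2 / s)); first by rewrite ler_wpM2r ?invr_ge0 ?(ltW s0).
  by rewrite lerDr (le_trans ler01).
have ibp := chisq_ibp rX g A0 dfq cfq b1 b2.
have mq : measurable_fun setT (fun w => q (W w)) by exact: (measurableT_comp (continuous_measurable_fun cq)).
have mfW : measurable_fun setT (fun w => f (q (W w))) by exact: (measurableT_comp (continuous_measurable_fun cf)).
have mf'W : measurable_fun setT (fun w => f' (q (W w))) by exact: (measurableT_comp (continuous_measurable_fun cf')).
have u1 w : 1 <= 1 + W w by rewrite lerDl.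
have u2 w : 1 <= (1 + W w) ^+ 2 by rewrite expr_ge1// (le_trans ler01).
have u3 w : W w <= (1 + W w) ^+ 2 by have := W0 w; nra.
have ifW : P.-integrable setT (EFin \o (fun w => f (q (W w)))).
  apply: (@integrable_chisq _ M) => //; first exact: le_trans M1.
  by move=> w; apply: (le_trans (bf _)); rewrite ler_peMr// (le_trans ler01).
have if'W : P.-integrable setT (EFin \o (fun w => f' (q (W w)))).
  apply: (@integrable_chisq _ 2) => // w.
  by apply: (le_trans (bf' _)); rewrite ler_peMr.
have iWf : P.-integrable setT (EFin \o (fun w => W w * f (q (W w)))).
  apply: (@integrable_chisq _ M) => //; [exact: measurable_funM|exact: le_trans M1|].
  move=> w; rewrite normrM (ger0_norm (W0 w)) mulrC; apply: ler_pM => //.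
have iWf' : P.-integrable setT (EFin \o (fun w => W w * f' (q (W w)))).
  apply: (@integrable_chisq _ 2) => //; first exact: measurable_funM.
  move=> w; rewrite normrM (ger0_norm (W0 w)) mulrC; apply: ler_pM => //.
have E1 : \int[P]_w (W w * f (q (W w))) =
   p%:R * \int[P]_w f (q (W w)) + 2 / s * \int[P]_w (W w * f' (q (W w))).
  rewrite [LHS]ibp; congr (_ + _); rewrite -mulrA; congr (_ * _).
  rewrite -RintegralZl//; congr Rintegral; apply/funext => w; rewrite /W; ring.
pose r w := f' (q (W w)) * (1 - 2 / s ^+ 2 * W w).
have E2 : \int[P]_w h ((W w - m) / s) - \int[gam]_x h x =
   \int[P]_w r w - (p%:R - m) / s * \int[P]_w f (q (W w)).
  have i1 : P.-integrable setT (EFin \o (fun w => m / s * f (q (W w)))).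
    exact: (integrableZl measurableT (m / s) ifW).
  have i2 : P.-integrable setT (EFin \o (fun w => - s^-1 * (W w * f (q (W w))))).
    exact: (integrableZl measurableT (- s^-1) iWf).
  have ic : P.-integrable setT (EFin \o (fun=> \int[gam]_x h x)) by exact: finite_measure_integrable_cst.
  have i12 : P.-integrable setT (EFin \o (fun w => m / s * f (q (W w)) + - s^-1 * (W w * f (q (W w))))).
    exact: (integrableD measurableT i1 i2).
  have i123 : P.-integrable setT (EFin \o (fun w => f' (q (W w)) + (m / s * f (q (W w)) + - s^-1 * (W w * f (q (W w)))))).
    exact: (integrableD measurableT if'W i12).
  have -> : (fun w => h ((W w - m) / s)) = (fun w => f' (q (W w)) +
     (m / s * f (q (W w)) + - s^-1 * (W w * f (q (W w)))) + \int[gam]_x h x).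
    apply/funext => w; have := stein (q (W w)); rewrite -/(q (W w)) => H.
    have -> : h (q (W w)) = (f' (q (W w)) - q (W w) * f (q (W w))) + \int[gam]_x h x.
      by rewrite H subrK.
    by rewrite {2}/q; ring.
  have -> : r = (fun w => f' (q (W w)) + - (2 / s ^+ 2) * (W w * f' (q (W w)))).
    by apply/funext => w; rewrite /r; ring.
  have i3 : P.-integrable setT (EFin \o (fun w => - (2 / s ^+ 2) * (W w * f' (q (W w))))).
    exact: (integrableZl measurableT (- (2 / s ^+ 2)) iWf').
  rewrite RintegralD// Rint_cst addrK.
  have -> : \int[P]_w (f' (q (W w)) + (m / s * f (q (W w)) + - s^-1 * (W w * f (q (W w))))) =
      \int[P]_w f' (q (W w)) + (m / s * \int[P]_w f (q (W w)) - s^-1 * \int[P]_w (W w * f (q (W w)))).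
    have e1 : \int[P]_w (m / s * f (q (W w))) = m / s * \int[P]_w f (q (W w)).
      exact: (RintegralZl _ measurableT ifW).
    have e2 : \int[P]_w (- s^-1 * (W w * f (q (W w)))) = - s^-1 * \int[P]_w (W w * f (q (W w))).
      exact: (RintegralZl _ measurableT iWf).
    by rewrite RintegralD// RintegralD// e1 e2 mulNr.
  have -> : \int[P]_w (f' (q (W w)) + - (2 / s ^+ 2) * (W w * f' (q (W w)))) =
      \int[P]_w f' (q (W w)) - 2 / s ^+ 2 * \int[P]_w (W w * f' (q (W w))).
    have e2 : \int[P]_w (- (2 / s ^+ 2) * (W w * f' (q (W w)))) =
        - (2 / s ^+ 2) * \int[P]_w (W w * f' (q (W w))).
      exact: (RintegralZl _ measurableT iWf').
    by rewrite RintegralD// e2 mulNr.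
  by rewrite E1; field; exact: sn0.
have ir : P.-integrable setT (EFin \o r).
  have -> : r = (fun w => f' (q (W w)) + - (2 / s ^+ 2) * (W w * f' (q (W w)))).
    by apply/funext => w; rewrite /r; ring.
  exact: (integrableD measurableT if'W (integrableZl measurableT (- (2 / s ^+ 2)) iWf')).
have B1 : `|\int[P]_w r w| <= 2 * (`|1 - 2 * p%:R / s ^+ 2| + 3 * sp / s ^+ 2).
  apply: (le_trans (le_normr_Rintegral measurableT ir)).
  have i4 : P.-integrable setT (EFin \o (fun w => 4 / s ^+ 2 * `|W w - p%:R|)).
    exact: (integrableZl measurableT (4 / s ^+ 2) iWp).
  have ic : P.-integrable setT (EFin \o (fun=> 2 * `|1 - 2 * p%:R / s ^+ 2|)) by exact: finite_measure_integrable_cst.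
  apply: (@le_trans _ _ (\int[P]_w (4 / s ^+ 2 * `|W w - p%:R| + 2 * `|1 - 2 * p%:R / s ^+ 2|))).
    apply: le_Rintegral => //.
    - exact: integrable_norm.
    - exact: (integrableD measurableT i4 ic).
    - move=> w _; rewrite /r normrM.
      have s20 : 0 <= 2 / s ^+ 2 by rewrite divr_ge0// sqr_ge0.
      have -> : 1 - 2 / s ^+ 2 * W w = (1 - 2 * p%:R / s ^+ 2) - 2 / s ^+ 2 * (W w - p%:R).
        by field; exact: sn0.
      apply: (@le_trans _ _ (2 * (`|1 - 2 * p%:R / s ^+ 2| + 2 / s ^+ 2 * `|W w - p%:R|))).
        apply: ler_pM => //; apply: (le_trans (ler_normB _ _)).
        by rewrite lerD2l normrM (ger0_norm s20).
      by rewrite le_eqVlt; apply/orP; left; apply/eqP; ring.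
  rewrite RintegralD// Rint_cst RintegralZl//.
  have s20 : 0 <= 4 / s ^+ 2 by rewrite divr_ge0// sqr_ge0.
  have := ler_wpM2l s20 chisq_absdev.
  have -> : 4 / s ^+ 2 * (3 / 2 * sp) = 2 * (3 * sp / s ^+ 2) by field; exact: sn0.
  lra.
have B2 : `|(p%:R - m) / s * \int[P]_w f (q (W w))| <= M * `|p%:R - m| / s.
  rewrite normrM normrM normfV (gtr0_norm s0) mulrC -mulrA; apply: ler_pM => //.
    by rewrite divr_ge0// ltW.
  apply: (le_trans (le_normr_Rintegral measurableT ifW)).
  rewrite -[leRHS](Rint_cst P M); apply: le_Rintegral => //.
  - exact: integrable_norm.
  - exact: finite_measure_integrable_cst.
rewrite E2; apply: (le_trans (ler_normB _ _)); lra.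
Qed.

End ChiSquareNormal.

(** * The loss due to the constraint *)

Section Model.
Context {R : realType}.
Notation cylT I := (g_sigma_algebraType (@rect R I)).
Variables (n p : nat) (X : 'M[R]_(n, p)) (lambda : R).
Hypothesis rX : \rank X = p.
Hypothesis l0 : 0 < lambda.
Let K := lasso_set X lambda.
Let H := hat X.

(** The squared distance to [K] of the projected observation: the amount by which
   the constraint lowers the statistic. *)
Definition defect (mu : 'cV[R]_n) (x : 'I_n -> R) : R :=
  nrm2 (resid X lambda (mu + vec x)).

Lemma defect_ge0 mu x : 0 <= defect mu x.
Proof. exact: nrm2_ge0. Qed.

Lemma defect_le_chisq mu x : K mu -> defect mu x <= chisq X x.
Proof.
move=> Kmu; apply: (le_trans (resid_min rX l0 _ Kmu)).
by rewrite mulmxDr (lasso_hat rX Kmu) addrC addKr.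
Qed.

Let vecB (a b : 'I_n -> R) : vec b - vec a = vec (fun i => b i - a i).
Proof. by apply/matrixP => i j; rewrite !mxE. Qed.

Let addBl (mu u v : 'cV[R]_n) : (mu + u) - (mu + v) = u - v.
Proof. by rewrite opprD addrACA subrr add0r. Qed.

Lemma measurable_resid mu i :
  measurable_fun setT ((fun x => resid X lambda (mu + vec x) i 0) : cylT 'I_n -> R).
Proof.
apply: measurable_lipschitz => a b.
rewrite -(nrm2_vec (fun i => b i - a i)) -vecB -(addBl mu).
apply: le_trans (resid_lipschitz rX l0 _ _).
rewrite /nrm2 /dot (bigD1 i)//= !mxE -expr2 lerDl sumr_ge0// => j _.
by rewrite -expr2 sqr_ge0.
Qed.

Lemma defectE mu x : defect mu x = \sum_i resid X lambda (mu + vec x) i 0 ^+ 2.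
Proof. by apply: eq_bigr => i _; rewrite expr2. Qed.

Lemma measurable_defect mu : measurable_fun setT (defect mu : cylT 'I_n -> R).
Proof.
rewrite (_ : defect mu = (fun x => \sum_i resid X lambda (mu + vec x) i 0 ^+ 2)); last exact/funext/defectE.
by apply: measurable_sum => i; apply: measurable_funX; exact: measurable_resid.
Qed.

Section Law.
Context d (T : measurableType d) (P : probability T R) (xi : 'I_n -> T -> R).
Hypothesis g : gaussian_family P xi.

Lemma defect_poincare mu : K mu ->
  \int[P]_w (defect mu (xi^~ w) ^+ 2) - (\int[P]_w defect mu (xi^~ w)) ^+ 2 <=
  pi ^+ 2 * \int[P]_w defect mu (xi^~ w).
Proof.
move=> Kmu; apply: (@gaussian_poincare R d T P 'I_n xi (defect mu)
   (fun i x => resid X lambda (mu + vec x) i 0) 1 g) => //.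
- exact: measurable_defect.
- by move=> i; exact: measurable_resid.
- move=> a b; have := resid_step rX l0 (mu + vec a) (mu + vec b).
  rewrite addBl vecB nrm2_vec.
  rewrite (_ : dot _ (vec _) = \sum_i resid X lambda (mu + vec a) i 0 * (b i - a i))//.
  by apply: eq_bigr => i _; rewrite [vec _ _ _]mxE.
- move=> x; rewrite mul1r; apply: (le_trans (defect_le_chisq x Kmu)).
  by apply: (le_trans (chisq_le rX x)); rewrite lerDr.
Qed.

(** Off this event the least squares fit lies in [K] and the defect vanishes. *)
Definition exit_event (mu : 'cV[R]_n) : set T :=
  [set w | lambda <= l1norm (ols X (mu + vec (xi^~ w)))].

Lemma measurable_exit mu : measurable (exit_event mu).
Proof.
have mxi := gf_meas g.
have m : measurable_fun setT (fun w => l1norm (ols X (mu + vec (xi^~ w)))).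
  apply: measurable_sum => i; apply: measurableT_comp => //.
  pose M := invmx (X^T *m X) *m X^T.
  rewrite (_ : (fun w => _) = (fun w => (M *m mu) i 0 + \sum_j M i j * xi j w)).
    apply: measurable_funD => //; apply: measurable_sum => j.
    by apply: measurable_funM.
  apply/funext => w; rewrite /ols -/M mulmxDr.
  have e : (M *m vec (xi^~ w)) i 0 = \sum_j M i j * xi j w.
    by rewrite mxE; apply: eq_bigr => j _; rewrite [vec _ _ _]mxE.
  by rewrite -e; move: (M *m mu) (M *m vec _) => u v; rewrite mxE.
have := m measurableT `[lambda, +oo[%classic; rewrite setTI => /(_ (measurable_itv _)).
congr measurable; apply/seteqP; split=> w /=; rewrite in_itv/= andbT//.
Qed.

Lemma defect_eq0 mu w : ~ exit_event mu w -> defect mu (xi^~ w) = 0.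
Proof.
move=> /negP; rewrite -ltNge => h; rewrite /defect (resid_eq0 rX l0 h).
by rewrite /nrm2 /dot big1// => i _; rewrite mxE mul0r.
Qed.

Let D mu w := defect mu (xi^~ w).

Let mD mu : measurable_fun setT (D mu).
Proof. exact: (measurableT_comp (measurable_defect mu) (measurable_family (gf_meas g))). Qed.

Let D0 mu w : 0 <= D mu w. Proof. exact: defect_ge0. Qed.

Lemma integrable_defect mu : K mu -> P.-integrable setT (EFin \o D mu).
Proof.
move=> Kmu; apply: (@integrable_chisq _ _ _ _ rX _ _ _ _ g _ 1) => // w.
rewrite ger0_norm// mul1r; have := defect_le_chisq (xi^~ w) Kmu; rewrite -/(D mu w).
have := chisq_ge0 X (xi^~ w); nra.
Qed.

Lemma integrable_defect2 mu : K mu -> P.-integrable setT (EFin \o (fun w => D mu w ^+ 2)).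
Proof.
move=> Kmu; apply: (@integrable_chisq _ _ _ _ rX _ _ _ _ g _ 1) => // [|w].
  exact: measurable_funX.
rewrite ger0_norm ?sqr_ge0// mul1r; have := defect_le_chisq (xi^~ w) Kmu; rewrite -/(D mu w).
have := D0 mu w; nra.
Qed.

(** The defect vanishes on an event of probability at least one half, so
   Cauchy-Schwarz gives [2 (E D)^2 <= E D^2]. The Poincare inequality bounds the
   variance by [pi^2 E D]. Together they force [(E D)^2 <= pi^2 E D], whence the
   constants, which depend neither on the dimensions nor on [K]. *)
Lemma defect_moments mu : K mu -> fine (P (exit_event mu)) <= 1 / 2 ->
  let b := \int[P]_w D mu w in let a := \int[P]_w (D mu w ^+ 2) in
  [/\ 0 <= b, b <= 16 & a - b ^+ 2 <= 256].
Proof.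
move=> Kmu q2 b a.
have b0 : 0 <= b by apply: Rintegral_ge0 => w _; exact: D0.
have poin : a - b ^+ 2 <= pi ^+ 2 * b := defect_poincare Kmu.
have pi4 : pi ^+ 2 <= 16 :> R.
  have h1 : pi <= 4 :> R by have := @pihalf_lt2 R; lra.
  have h2 := @pi_gt0 R; nra.
have mE := measurable_exit mu.
have iI : P.-integrable setT (EFin \o (fun w => \1_(exit_event mu) w : R)).
  apply: (@integrable_chisq _ _ _ _ rX _ _ _ _ g _ 1) => // [|w]; first exact: measurable_indic.
  rewrite mul1r indicE; case: (_ \in _); rewrite /= ?normr1 ?normr0 ?sqr_ge0//.
  by rewrite expr_ge1// ?lerDl ?chisq_ge0// addr_ge0// chisq_ge0.
have EI : \int[P]_w (\1_(exit_event mu) w) = fine (P (exit_event mu)).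
  by rewrite /Rintegral integral_indic// setIT.
have iD := integrable_defect Kmu; have iD2 := integrable_defect2 Kmu.
have key : 2 * b ^+ 2 <= a.
  (* Cauchy-Schwarz, as positivity of the square of [D - 2 b 1_E]. *)
  have h : 0 <= \int[P]_w (D mu w - 2 * b * \1_(exit_event mu) w) ^+ 2.
    by apply: Rintegral_ge0 => w _; exact: sqr_ge0.
  have i1 : P.-integrable setT (EFin \o (fun w => - (4 * b) * D mu w)).
    exact: (integrableZl measurableT (- (4 * b)) iD).
  have i2 : P.-integrable setT (EFin \o (fun w => (4 * b ^+ 2) * (\1_(exit_event mu) w : R))).
    exact: (integrableZl measurableT (4 * b ^+ 2) iI).
  have i3 : P.-integrable setT (EFin \o (fun w => D mu w ^+ 2 + - (4 * b) * D mu w)).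
    exact: (integrableD measurableT iD2 i1).
  have e : (fun w => (D mu w - 2 * b * \1_(exit_event mu) w) ^+ 2) =
    (fun w => D mu w ^+ 2 + - (4 * b) * D mu w + (4 * b ^+ 2) * \1_(exit_event mu) w).
    apply/funext => w; rewrite indicE.
    have [_|wE] := boolP (w \in exit_event mu); first by rewrite /=; ring.
    rewrite (_ : D mu w = 0); first by rewrite /=; ring.
    by apply: defect_eq0 => wE'; move/negP: wE; apply; rewrite inE.
  rewrite e RintegralD// RintegralD// in h.
  have e1 : \int[P]_w (- (4 * b) * D mu w) = - (4 * b) * b by exact: (RintegralZl _ measurableT iD).
  have e2 : \int[P]_w ((4 * b ^+ 2) * (\1_(exit_event mu) w)) = 4 * b ^+ 2 * fine (P (exit_event mu)).
    by rewrite -EI; exact: (RintegralZl _ measurableT iI).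
  rewrite e1 e2 -/a in h.
  have := ler_wpM2l (sqr_ge0 b) q2; lra.
have b16 : b <= 16.
  have h1 : b * b <= 16 * b.
    have := ler_wpM2r b0 pi4; rewrite expr2 in key poin *; lra.
  have [b00|bp] := eqVneq b 0; first by rewrite b00.
  have bp' : 0 < b by rewrite lt0r bp b0.
  by rewrite -(ler_pM2r bp').
split=> //; apply: (le_trans poin).
by rewrite (_ : 256 = 16 * 16)%R; [apply: ler_pM => //; exact: sqr_ge0|ring].
Qed.

End Law.
End Model.

(** * Mean, variance and normal approximation under the null *)

Section Stat.
Context {R : realType}.
Notation gam := (normal_prob (0:R) 1).
Variables (n p : nat) (X : 'M[R]_(n, p)) (lambda : R).
Hypothesis rX : \rank X = p.
Hypothesis l0 : 0 < lambda.
Let K := lasso_set X lambda.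
Context d (T : measurableType d) (P : probability T R) (xi : 'I_n -> {RV P >-> R}).
Hypothesis sg : standard_gaussian xi.

Lemma standard_gaussian_family : gaussian_family P (fun i => xi i : T -> R).
Proof.
have [h1 h2] := sg; split; first by move=> i; exact: measurable_funP.
move=> B mB; have := h2 B mB.
rewrite (_ : [set w | forall i, B i (xi i w)] = \bigcap_i (xi i @^-1` B i)).
  by move=> ->; apply: eq_bigr => i _; exact: h1.
by apply/seteqP; split=> w /=; [move=> h i _; exact: h|move=> h i; exact: h].
Qed.
Let g := standard_gaussian_family.

Let x w : 'I_n -> R := fun i => xi i w.
Let W w := chisq X (x w).
Let D mu w := defect X lambda mu (x w).

(** By Pythagoras the statistic is [|H Y - mu0|^2] minus the defect, and
   [H Y - mu0 = H xi + (mu - mu0)]. *)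
Lemma lr_stat_obs mu mu0 w : K mu -> K mu0 ->
  lr_stat K mu0 (obs mu xi w) =
  W w + 2 * dot (vec (x w)) (mu - mu0) + nrm2 (mu - mu0) - D mu w.
Proof.
move=> Kmu Kmu0; rewrite (lr_statE rX l0 _ Kmu0).
rewrite /D /defect; congr (_ - _).
have -> : hat X *m obs mu xi w - mu0 = hat X *m vec (x w) + (mu - mu0).
  by rewrite /obs mulmxDr (lasso_hat rX Kmu) addrAC addrC.
rewrite (nrm2D (hat X *m vec (x w)) (mu - mu0)) (dot_hat X) mulmxBr.
by rewrite (lasso_hat rX Kmu) (lasso_hat rX Kmu0).
Qed.

Lemma lr_stat_null mu w : K mu -> lr_stat K mu (obs mu xi w) = W w - D mu w.
Proof.
move=> Kmu; rewrite (lr_stat_obs w Kmu Kmu) subrr.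
have -> : dot (vec (x w)) 0 = 0 by rewrite -(scale0r (vec (x w))) dotZr mul0r.
have -> : nrm2 (0 : 'cV[R]_n) = 0 by rewrite /nrm2 /dot big1// => i _; rewrite mxE mulr0.
by rewrite mulr0 !addr0.
Qed.

Let mW : measurable_fun setT W.
Proof. exact: (measurableT_comp (measurable_chisq X) (measurable_family (gf_meas g))). Qed.

Let mD mu : measurable_fun setT (D mu).
Proof. exact: (measurableT_comp (measurable_defect rX l0 mu) (measurable_family (gf_meas g))). Qed.

Lemma measurable_lr_stat mu mu0 : K mu -> K mu0 ->
  measurable_fun setT (fun w => lr_stat K mu0 (obs mu xi w)).
Proof.
move=> Kmu Kmu0.
rewrite (_ : (fun w => _) = (fun w => W w + 2 * (\sum_i xi i w * (mu - mu0) i 0)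
    + nrm2 (mu - mu0) - D mu w)).
  apply: measurable_funB => //; apply: measurable_funD => //; apply: measurable_funD => //.
  apply: measurable_funM => //; apply: measurable_sum => i.
  by apply: measurable_funM.
apply/funext => w; rewrite lr_stat_obs//; congr (_ + 2 * _ + _ - _).
by apply: eq_bigr => i _; rewrite mxE.
Qed.

Lemma exit_probE mu :
  exit_prob X lambda mu xi = fine (P (exit_event X lambda (fun i => xi i : T -> R) mu)).
Proof. by []. Qed.

Variables (mu0 : 'cV[R]_n).
Hypothesis K0 : K mu0.
Let m := stat_mean K mu0 mu0 xi.
Let s := stat_sd K mu0 mu0 xi.
Let b := \int[P]_w D mu0 w.
Let a := \int[P]_w (D mu0 w ^+ 2).

Let iW : P.-integrable setT (EFin \o W).
Proof.
apply: (@integrable_chisq _ _ _ _ rX _ _ _ _ g _ 1) => // w.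
rewrite ger0_norm ?chisq_ge0// mul1r -/(W w).
have : 0 <= W w by exact: chisq_ge0.
by nra.
Qed.

Lemma stat_meanE : m = p%:R - b.
Proof.
transitivity (\int[P]_w (W w - D mu0 w)).
  rewrite /m /stat_mean unlock /Rintegral; congr fine.
  by apply: eq_integral => w _; rewrite lr_stat_null.
rewrite RintegralB//; last exact: (integrable_defect rX l0 g K0).
by rewrite (chisq_mean rX g).
Qed.

Lemma stat_sdE : s = Num.sqrt (\int[P]_w ((W w - p%:R) - (D mu0 w - b)) ^+ 2).
Proof.
rewrite /s /stat_sd /variance; congr Num.sqrt.
rewrite unlock -/(stat_mean K mu0 mu0 xi) -/m stat_meanE unlock.
rewrite /Rintegral; congr fine; apply: eq_integral => w _.
have e : lr_stat K mu0 (obs mu0 xi w) = W w - D mu0 w by exact: lr_stat_null.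
rewrite (_ : (W w - p%:R - (D mu0 w - b)) = lr_stat K mu0 (obs mu0 xi w) - (p%:R - b)); last by rewrite e; ring.
by rewrite expr2.
Qed.

Hypothesis p0 : 514 <= Num.sqrt p%:R :> R.
Hypothesis q2 : exit_prob X lambda mu0 xi <= 1 / 2.
Let sp : R := Num.sqrt p%:R.
Let sp0 : 0 < sp. Proof. by apply: lt_le_trans p0; rewrite ltr0n. Qed.
Let sp2 : sp ^+ 2 = p%:R. Proof. by rewrite sqr_sqrtr. Qed.
Let pn0 : (0 < p)%N. Proof. by move: sp0; rewrite sqrtr_gt0 ltr0n. Qed.

Lemma stat_mean_near : `|p%:R - m| <= 16.
Proof.
have [b0 b16 _] := defect_moments rX l0 g K0 q2.
by rewrite stat_meanE opprB addrC subrK ger0_norm.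
Qed.

(** The variances of [W] and of the defect are [2 p] and [O(1)]; their covariance is
   handled by Young's inequality with weight [sqrt p], which costs [O(sqrt p)].
   The condition [514 <= sqrt p] makes this error at most [p]. *)
Lemma stat_var_near : `|s ^+ 2 - 2 * p%:R| <= 514 * sp /\ p%:R <= s ^+ 2.
Proof.
have [b0 b16 ab] := defect_moments rX l0 g K0 q2.
rewrite -/b in b0 b16; rewrite -/a -/b in ab.
have [iWp eWp] := chisq_sqdist rX g p%:R; rewrite subrr expr0n addr0 in eWp.
have iD := integrable_defect rX l0 g K0; have iD2 := integrable_defect2 rX l0 g K0.
have i1 : P.-integrable setT (EFin \o (fun w => - (2 * b) * D mu0 w)).
  exact: (integrableZl measurableT (- (2 * b)) iD).
have ic : P.-integrable setT (EFin \o (fun=> b ^+ 2)) by exact: finite_measure_integrable_cst.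
have i2 : P.-integrable setT (EFin \o (fun w => D mu0 w ^+ 2 + - (2 * b) * D mu0 w)).
  exact: (integrableD measurableT iD2 i1).
have eDb : (fun w => (D mu0 w - b) ^+ 2) = (fun w => D mu0 w ^+ 2 + - (2 * b) * D mu0 w + b ^+ 2).
  by apply/funext => w; ring.
have iDb : P.-integrable setT (EFin \o (fun w => (D mu0 w - b) ^+ 2)).
  by rewrite eDb; exact: (integrableD measurableT i2 ic).
have vDb : \int[P]_w (D mu0 w - b) ^+ 2 <= 256.
  rewrite eDb RintegralD// Rint_cst RintegralD//.
  have -> : \int[P]_w (- (2 * b) * D mu0 w) = - (2 * b) * b by exact: (RintegralZl _ measurableT iD).
  rewrite -/a; lra.
have vDb0 : 0 <= \int[P]_w (D mu0 w - b) ^+ 2 by apply: Rintegral_ge0 => w _; exact: sqr_ge0.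
pose V := \int[P]_w ((W w - p%:R) - (D mu0 w - b)) ^+ 2.
have V0 : 0 <= V by apply: Rintegral_ge0 => w _; exact: sqr_ge0.
have s2 : s ^+ 2 = V by rewrite stat_sdE sqr_sqrtr.
have spn : sp != 0 by rewrite gt_eqF.
have mm : measurable_fun setT (fun w => ((W w - p%:R) - (D mu0 w - b)) ^+ 2).
  apply: measurable_funX; apply: measurable_funB; apply: measurable_funB => //.
have j1 (c : R) : P.-integrable setT (EFin \o (fun w => c * (W w - p%:R) ^+ 2)).
  exact: (integrableZl measurableT c iWp).
have j2 (c : R) : P.-integrable setT (EFin \o (fun w => c * (D mu0 w - b) ^+ 2)).
  exact: (integrableZl measurableT c iDb).
have iV : P.-integrable setT (EFin \o (fun w => ((W w - p%:R) - (D mu0 w - b)) ^+ 2)).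
  apply: (@le_integrable _ _ _ P setT measurableT _ (EFin \o (fun w => 2 * ((W w - p%:R) ^+ 2) + 2 * ((D mu0 w - b) ^+ 2)))).
  - exact/measurable_EFinP.
  - move=> w _ /=; rewrite lee_fin (ger0_norm (sqr_ge0 _)); apply: le_trans (ler_norm _).
    have := sqr_ge0 ((W w - p%:R) + (D mu0 w - b)); lra.
  - exact: (integrableD measurableT (j1 2) (j2 2)).
have I12 (c e : R) : \int[P]_w (c * (W w - p%:R) ^+ 2 + e * (D mu0 w - b) ^+ 2) =
    c * (2 * p%:R) + e * \int[P]_w (D mu0 w - b) ^+ 2.
  rewrite RintegralD// -eWp; congr (_ + _).
    exact: (RintegralZl _ measurableT iWp).
  exact: (RintegralZl _ measurableT iDb).
have Vup : V <= (1 + sp^-1) * (2 * p%:R) + (1 + sp) * \int[P]_w (D mu0 w - b) ^+ 2.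
  rewrite -I12; apply: le_Rintegral => //; first exact: (integrableD measurableT (j1 _) (j2 _)).
  move=> w _; move: (W w - p%:R) (D mu0 w - b) => u v; rewrite -subr_ge0.
  have -> : (1 + sp^-1) * u ^+ 2 + (1 + sp) * v ^+ 2 - (u - v) ^+ 2 = (u + sp * v) ^+ 2 / sp.
    by field.
  by rewrite divr_ge0 ?sqr_ge0 ?(ltW sp0).
have Vlo : (1 - sp^-1) * (2 * p%:R) + (1 - sp) * \int[P]_w (D mu0 w - b) ^+ 2 <= V.
  rewrite -I12; apply: le_Rintegral => //; first exact: (integrableD measurableT (j1 _) (j2 _)).
  move=> w _; move: (W w - p%:R) (D mu0 w - b) => u v; rewrite -subr_ge0.
  have -> : (u - v) ^+ 2 - ((1 - sp^-1) * u ^+ 2 + (1 - sp) * v ^+ 2) = (u - sp * v) ^+ 2 / sp.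
    by field.
  by rewrite divr_ge0 ?sqr_ge0 ?(ltW sp0).
have h1 : sp^-1 * (2 * p%:R) = 2 * sp by rewrite -sp2; field.
have p1 : 514 <= sp := p0.
set v := \int[P]_w (D mu0 w - b) ^+ 2 in vDb vDb0 Vup Vlo.
have h2 : sp * v <= sp * 256 by rewrite ler_wpM2l// ltW.
have h3 : 0 <= sp * v by rewrite mulr_ge0// ltW.
have h4 : `|V - 2 * p%:R| <= 514 * sp.
  rewrite ler_norml; apply/andP; split; lra.
rewrite s2; split=> //.
have h5 : 514 * sp <= p%:R by rewrite -sp2 expr2 ler_wpM2r// ltW.
by move: h4; rewrite ler_norml => /andP[h _]; lra.
Qed.

(** [16 mills_cst] bounds the contribution of the mean, and
   [1034 = 2 (514 + 3)] that of the variance and of the fluctuation of [W]. *)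
Definition null_cst : R := 16 * @mills_cst R + 1034.

Lemma stat_sd_ge : sp <= s.
Proof.
have [_ h] := stat_var_near.
have s0 : 0 <= s by rewrite stat_sdE sqrtr_ge0.
by rewrite -(ler_pXn2r (n := 2))// ?nnegrE ?(ltW sp0)// sp2.
Qed.

Lemma chisq_test_function (h : R -> R) : continuous h -> (forall x, 0 <= h x <= 1) ->
  `|\int[P]_w h ((W w - m) / s) - \int[gam]_x h x| <= null_cst / sp.
Proof.
move=> ch h01.
have [hv hp] := stat_var_near; have hs := stat_sd_ge; have hm := stat_mean_near.
have s0 : 0 < s by apply: lt_le_trans hs.
apply: (le_trans (chisq_stein rX g pn0 m ch h01 s0)).
have M1 := @mills_cst_ge1 R; set M := @mills_cst R in M1 *.
have spn : sp != 0 by rewrite gt_eqF.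
have pp : 0 < p%:R :> R by rewrite -sp2 exprn_gt0.
have isp : s^-1 <= sp^-1 by rewrite lef_pV2 ?posrE.
have is2 : (s ^+ 2)^-1 <= (p%:R)^-1 by rewrite lef_pV2 ?posrE ?exprn_gt0.
have t1 : M * `|p%:R - m| / s <= 16 * M / sp.
  apply: ler_pM => //; [by rewrite mulr_ge0// (le_trans ler01)|by rewrite invr_ge0 ltW|].
  by rewrite mulrC; apply: ler_pM => //; exact: le_trans M1.
have t2 : `|1 - 2 * p%:R / s ^+ 2| <= 514 / sp.
  have -> : 1 - 2 * p%:R / s ^+ 2 = (s ^+ 2 - 2 * p%:R) / s ^+ 2 by field; rewrite gt_eqF.
  rewrite normrM normfV (ger0_norm (sqr_ge0 s)).
  have -> : 514 / sp = 514 * sp / p%:R :> R by rewrite -sp2; field.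
  by apply: ler_pM => //; rewrite invr_ge0 sqr_ge0.
have t3 : 3 * sp / s ^+ 2 <= 3 / sp.
  have -> : 3 / sp = 3 * sp / p%:R :> R by rewrite -sp2; field.
  by rewrite ler_wpM2l// mulr_ge0// ltW.
have -> : null_cst / sp = 16 * M / sp + 2 * (514 / sp + 3 / sp).
  by rewrite /null_cst -/M; field.
apply: lerD; first exact: t1.
by rewrite ler_wpM2l//; apply: lerD; [exact: t2|exact: t3].
Qed.

(** The chi-square part of the statistic, normalised by the mean and standard
   deviation of the whole statistic, is close to normal. *)
Lemma chisq_tv (B : set R) : measurable B ->
  `|fine (P [set w | B ((W w - m) / s)]) - fine (gam B)| <= null_cst / sp.
Proof.
move=> mB.
have mG : measurable_fun setT (fun w => ((W w - m) / s : measurableTypeR R)).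
  by apply: measurable_funM => //; exact: measurable_funB.
pose L := @law R _ _ T (measurableTypeR R) P _ mG.
apply: (@tv_of_continuous R L gam (null_cst / sp) _ B mB) => h ch h01.
have mh : measurable_fun setT h by exact: continuous_measurable_fun.
have := @integral_law R _ _ T (measurableTypeR R) P _ mG h mh => e.
by rewrite {1}/Rintegral -e; exact: chisq_test_function.
Qed.

End Stat.

(** * Quantiles of the normal law *)

Section Quantile.
Context {R : realType}.
Notation mu := (@lebesgue_measure R).
Notation gam := (normal_prob (0:R) 1).
Notation phi := (normal_pdf (0:R) 1).

Lemma gauss_set (D : set (measurableTypeR R)) : measurable D ->
  gam D = (\int[mu]_(t in D) phi t)%:E.
Proof.
move=> mD; rewrite /normal_prob /Rintegral fineK//.
by apply: integrable_fin_num => //; exact: integrableS (@integrable_phi1 R).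
Qed.

Lemma utail_nonincr (x y : R) : x <= y -> utail y <= utail x.
Proof.
move=> xy; rewrite /utail -lee_fin -!gauss_set//.
apply: le_measure; rewrite ?inE// => t /=; rewrite !in_itv/= !andbT.
exact: le_trans.
Qed.

Lemma utail_sum (x : R) : utail x + utail (- x) = 1.
Proof.
have e : \int[mu]_t phi t = 1 by rewrite /Rintegral integral_normal_pdf.
rewrite -e -ltailE addrC /utail.
rewrite -(@Rintegral_itv_obnd_cbnd R x +oo%O); last exact: integrableS (@integrable_phi1 R).
rewrite -Rintegral_setU//.
- congr Rintegral; apply/seteqP; split=> t //= _; rewrite /= !in_itv/= andbT.
  by have [tx|tx] := leP t x; [left|right].
- by apply: (integrableS measurableT _ _ (@integrable_phi1 R)) => //; exact: measurableU.
- rewrite disj_set2E; apply/eqP/seteqP; split=> // t [] /=.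
  by rewrite !in_itv/= andbT => h1; rewrite ltNge h1.
Qed.

Lemma utail0 : utail (0 : R) = 1 / 2.
Proof. by have := utail_sum 0; rewrite oppr0; lra. Qed.

Lemma continuous_utail : continuous (@utail R).
Proof.
pose F (x : R) := \int[mu]_(t in `]-oo, x]) phi t.
have cF : continuous F.
  move=> x; have xx : x < x + 1 by rewrite ltrDl.
  have ikx : mu.-integrable [set` Interval -oo%O (BRight (x + 1))] (EFin \o phi).
    exact: integrableS (@integrable_phi1 R).
  have ckx : {for x, continuous phi} by exact: continuous_phi.
  have [dd e] := continuous_FTC1 xx ikx (ltNyr x) ckx.
  by apply: differentiable_continuous; apply/derivable1_diffP.
have -> : @utail R = (fun x => F (- x)).
  by apply/funext => x; rewrite /F ltailE opprK.
move=> x; apply: (@continuous_comp _ _ _ (fun x : R => - x) F); first exact: opp_continuous.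
exact: cF.
Qed.

Section Alpha.
Variable alpha : R.
Hypothesis a0 : 0 < alpha.
Hypothesis a1 : alpha < 1.

Let z := normal_upper_quantile (alpha / 2).

(** The tail is continuous, equal to [1/2] at 0 and arbitrarily small far away,
   so the quantile exists by the intermediate value theorem. *)
Lemma quantileP : utail z = alpha / 2.
Proof.
have ex : exists z : R, normal_prob 0 1 `[z, +oo[%classic = (alpha / 2)%:E.
  have c0 := phi_gt0 (0 : R).
  pose Z : R := 2 * phi 0 / alpha + 1.
  have Z0 : 0 < Z by rewrite addr_gt0// divr_gt0// mulr_gt0.
  have uZ : utail Z <= alpha / 2.
    have h1 := mills_mul (ltW Z0).
    have h2 : phi Z <= phi 0.
      by rewrite !phiE ler_wpM2l ?normal_peak_ge0// ler_expR lerN2 expr0n/= mul0r divr_ge0// sqr_ge0.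
    have h3 : phi 0 <= Z * (alpha / 2).
      have -> : Z * (alpha / 2) = phi 0 + alpha / 2 by rewrite /Z; field; rewrite gt_eqF.
      by rewrite lerDl divr_ge0// ltW.
    by rewrite -(ler_pM2l Z0); lra.
  have hv : Num.min (utail 0) (utail Z) <= alpha / 2 <= Num.max (utail 0) (utail Z).
    rewrite utail0 ge_min uZ orbT/= le_max; apply/orP; left.
    by rewrite ler_wpM2r// ltW.
  have [c _ cE] := IVT (ltW Z0) (continuous_subspaceT continuous_utail) hv.
  by exists c; rewrite gauss_set//; congr EFin.
have h : normal_prob 0 1 `[z, +oo[%classic = (alpha / 2)%:E.
  exact: (@xgetPex _ 0 [set z : R | normal_prob 0 1 `[z, +oo[%classic = (alpha / 2)%:E] ex).
by rewrite gauss_set// in h; case: h.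
Qed.

Lemma quantile_gt0 : 0 < z.
Proof.
rewrite ltNge; apply/negP => z0.
have := utail_nonincr z0; rewrite quantileP utail0; have := a1; lra.
Qed.

Lemma gauss_two_sided : gam [set x : R | z < `|x|] = alpha%:E.
Proof.
have z0 := quantile_gt0.
have -> : [set x : R | z < `|x|] = `]-oo, (- z)[%classic `|` `]z, +oo[%classic.
  apply/seteqP; split=> x /=; rewrite !in_itv/= andbT.
    by rewrite lter_normr => /orP[|]; [right|left; rewrite ltrNr].
  by move=> [h|h]; rewrite lter_normr ?h// ltrNr h orbT.
have dj : `]-oo, (- z)[%classic `&` `]z, +oo[%classic = set0 :> set R.
  apply/seteqP; split=> x // [] /=; rewrite !in_itv/= andbT => h1 h2.
  have := lt_trans h2 h1; have := z0; lra.
transitivity (gam `]-oo, (- z)%R[%classic + gam `]z%R, +oo[%classic)%E.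
  by apply: measureU.
rewrite !gauss_set// -EFinD; congr EFin.
rewrite Rintegral_itv_bndo_bndc; last exact: integrableS (@integrable_phi1 R).
rewrite Rintegral_itv_obnd_cbnd; last exact: integrableS (@integrable_phi1 R).
rewrite ltailE opprK -/(utail z) quantileP; lra.
Qed.

(** On this interval the density is at least its value at [B]. *)
Lemma gauss_interval_ge (c r B : R) : 0 <= r -> `|c| + r <= B ->
  2 * r * phi B <= fine (gam `[c - r, c + r]%classic).
Proof.
move=> r0 cB; rewrite gauss_set//=.
have -> : 2 * r * phi B = \int[mu]_(t in `[c - r, c + r]) phi B.
  rewrite Rintegral_cst// /= lebesgue_measure_itv/= lte_fin.
  case: ifPn => [h|]; first by rewrite -EFinD /=; ring.
  rewrite -leNgt => h; have -> : r = 0 by lra.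
  by rewrite mulr0 mul0r mulr0.
apply: le_Rintegral => //.
- apply/integrableP; split; first exact/measurable_EFinP.
  rewrite integral_cst//= lebesgue_measure_itv/=; case: ifP => _; rewrite ?mule0 ?ltry//.
- exact: integrableS (@integrable_phi1 R).
- move=> t; rewrite /= in_itv/= => /andP[t1 t2].
  rewrite !phiE ler_wpM2l ?normal_peak_ge0// ler_expR lerN2 ler_wpM2r//.
  rewrite -(real_normK (num_real t)) lerXn2r ?nnegrE//.
    by apply: le_trans cB; rewrite addr_ge0.
  apply: le_trans cB; rewrite ler_norml.
  by have := ler_norm c; have := ler_norm (- c); rewrite normrN => *; apply/andP; split; lra.
Qed.

End Alpha.
End Quantile.

(** * Error bounds at a fixed sample size *)

Section Cover.
Context {R : realType} d (T : measurableType d) (P : probability T R).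

Lemma prob_cover (A B E : set T) : measurable A -> measurable B -> measurable E ->
  (forall w, A w -> ~ E w -> B w) -> fine (P A) <= fine (P B) + fine (P E).
Proof.
move=> mA mB mE h.
have fA := fin_num_measure P _ mA; have fB := fin_num_measure P _ mB.
have fE := fin_num_measure P _ mE.
have le1 : (P A <= P B + P E)%E.
  apply: (@le_trans _ _ (P (B `|` E))); last exact: measureU2.
  apply: le_measure; rewrite ?inE//; first exact: measurableU.
  by move=> w Aw; have [Ew|nEw] := pselect (E w); [right|left; exact: h].
by rewrite -lee_fin EFinD !fineK.
Qed.

Lemma prob_agree (A B E : set T) : measurable A -> measurable B -> measurable E ->
  (forall w, ~ E w -> (A w <-> B w)) -> `|fine (P A) - fine (P B)| <= fine (P E).
Proof.
move=> mA mB mE h.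
have h1 : fine (P A) <= fine (P B) + fine (P E).
  by apply: prob_cover => // w Aw nE; exact/(h w nE).
have h2 : fine (P B) <= fine (P A) + fine (P E).
  by apply: prob_cover => // w Bw nE; exact/(h w nE).
by rewrite ler_norml; apply/andP; split; lra.
Qed.

Lemma measurable_superlevel (f : T -> R) (c : R) :
  measurable_fun setT f -> measurable [set w | c <= f w].
Proof.
move=> mf; rewrite (_ : [set w | _] = setT `&` f @^-1` `[c, +oo[); first exact: mf.
by apply/seteqP; split=> w /=; rewrite in_itv/= andbT => // -[].
Qed.

Lemma markov_Rint (f : T -> R) (c : R) : P.-integrable setT (EFin \o f) ->
  (forall w, 0 <= f w) -> 0 < c ->
  fine (P [set w | c <= f w]) <= (\int[P]_w f w) / c.
Proof.
move=> fi f0 c0.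
have mf : measurable_fun setT f by apply/measurable_EFinP; case/integrableP: fi.
have mA := measurable_superlevel c mf.
rewrite ler_pdivlMr// mulrC -lee_fin EFinM fineK ?fin_num_measure//.
rewrite -integral_cst// /Rintegral fineK; last exact: integrable_fin_num.
apply: (@le_trans _ _ (\int[P]_(w in [set w | (c <= f w)%R]) (f w)%:E)%E).
  apply: ge0_le_integral => //.
  - by move=> w _; rewrite lee_fin ltW.
  - by apply/measurable_EFinP; apply: measurable_funTS.
apply: ge0_subset_integral => //; first exact/measurable_EFinP.
by move=> w _; rewrite lee_fin.
Qed.

Lemma gf_linear_integrable (I : finType) (xi : I -> T -> R) (a : I -> R) :
  gaussian_family P xi ->
  P.-integrable setT (EFin \o (fun w => (\sum_i a i * xi i w) ^+ 2)).
Proof.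
move=> g; have mxi := gf_meas g.
pose S := \sum_i a i ^+ 2.
apply: (@gf_integrable _ _ _ P I xi _ (#|I|%:R * S * (2 * (1 + #|I|%:R))) g).
  by apply: measurable_funX; apply: measurable_sum => i; apply: measurable_funM.
move=> w; rewrite ger0_norm ?sqr_ge0//.
apply: (le_trans (sqr_sum_le _)); rewrite -!mulrA ler_wpM2l//.
have S0 : 0 <= S by apply: sumr_ge0 => i _; exact: sqr_ge0.
apply: (@le_trans _ _ (S * (\sum_i xi i w ^+ 2))).
  rewrite mulr_sumr; apply: ler_sum => i _; rewrite exprMn ler_wpM2r ?sqr_ge0//.
  by rewrite /S (bigD1 i)//= lerDl sumr_ge0// => j _; exact: sqr_ge0.
rewrite ler_wpM2l// mulrA; apply: le_trans (sum_sqr_le_Q4 _).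
by rewrite lerDr.
Qed.

End Cover.

Section Power.
Context {R : realType}.
Notation gam := (normal_prob (0:R) 1).
Notation phi := (normal_pdf (0:R) 1).
Variables (n p : nat) (X : 'M[R]_(n, p)) (lambda : R).
Hypothesis rX : \rank X = p.
Hypothesis l0 : 0 < lambda.
Let K := lasso_set X lambda.
Context d (T : measurableType d) (P : probability T R) (xi : 'I_n -> {RV P >-> R}).
Hypothesis sg : standard_gaussian xi.
Variables (mu0 mu : 'cV[R]_n).
Hypothesis K0 : K mu0.
Hypothesis Kmu : K mu.
Let m := stat_mean K mu0 mu0 xi.
Let s := stat_sd K mu0 mu0 xi.
Let g := standard_gaussian_family sg.
Let x w : 'I_n -> R := fun i => xi i w.
Let W w := chisq X (x w).
Let D nu w := defect X lambda nu (x w).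
Let E nu := exit_event X lambda (fun i => xi i : T -> R) nu.

Let mE nu : measurable (E nu). Proof. exact: (measurable_exit X lambda g nu). Qed.

Let mW : measurable_fun setT W.
Proof. exact: (measurableT_comp (measurable_chisq X) (measurable_family (gf_meas g))). Qed.

Let mpre (f : T -> R) (B : set R) : measurable_fun setT f -> measurable B ->
  measurable [set w | B (f w)].
Proof.
move=> mf mB; rewrite (_ : [set w | _] = setT `&` f @^-1` B); first exact: mf.
by rewrite setTI.
Qed.

Let Tm w := lr_stat K mu0 (obs mu xi w).
Let mTm : measurable_fun setT Tm.
Proof. exact: (measurable_lr_stat rX l0 sg Kmu K0). Qed.

Let mrej z : measurable [set w | z < `|Tm w - m| / s].
Proof.
apply: (@mpre (fun w => `|Tm w - m| / s) [set u | z < u]).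
  by apply: measurable_funM => //; apply: measurableT_comp => //; exact: measurable_funB.
rewrite (_ : [set u | z < u] = `]z, +oo[%classic)//.
by apply/seteqP; split=> u /=; rewrite in_itv/= andbT.
Qed.

Lemma powerE (alpha : R) : power_two_sided K alpha mu0 mu xi =
  fine (P [set w | normal_upper_quantile (alpha / 2) < `|Tm w - m| / s]).
Proof.
rewrite /power_two_sided unlock; congr fine.
set z := normal_upper_quantile _; set A := [set w | _].
have mA : measurable A by exact: mrej.
transitivity (\int[P]_w (\1_A w)%:E)%E; last by rewrite integral_indic// setIT.
apply: eq_integral => w _; congr EFin; rewrite indicE /lrt_two_sided -/z -/m -/s -/(Tm w).
by have -> : (w \in A) = (z < `|Tm w - m| / s) by apply/idP/idP; rewrite inE.
Qed.

(** The statistic and its chi-square part differ only on the exit event. *)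
Lemma null_tv_agree (B : set R) : 514 <= Num.sqrt p%:R :> R ->
  exit_prob X lambda mu0 xi <= 1 / 2 -> measurable B ->
  `|fine (P [set w | B ((lr_stat K mu0 (obs mu0 xi w) - m) / s)]) - fine (gam B)|
    <= exit_prob X lambda mu0 xi + null_cst / Num.sqrt p%:R.
Proof.
move=> p0 q2 mB.
have mT0 := measurable_lr_stat rX l0 sg K0 K0.
have h1 : `|fine (P [set w | B ((lr_stat K mu0 (obs mu0 xi w) - m) / s)]) -
    fine (P [set w | B ((W w - m) / s)])| <= fine (P (E mu0)).
  apply: prob_agree => //.
  - apply: (mpre _ mB); apply: measurable_funM => //; exact: measurable_funB.
  - apply: (mpre _ mB); apply: measurable_funM => //; exact: measurable_funB.
  - move=> w nE; have D0 := defect_eq0 rX l0 nE.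
    have e : lr_stat K mu0 (obs mu0 xi w) = W w.
      by apply: (etrans (lr_stat_null rX l0 xi w K0)); rewrite D0 subr0.
    by rewrite /= e.
have h2 := chisq_tv rX l0 sg K0 p0 q2 mB.
rewrite exit_probE; apply: le_trans (lerD h1 h2).
by apply: le_trans (ler_normD _ _); rewrite addrA subrK.
Qed.

Hypothesis p0 : 514 <= Num.sqrt p%:R :> R.
Hypothesis q2 : exit_prob X lambda mu0 xi <= 1 / 2.
Let sp : R := Num.sqrt p%:R.
Let sp0 : 0 < sp. Proof. by apply: lt_le_trans p0; rewrite ltr0n. Qed.
Let sp2 : sp ^+ 2 = p%:R. Proof. by rewrite sqr_sqrtr. Qed.
Let s0 : 0 < s. Proof. exact: lt_le_trans (stat_sd_ge rX l0 sg K0 p0 q2). Qed.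
Let Delta := nrm2 (mu - mu0).
Let L w := dot (vec (x w)) (mu - mu0).
Let Delta0 : 0 <= Delta. Proof. exact: nrm2_ge0. Qed.

Let LE w : L w = \sum_i (mu - mu0) i 0 * xi i w.
Proof. by apply: eq_bigr => i _; rewrite [vec _ _ _]mxE mulrC. Qed.

Let iL2 : P.-integrable setT (EFin \o (fun w => L w ^+ 2)).
Proof.
rewrite (_ : (fun w => L w ^+ 2) = (fun w => (\sum_i (mu - mu0) i 0 * xi i w) ^+ 2)).
  exact: gf_linear_integrable g.
by apply/funext => w; rewrite LE.
Qed.

Let eL2 : \int[P]_w (L w ^+ 2) = Delta.
Proof.
rewrite (_ : (fun w => L w ^+ 2) = (fun w => (\sum_i (mu - mu0) i 0 * xi i w) ^+ 2)).
  by rewrite (gf_linear_moment2 _ g); apply: eq_bigr => i _; rewrite expr2.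
by apply/funext => w; rewrite LE.
Qed.

Let mL : measurable_fun setT L.
Proof.
rewrite (_ : L = (fun w => \sum_i (mu - mu0) i 0 * xi i w)); last exact/funext.
by apply: measurable_sum => i; apply: measurable_funM.
Qed.

Let m_le : m <= p%:R.
Proof.
rewrite /m (stat_meanE rX l0 sg K0) gerBl.
by apply: Rintegral_ge0 => w _; exact: defect_ge0.
Qed.

Let s_le : s <= 2 * sp.
Proof.
have [h _] := stat_var_near rX l0 sg K0 p0 q2.
rewrite -(@ler_pXn2r _ 2)// ?nnegrE ?mulr_ge0 ?(ltW s0) ?(ltW sp0)//.
rewrite exprMn sp2; have h5 : 514 * sp <= p%:R by rewrite -sp2 expr2 ler_wpM2r// ltW.
have pp := ler0n R p; by move: h; rewrite -/s -/sp ler_norml => /andP[_ h]; lra.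
Qed.

Let TmE w : ~ E mu w -> Tm w = W w + 2 * L w + Delta.
Proof.
move=> nE; apply: (etrans (lr_stat_obs rX l0 xi w Kmu K0)).
by rewrite (defect_eq0 rX l0 nE) subr0.
Qed.

Let rejE z : fine (P (~` [set w | z < `|Tm w - m| / s])) =
  1 - fine (P [set w | z < `|Tm w - m| / s]).
Proof. by rewrite probability_setC// fineB// fin_num_measure. Qed.

Lemma power_le1 alpha : power_two_sided K alpha mu0 mu xi <= 1.
Proof.
rewrite powerE -lee_fin fineK; last by apply: fin_num_measure; exact: mrej.
by apply: probability_le1; exact: mrej.
Qed.

(** Off the exit event for [mu] the statistic is [W + 2 L + Delta], where [L] is
   centred with variance [Delta]. Acceptance forces [(W - p) + 2 L] below
   [- Delta / 2], which Chebyshev's inequality makes unlikely. *)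
Lemma miss_le (z : R) : 0 < z -> 4 * z * sp <= Delta ->
  1 - fine (P [set w | z < `|Tm w - m| / s]) <=
    exit_prob X lambda mu xi + (16 * p%:R + 32 * Delta) / Delta ^+ 2.
Proof.
move=> z0 zD; rewrite -rejE.
have D0 : 0 < Delta by apply: lt_le_trans zD; rewrite mulr_gt0// mulr_gt0.
pose f w := 2 * (W w - p%:R) ^+ 2 + 8 * L w ^+ 2.
have [iWp eWp] := chisq_sqdist rX g p%:R; rewrite subrr expr0n addr0 in eWp.
have i1 : P.-integrable setT (EFin \o (fun w => 2 * (W w - p%:R) ^+ 2)).
  exact: (integrableZl measurableT 2 iWp).
have i2 : P.-integrable setT (EFin \o (fun w => 8 * L w ^+ 2)).
  exact: (integrableZl measurableT 8 iL2).
have fi : P.-integrable setT (EFin \o f) by exact: (integrableD measurableT i1 i2).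
have ef : \int[P]_w f w = 4 * p%:R + 8 * Delta.
  rewrite RintegralD//; congr (_ + _).
    transitivity (2 * (2 * p%:R) : R); last by ring.
    by rewrite -eWp; exact: (RintegralZl _ measurableT iWp).
  by rewrite -eL2; exact: (RintegralZl _ measurableT iL2).
have f0 w : 0 <= f w by rewrite addr_ge0// mulr_ge0// sqr_ge0.
have c0 : 0 < Delta ^+ 2 / 4 by rewrite divr_gt0// exprn_gt0.
have mk := markov_Rint fi f0 c0.
have -> : (16 * p%:R + 32 * Delta) / Delta ^+ 2 = (\int[P]_w f w) / (Delta ^+ 2 / 4).
  by rewrite ef; field; rewrite gt_eqF.
have mf : measurable_fun setT f by apply/measurable_EFinP; case/integrableP: fi.
have mfs := measurable_superlevel (Delta ^+ 2 / 4) mf.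
rewrite addrC exit_probE; apply: le_trans (lerD mk (lexx _)).
apply: prob_cover => //; first exact: measurableC.
move=> w /negP; rewrite -leNgt ler_pdivrMr// => h nE /=.
rewrite (TmE nE) in h.
have zs : z * s <= Delta / 2.
  by have := ler_wpM2l (ltW z0) s_le; have := zD; rewrite -mulrA; lra.
have h1 : W w - p%:R + 2 * L w <= - (Delta / 2).
  by have := m_le; have := le_trans (ler_norm _) h; lra.
have h2 : (Delta / 2) ^+ 2 <= (W w - p%:R + 2 * L w) ^+ 2.
  rewrite -(sqrrN (W w - _ + _)) lerXn2r// ?nnegrE ?divr_ge0//; lra.
have h3 := sqr_ge0 (W w - p%:R - 2 * L w).
have e1 : (Delta / 2) ^+ 2 = Delta ^+ 2 / 4 by field.
rewrite -e1; apply: (le_trans h2); rewrite /f.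
move: h3; move: (W w - p%:R) (L w) => u v h3; lra.
Qed.

(** When [Delta <= M sqrt p], the normalised statistic is, off the exit event,
   [(W - m) / s] shifted by [a = Delta / s] in [[0, M]], plus [2 L / s] whose variance
   is [O(M / sqrt p)]. If the latter is at most [z / 2], acceptance follows as soon as
   the nearly normal [(W - m) / s] lies within [z / 2] of [- a], an event of
   probability bounded away from 0. *)
Lemma miss_ge (z M : R) : 0 < z -> Delta <= M * sp ->
  z * phi (M + z) - null_cst / sp - 16 * M / (z ^+ 2 * sp) - exit_prob X lambda mu xi <=
  1 - fine (P [set w | z < `|Tm w - m| / s]).
Proof.
move=> z0 DM; rewrite -rejE.
pose a := Delta / s.
have ss : sp <= s := stat_sd_ge rX l0 sg K0 p0 q2.
have a0 : 0 <= a by rewrite divr_ge0// ltW.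
have M0 : 0 <= M by rewrite -(pmulr_lge0 _ sp0); exact: le_trans DM.
have aM : a <= M.
  by rewrite ler_pdivrMr//; apply: (le_trans DM); rewrite ler_wpM2l.
pose I : set R := `[- a - z / 2, - a + z / 2]%classic.
have mI : measurable I by exact: measurable_itv.
have gI : z * phi (M + z) <= fine (gam I).
  have h := @gauss_interval_ge R (- a) (z / 2) (M + z).
  have e : 2 * (z / 2) = z by field.
  rewrite e in h; apply: h; first by rewrite divr_ge0// ltW.
  by rewrite normrN ger0_norm//; have := z0; lra.
have := chisq_tv rX l0 sg K0 p0 q2 mI; rewrite -/m -/s -/sp.
set pI := fine (P _) => /ler_normlP[tv _].
have mG : measurable_fun setT (fun w => (W w - m) / s).
  by apply: measurable_funM => //; exact: measurable_funB.
pose c := z ^+ 2 * p%:R / 16.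
have c0 : 0 < c by rewrite divr_gt0// mulr_gt0 ?exprn_gt0// -sp2 exprn_gt0.
have mk := markov_Rint iL2 (fun w => sqr_ge0 (L w)) c0.
have mL2 : measurable_fun setT (fun w => L w ^+ 2) by exact: measurable_funX.
have mLs := measurable_superlevel c mL2.
have cov : pI <= fine (P (~` [set w | z < `|Tm w - m| / s])) +
    fine (P (E mu `|` [set w | c <= L w ^+ 2])).
  apply: prob_cover.
  - exact: (mpre mG mI).
  - exact: measurableC.
  - exact: measurableU.
  move=> w; rewrite /I /= in_itv/= => /andP[g1 g2] /not_orP[nE nL].
  apply/negP; rewrite -leNgt (TmE nE).
  have Lz : `|2 * L w / s| <= z / 2.
    rewrite normrM normfV (gtr0_norm s0) ler_pdivrMr// normrM (ger0_norm (ler0n _ 2)).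
    move/negP: nL; rewrite -ltNge -(real_normK (num_real (L w))) => nL.
    have : `|L w| <= z * sp / 4.
      rewrite -(@ler_pXn2r _ 2)// ?nnegrE// ?divr_ge0 ?mulr_ge0 ?(ltW z0) ?(ltW sp0)//.
      apply: (le_trans (ltW nL)); rewrite /c -sp2.
      by rewrite (_ : (z * sp / 4) ^+ 2 = z ^+ 2 * sp ^+ 2 / 16)//; field.
    have := ler_wpM2l (ltW z0) ss; lra.
  rewrite -{1}(gtr0_norm s0) -normfV -normrM.
  have -> : (W w + 2 * L w + Delta - m) / s = (W w - m) / s + (2 * L w / s + a).
    by rewrite /a; field; rewrite gt_eqF.
  move: Lz g1 g2; rewrite ler_norml; move: (_ / s) (2 * L w / s) => u v.
  by move=> /andP[v1 v2] g1 g2; rewrite ler_norml; apply/andP; split; lra.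
have cU : fine (P (E mu `|` [set w | c <= L w ^+ 2])) <=
    exit_prob X lambda mu xi + 16 * M / (z ^+ 2 * sp).
  apply: (@le_trans _ _ (fine (P (E mu)) + fine (P [set w | c <= L w ^+ 2]))).
    have f1 := fin_num_measure P _ (mE mu); have f2 := fin_num_measure P _ mLs.
    rewrite -lee_fin EFinD !fineK// ?measureU2//.
    by rewrite fin_num_measure//; exact: measurableU.
  rewrite exit_probE lerD2l; apply: (le_trans mk); rewrite eL2 ler_pdivrMr//.
  apply: (le_trans DM); rewrite (_ : _ * c = M * sp)// /c -sp2.
  by field; rewrite !gt_eqF.
by move: gI tv cov cU; lra.
Qed.

End Power.

Section FixedN.
Context {R : realType}.
Notation gam := (normal_prob (0:R) 1).
Variables (n p : nat) (X : 'M[R]_(n, p)) (lambda : R).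
Hypothesis rX : \rank X = p.
Hypothesis l0 : 0 < lambda.
Let K := lasso_set X lambda.
Context d (T : measurableType d) (P : probability T R) (xi : 'I_n -> {RV P >-> R}).
Hypothesis sg : standard_gaussian xi.
Variable (mu0 : 'cV[R]_n).
Hypothesis K0 : K mu0.
Let m := stat_mean K mu0 mu0 xi.
Let s := stat_sd K mu0 mu0 xi.
Let sp : R := Num.sqrt p%:R.
Let q := exit_prob X lambda mu0 xi.

Lemma exit_prob_ge0 mu : 0 <= exit_prob X lambda mu xi.
Proof. by rewrite /exit_prob fine_ge0. Qed.

Lemma exit_prob_small mu : (0 < p)%N -> (p <= n)%N ->
  n%:R * Num.sqrt (exit_prob X lambda mu xi) <= 1 ->
  exit_prob X lambda mu xi <= sp^-1 ^+ 2.
Proof.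
move=> p0 pn h.
have n1 : 1 <= n%:R :> R by rewrite ler1n (leq_trans p0).
rewrite exprVn sqr_sqrtr// -(sqr_sqrtr (exit_prob_ge0 mu)).
set r := Num.sqrt _ in h *.
have r0 : 0 <= r by exact: sqrtr_ge0.
have pp : 0 < p%:R :> R by rewrite ltr0n.
have pnR : p%:R <= n%:R :> R by rewrite ler_nat.
rewrite -div1r ler_pdivlMr// expr2 -mulrA.
have r1 : r <= 1 by apply: le_trans h; rewrite ler_peMl.
apply: le_trans r1; rewrite ler_piMr//; apply: le_trans h.
by rewrite mulrC ler_wpM2r.
Qed.

Lemma exit_prob_le mu : (0 < p)%N -> (p <= n)%N -> 514 <= sp ->
  n%:R * Num.sqrt (exit_prob X lambda mu xi) <= 1 ->
  exit_prob X lambda mu xi <= sp^-1 /\ exit_prob X lambda mu xi <= 1 / 2.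
Proof.
move=> p0 pn h1 h2; have h := exit_prob_small p0 pn h2.
have sp0 : 0 < sp by apply: lt_le_trans h1; rewrite ltr0n.
have i0 : 0 < sp^-1 by rewrite invr_gt0.
have i2 : sp^-1 <= 1 / 2.
  by rewrite -div1r ler_wpM2l// lef_pV2 ?posrE//; apply: le_trans h1; rewrite ler_nat.
have h3 : sp^-1 ^+ 2 <= sp^-1 by rewrite expr2 ler_piMl ?(ltW i0)//; lra.
by split; [exact: le_trans h3|apply: le_trans i2; exact: le_trans h3].
Qed.

Let G w : R := (lr_stat K mu0 (obs mu0 xi w) - m) / s.

Let mG (B : set R) : measurable B -> measurable [set w | B (G w)].
Proof.
move=> mB; rewrite -[X in measurable X]setTI.
suff: measurable_fun setT G by apply.
apply: measurable_funM => //; apply: measurable_funB => //.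
exact: (measurable_lr_stat rX l0 sg K0 K0).
Qed.

Lemma dTV_null_le (c : R) :
  (forall B : set R, measurable B ->
    `|fine (P [set w | B (G w)]) - fine (gam B)| <= c) ->
  (dTV (std_stat_law K mu0 xi) gam <= c%:E)%E.
Proof.
move=> h; apply: ge_ereal_sup => _ [B mB <-].
have := h B mB; rewrite -lee_fin; apply: le_trans.
have f1 := fin_num_measure P _ (mG mB).
have f2 : gam B \is a fin_num by exact: fin_num_measure.
by rewrite -abse_EFin EFinB !fineK.
Qed.

Let q0 : 0 <= q. Proof. exact: exit_prob_ge0. Qed.

Let dTV_null_le1 : (dTV (std_stat_law K mu0 xi) gam <= 1%:E)%E.
Proof.
apply: dTV_null_le => B mB.
have a0 : 0 <= fine (P [set w | B (G w)]) by rewrite fine_ge0.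
have b0 : 0 <= fine (gam B) by rewrite fine_ge0.
have a1 : fine (P [set w | B (G w)]) <= 1.
  by rewrite -lee_fin fineK ?fin_num_measure// ?probability_le1//; exact: mG.
have b1 : fine (gam B) <= 1.
  by rewrite -lee_fin fineK ?fin_num_measure// probability_le1.
by rewrite ler_norml; apply/andP; split; lra.
Qed.

(** If [C (n q)^2 >= p] the right side is infinite; otherwise it is at least
   [C / sqrt p]. Then either [sqrt p < 514] and this exceeds 1, or
   [(p q)^2 <= (n q)^2 < p] gives [q <= 1 / sqrt p], so that the exit event costs no
   more than the normal approximation. *)
Lemma null_dTV_bound (C := @null_cst R + 515) : (0 < p)%N -> (p <= n)%N ->
  (dTV (std_stat_law K mu0 xi) gam
        <= (C * Num.sqrt (p%:R + n%:R * Num.sqrt q))%:E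
           / (Num.max (p%:R - C * (n%:R * q) ^+ 2) 0)%:E)%E.
Proof.
move=> pp pn.
have pR : 0 < p%:R :> R by rewrite ltr0n.
have p1 : 1 <= p%:R :> R by rewrite ler1n.
have pnR : p%:R <= n%:R :> R by rewrite ler_nat.
have sp0 : 0 < sp by rewrite sqrtr_gt0.
have sp2 : sp ^+ 2 = p%:R by rewrite sqr_sqrtr.
have sp1 : 1 <= sp by rewrite -sqrtr1 ler_sqrt.
have nc : 0 <= @null_cst R.
  rewrite /null_cst; have := @mills_cst_ge1 R; lra.
have C1 : 1 <= C by rewrite /C; lra.
have C0 : 0 < C by lra.
have nq : 0 <= n%:R * Num.sqrt q by rewrite mulr_ge0// sqrtr_ge0.
have sq : sp <= Num.sqrt (p%:R + n%:R * Num.sqrt q) by rewrite ler_sqrt ?addr_ge0// lerDl.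
set den := p%:R - _.
have [den0|den0] := leP den 0.
  rewrite inve0 gt0_muley ?leey// lte_fin mulr_gt0//.
  exact: lt_le_trans sq.
rewrite inver gt_eqF// -EFinM.
have base : C / sp <= C * Num.sqrt (p%:R + n%:R * Num.sqrt q) / den.
  rewrite -mulrA ler_wpM2l ?(ltW C0)//.
  have -> : sp^-1 = sp / p%:R by rewrite -sp2; field; rewrite gt_eqF.
  apply: ler_pM => //; rewrite ?invr_ge0 ?(ltW sp0)//.
  rewrite lef_pV2 ?posrE// /den gerBl mulr_ge0 ?sqr_ge0//; exact: ltW.
apply: (@le_trans _ _ (C / sp)%:E); last by rewrite lee_fin.
have [h|h] := ltP sp 514.
  apply: (le_trans dTV_null_le1); rewrite lee_fin ler_pdivlMr// mul1r.
  by apply: ltW; apply: (lt_le_trans h); rewrite /C; lra.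
have qs : q <= sp^-1.
  rewrite -div1r ler_pdivlMr//.
  have h1 : (q * p%:R) ^+ 2 <= p%:R.
    apply: (@le_trans _ _ (C * (n%:R * q) ^+ 2)); last by rewrite -subr_ge0 ltW.
    apply: (@le_trans _ _ ((n%:R * q) ^+ 2)); last by rewrite ler_peMl ?sqr_ge0.
    by rewrite lerXn2r ?nnegrE ?mulr_ge0// mulrC ler_wpM2r.
  have h2 : q * p%:R <= sp by rewrite -(@ler_pXn2r _ 2)// ?nnegrE ?mulr_ge0 ?(ltW sp0)// sp2.
  by rewrite -(ler_pM2r sp0) mul1r -mulrA -expr2 sp2.
have q2 : q <= 1 / 2.
  apply: (le_trans qs); rewrite -div1r ler_wpM2l// lef_pV2 ?posrE//.
  by apply: le_trans h; rewrite ler_nat.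
apply: dTV_null_le => B mB.
apply: (le_trans (null_tv_agree rX l0 sg K0 h q2 mB)).
have -> : C / sp = 515 * sp^-1 + null_cst / sp by rewrite /C mulrDl addrC.
rewrite lerD2r; apply: (le_trans qs).
by rewrite ler_peMl ?invr_ge0 ?(ltW sp0)// ler1n.
Qed.

Lemma size_error (alpha : R) : 0 < alpha -> alpha < 1 -> 514 <= sp -> q <= 1 / 2 ->
  `|power_two_sided K alpha mu0 mu0 xi - alpha| <= q + null_cst / sp.
Proof.
move=> a0 a1 h q2; rewrite (powerE rX l0 sg K0 K0).
set z := normal_upper_quantile _.
have s0 : 0 < s by apply: lt_le_trans (stat_sd_ge rX l0 sg K0 h q2); apply: lt_le_trans h; rewrite ltr0n.
have mB : measurable [set u : R | z < `|u|].
  have -> : [set u : R | z < `|u|] = setT `&` (fun u : R => `|u|) @^-1` `]z, +oo[.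
    by apply/seteqP; split=> u /=; rewrite in_itv/= andbT => // -[].
  exact: normr_measurable.
have := null_tv_agree rX l0 sg K0 h q2 mB.
rewrite (gauss_two_sided a0 a1) /= -/q -/sp -/m -/s.
rewrite (_ : [set w | _] = [set w | z < `|lr_stat K mu0 (obs mu0 xi w) - m| / s])//.
by apply/funext => w /=; rewrite normrM normfV (gtr0_norm s0).
Qed.

End FixedN.

(** * Asymptotics *)

Section Asymptotics.
Context {R : realType}.

Lemma near_sqrt_ge (p : nat -> nat) (B : R) : p n @[n --> \oo] --> \oo ->
  \forall n \near \oo, B <= Num.sqrt (p n)%:R.
Proof.
move=> /cvgnyPge /(_ (Num.truncn (`|B| ^+ 2)).+1).
apply: filterS => n h; apply: (le_trans (ler_norm B)).
rewrite -(@ler_pXn2r _ 2)// ?nnegrE ?sqrtr_ge0// sqr_sqrtr//.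
apply: le_trans (ltW (truncnS_gt _)) _; by rewrite ler_nat.
Qed.

(** The detection boundary [p^(1/4)] for the norm is [sqrt p] for its square. *)
Lemma enorm_ratio_sqr n (x : 'cV[R]_n) (p : nat) : (0 < p)%N ->
  (enorm x / (p%:R `^ (1 / 4))) ^+ 2 = nrm2 x / Num.sqrt p%:R.
Proof.
move=> p0; rewrite expr_div_n enorm_sqr; congr (_ / _).
rewrite expr2 -powRD; last by rewrite pnatr_eq0 -lt0n p0 implybT.
rewrite -powR12_sqrt//; congr (_ `^ _); by field.
Qed.

Lemma near_max_le1 (a b : nat -> R) :
  (n%:R * Num.max (a n) (b n) : R) @[n --> \oo] --> (0 : R) ->
  \forall n \near \oo, n%:R * a n <= 1 /\ n%:R * b n <= 1.
Proof.
move=> /cvgrPdist_le /(_ 1 ltr01); apply: filterS => n.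
rewrite sub0r normrN => /(le_trans (ler_norm _)) h.
split; apply: le_trans h; rewrite ler_wpM2l// le_max lexx ?orbT//.
Qed.

End Asymptotics.

Theorem theorem4p9 (R : realType) :
  (exists C : R, 0 < C /\
    forall (n p : nat) (X : 'M[R]_(n, p)) (lambda : R) (mu0 : 'cV[R]_n)
      (d : measure_display) (Omega : measurableType d)
      (P : probability Omega R) (xi : 'I_n -> {RV P >-> R}),
      (0 < p)%N -> (p <= n)%N -> \rank X = p -> 0 < lambda ->
      lasso_set X lambda mu0 -> standard_gaussian xi ->
      let q := exit_prob X lambda mu0 xi in
      (dTV (std_stat_law (lasso_set X lambda) mu0 xi) (normal_prob 0 1)
        <= (C * Num.sqrt (p%:R + n%:R * Num.sqrt q))%:E
           / (Num.max (p%:R - C * (n%:R * q) ^+ 2) 0)%:E)%E)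
  /\
  (forall (alpha : R) (p : nat -> nat) (X : forall n, 'M[R]_(n, p n))
      (lambda : nat -> R) (mu0 : forall n, 'cV[R]_n)
      (d : nat -> measure_display) (Omega : forall n, measurableType (d n))
      (P : forall n, probability (Omega n) R)
      (xi : forall n, 'I_n -> {RV (P n) >-> R}),
      0 < alpha -> alpha < 1 ->
      (forall n, (p n <= n)%N) -> (forall n, \rank (X n) = p n) ->
      (forall n, 0 < lambda n) ->
      (forall n, lasso_set (X n) (lambda n) (mu0 n)) ->
      (forall n, standard_gaussian (@xi n)) ->
      p n @[n --> \oo] --> \oo ->
      (n%:R * Num.sqrt (exit_prob (X n) (lambda n) (mu0 n) (@xi n)) : R)
        @[n --> \oo] --> (0 : R) ->
      (fun n => power_two_sided (lasso_set (X n) (lambda n)) alpha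
                  (mu0 n) (mu0 n) (@xi n) - alpha : R^o)
        =O_\oo (fun n => (Num.sqrt (p n)%:R)^-1 : R^o))
  /\
  (forall (alpha : R) (p : nat -> nat) (X : forall n, 'M[R]_(n, p n))
      (lambda : nat -> R) (mu0 mu : forall n, 'cV[R]_n)
      (d : nat -> measure_display) (Omega : forall n, measurableType (d n))
      (P : forall n, probability (Omega n) R)
      (xi : forall n, 'I_n -> {RV (P n) >-> R}),
      0 < alpha -> alpha < 1 ->
      (forall n, (p n <= n)%N) -> (forall n, \rank (X n) = p n) ->
      (forall n, 0 < lambda n) ->
      (forall n, lasso_set (X n) (lambda n) (mu0 n)) ->
      (forall n, lasso_set (X n) (lambda n) (mu n)) ->
      (forall n, standard_gaussian (@xi n)) ->
      p n @[n --> \oo] --> \oo ->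
      (n%:R * Num.max
         (Num.sqrt (exit_prob (X n) (lambda n) (mu n) (@xi n)))
         (Num.sqrt (exit_prob (X n) (lambda n) (mu0 n) (@xi n))) : R)
        @[n --> \oo] --> (0 : R) ->
      (power_two_sided (lasso_set (X n) (lambda n)) alpha (mu0 n) (mu n) (@xi n)
         @[n --> \oo] --> (1 : R)
       <->
       (enorm (mu n - mu0 n) / ((p n)%:R `^ (1 / 4)) : R)
         @[n --> \oo] --> +oo)).
Proof.
have nc : 0 <= @null_cst R.
  by rewrite /null_cst; have := @mills_cst_ge1 R; lra.
split; [|split].
- exists (@null_cst R + 515); split; first lra.
  move=> n p X lambda mu0 d T P xi p0 pn rX l0 K0 sg /=.
  exact: (null_dTV_bound rX l0 sg K0).
- move=> alpha p X lambda mu0 d T P xi a0 a1 pn rX l0 K0 sg pinf qlim.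
  apply/eqO_exP; exists (1 + @null_cst R); first lra.
  have ev1 := near_sqrt_ge (514 : R) pinf.
  have ev2 : \forall n \near \oo,
      n%:R * Num.sqrt (exit_prob (X n) (lambda n) (mu0 n) (@xi n)) <= 1 :> R.
    move/cvgrPdist_le : qlim => /(_ 1 ltr01); apply: filterS => n.
    by rewrite sub0r normrN; exact: le_trans (ler_norm _).
  suff ev : \forall n \near \oo,
      `|power_two_sided (lasso_set (X n) (lambda n)) alpha (mu0 n) (mu0 n) (@xi n) - alpha|
        <= (1 + null_cst) * `|(Num.sqrt (p n)%:R)^-1| :> R by exact: ev.
  apply: (filterS2 _ _ ev1 ev2) => n h1 h2.
  have sp0 : 0 < Num.sqrt (p n)%:R :> R by apply: lt_le_trans h1; rewrite ltr0n.
  have p0 : (0 < p n)%N by move: sp0; rewrite sqrtr_gt0 ltr0n.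
  have [qs q2] := exit_prob_le p0 (pn n) h1 h2.
  have := size_error (rX n) (l0 n) (sg n) (K0 n) a0 a1 h1 q2.
  have -> : `|(Num.sqrt (p n)%:R)^-1| = (Num.sqrt (p n)%:R)^-1 :> R.
    by rewrite ger0_norm// invr_ge0 ltW.
  have -> : (1 + null_cst) * (Num.sqrt (p n)%:R)^-1 =
      (Num.sqrt (p n)%:R)^-1 + null_cst / Num.sqrt (p n)%:R :> R.
    by rewrite [LHS]mulrDl mul1r.
  by move/le_trans; apply; rewrite lerD2r.
- move=> alpha p X lambda mu0 mu d T P xi a0 a1 pn rX l0 K0 Kmu sg pinf qlim.
  have ev1 := near_sqrt_ge (514 : R) pinf.
  have ev2 := near_max_le1 qlim.
  set z := normal_upper_quantile (alpha / 2).
  have z0 : 0 < z := quantile_gt0 a0 a1.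
  pose sp n : R := Num.sqrt (p n)%:R.
  pose Delta n := nrm2 (mu n - mu0 n).
  have D0 n : 0 <= Delta n by exact: nrm2_ge0.
  pose pw n := power_two_sided (lasso_set (X n) (lambda n)) alpha (mu0 n) (mu n) (@xi n).
  have key : \forall n \near \oo, [/\ 1 <= sp n, (0 < p n)%N,
      (forall M : R, Delta n <= M * sp n ->
        z * normal_pdf 0 1 (M + z) - (null_cst + 16 * M / z ^+ 2 + 1) / sp n <= 1 - pw n),
      0 <= 1 - pw n &
      (4 * z * sp n <= Delta n ->
        1 - pw n <= (sp n)^-1 + (16 * (p n)%:R + 32 * Delta n) / Delta n ^+ 2)].
    apply: (filterS2 _ _ ev1 ev2) => n h1 [h2 h3].
    have sp0 : 0 < sp n by apply: lt_le_trans h1; rewrite ltr0n.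
    have p0 : (0 < p n)%N by move: sp0; rewrite sqrtr_gt0 ltr0n.
    have [qs q2] := exit_prob_le p0 (pn n) h1 h2.
    have [qs0 q20] := exit_prob_le p0 (pn n) h1 h3.
    have pe := powerE (rX n) (l0 n) (sg n) (K0 n) (Kmu n) alpha.
    split=> //.
    + by apply: le_trans h1; rewrite ler1n.
    + move=> M DM; rewrite /pw pe.
      apply: le_trans (miss_ge (rX n) (l0 n) (sg n) (K0 n) (Kmu n) h1 q20 z0 DM).
      have -> : (null_cst + 16 * M / z ^+ 2 + 1) / sp n =
         null_cst / sp n + 16 * M / (z ^+ 2 * sp n) + (sp n)^-1.
        by field; rewrite !gt_eqF.
      by rewrite -/(sp n); move: qs; rewrite -/(sp n); lra.
    + by rewrite subr_ge0; exact: (power_le1 (rX n) (l0 n) (sg n) (K0 n) (Kmu n)).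
    + move=> zD; rewrite /pw pe.
      apply: (le_trans (miss_le (rX n) (l0 n) (sg n) (K0 n) (Kmu n) h1 q20 z0 zD)).
      by rewrite lerD2r.
  split.
  + move=> /cvgrPdist_le pw1; apply/cvgryPge => A.
    pose M := A ^+ 2.
    have e0 : 0 < z * normal_pdf 0 1 (M + z) / 3 by rewrite divr_gt0// mulr_gt0// phi_gt0.
    have ev3 := near_sqrt_ge ((null_cst + 16 * M / z ^+ 2 + 1) / (z * normal_pdf 0 1 (M + z) / 3)) pinf.
    apply: (filterS3 _ _ key (pw1 _ e0) ev3) => n [sp1 p0 hM _ _] h1 h2.
    have sp0 : 0 < sp n by apply: lt_le_trans sp1.
    rewrite leNgt; apply/negP => rA.
    have r0 : 0 <= enorm (mu n - mu0 n) / (p n)%:R `^ (1 / 4).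
      by rewrite divr_ge0 ?enorm_ge0// powR_ge0.
    have : Delta n <= M * sp n.
      rewrite -ler_pdivrMr// -enorm_ratio_sqr// /M lerXn2r ?nnegrE ?(ltW rA)//.
      by apply: le_trans (ltW rA).
    move=> /hM h3; have h4 := le_trans (ler_norm _) h1; rewrite -/(pw n) in h4.
    have h5 : (null_cst + 16 * M / z ^+ 2 + 1) / sp n <= z * normal_pdf 0 1 (M + z) / 3.
      by rewrite ler_pdivrMr// [leRHS]mulrC -ler_pdivrMr.
    by move: e0 h3 h4 h5; lra.
  + move=> /cvgryPge rinf; apply/cvgrPdist_le => eps eps0.
    (* [4 z <= t] is what [miss_le] asks for, and [96 / eps <= t] makes its right side
       small. *)
    pose t := Num.max (Num.max 1 (4 * z)) (96 / eps).
    have t1 : 1 <= t by rewrite !le_max lexx.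
    have tz : 4 * z <= t by rewrite !le_max lexx orbT.
    have te : 96 / eps <= t by rewrite !le_max lexx orbT.
    have ev3 := near_sqrt_ge (2 / eps) pinf.
    apply: (filterS3 _ _ key (rinf t) ev3) => n [sp1 p0 _ h0 hD] h1 h2.
    have sp0 : 0 < sp n by apply: lt_le_trans sp1.
    have sp2 : sp n ^+ 2 = (p n)%:R by rewrite sqr_sqrtr.
    have t0 : 0 < t by apply: lt_le_trans t1.
    have Dt : t * sp n <= Delta n.
      rewrite -ler_pdivlMr// -enorm_ratio_sqr//.
      apply: (@le_trans _ _ (t ^+ 2)); first by rewrite expr2 ler_peMl// ltW.
      by rewrite lerXn2r ?nnegrE ?(ltW t0)// (le_trans (ltW t0) h1).
    rewrite ger0_norm//; apply: le_trans (hD _) _.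
      by apply: le_trans Dt; rewrite ler_wpM2r// ltW.
    have Dp : 0 < Delta n by apply: lt_le_trans Dt; rewrite mulr_gt0.
    have b1 : (sp n)^-1 <= eps / 2.
      rewrite -div1r ler_pdivrMr//; move: h2; rewrite ler_pdivrMr// -/(sp n); lra.
    have b2 : (16 * (p n)%:R + 32 * Delta n) / Delta n ^+ 2 <= 48 / t.
      rewrite ler_pdivrMr ?exprn_gt0// mulrAC ler_pdivlMr// -sp2.
      move: Dt t1 sp1 Dp; move: (Delta n) (sp n) => D u.
      move=> Dt t1 u1 Dp.
      have a1' : u * t <= D by rewrite mulrC.
      have uD : u <= D by apply: le_trans a1'; rewrite ler_peMr// (le_trans ler01).
      have tD : t <= D by apply: le_trans Dt; rewrite ler_peMr// ltW.
      have c1 : u ^+ 2 * t <= D ^+ 2.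
        by rewrite !expr2 -mulrA ler_pM// ?mulr_ge0// ?(le_trans ler01)// ltW.
      have c2 : D * t <= D ^+ 2 by rewrite expr2 ler_wpM2l// ltW.
      lra.
    have b3 : 48 / t <= eps / 2.
      by rewrite ler_pdivrMr//; move: te; rewrite ler_pdivrMr//; lra.
    lra.
Qed.
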